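(* Let $M$ be a complete hyperbolic complex manifold. The set of infinitesimal generators on $M$ is a closed convex cone with vertex in $0$ in the real vector space of holomorphic vector fields on $M$, endowed with the topology of uniform convergence on compacta.
   Context: Complex manifolds are connected. $M$ is complete hyperbolic if its Kobayashi pseudodistance $k_M$ is a distance and $(M,k_M)$ is a complete metric space. A holomorphic vector field $H$ on $M$ is an infinitesimal generator if for every $z_0\in M$ the Cauchy problem $\dot z(t)=H(z(t))$, $z(0)=z_0$, has a solution $z\colon[0,+\infty)\to M$. A convex cone with vertex in $0$ is a subset containing $0$ that is closed under addition and under multiplication by non-negative real numbers. *)

(* Defs.v *)
From HB Require Import structures.
From mathcomp Require Import all_boot all_order all_algebra.
From mathcomp Require Import complex.
From mathcomp Require Import all_classical all_reals all_analysis.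

Set Implicit Arguments.
Unset Strict Implicit.
Unset Printing Implicit Defensive.

Import Order.TTheory GRing.Theory Num.Theory.
Import numFieldNormedType.Exports.

Local Open Scope classical_set_scope.
Local Open Scope ring_scope.
Local Open Scope complex_scope.

(* [R[i]] packed as a numClosedFieldType, so that its topology and the norms on
   row vectors over it are inferred. *)
Definition Cplx (R : realType) : numClosedFieldType := R[i].
Definition Cn (R : realType) (n : nat) : normedModType (Cplx R) := 'rV[Cplx R]_n.

(* [differentiable] is Frechet differentiability over the scalars [Cplx R], that
   is, complex differentiability. *)
Definition holomorphic_on (R : realType) (V W : normedModType (Cplx R))
  (U : set V) (f : V -> W) := forall x, U x -> differentiable f x.

(* Each chart is a total function together with a total inverse; only
   their values on [cdom i] and on [cmap i @` cdom i] matter. *)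
Record complexManifold (R : realType) (n : nat) := ComplexManifold {
  carrier :> topologicalType ;
  index : Type ;
  cdom : index -> set carrier ;
  cmap : index -> carrier -> Cn R n ;
  cinv : index -> Cn R n -> carrier ;
  mfd_hausdorff : hausdorff_space carrier ;
  mfd_second_countable : @second_countable carrier ;
  mfd_connected : connected [set: carrier] ;
  cdom_cover : forall p, exists i, cdom i p ;
  cdom_open : forall i, open (cdom i) ;
  cimg_open : forall i, open (cmap i @` cdom i) ;
  cmapK : forall i p, cdom i p -> cinv i (cmap i p) = p ;
  cmap_continuous : forall i, {within cdom i, continuous (cmap i)} ;
  cinv_continuous : forall i, {within cmap i @` cdom i, continuous (cinv i)} ;
  transition_holomorphic : forall i j,
    holomorphic_on (cmap i @` (cdom i `&` cdom j)) (cmap j \o cinv i)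
}.

Section Kobayashi.
Variables (R : realType) (n : nat) (M : complexManifold R n).

Definition unit_disc : set (Cplx R) := [set z | `|z| < 1].

(* A holomorphic map from the disc to [M]; its values off the disc are
   irrelevant. *)
Definition holomorphic_disc (f : Cplx R -> M) :=
  forall z, unit_disc z -> {for z, continuous f} /\
    forall i, cdom i (f z) -> differentiable (@cmap R n M i \o f) z.

Definition poincare_dist (z w : Cplx R) : R :=
  let m := complex.Re `|(z - w) / (1 - z * w^*)| in
  2^-1 * ln ((1 + m) / (1 - m)).

Definition disc_chain_length (p q : M) : set R :=
  [set s | exists m (x : nat -> M) (f : nat -> Cplx R -> M) (a b : nat -> Cplx R),
    [/\ x 0%N = p, x m = q,
        forall j, (j < m)%N ->
          [/\ holomorphic_disc (f j), unit_disc (a j), unit_disc (b j),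
              f j (a j) = x j & f j (b j) = x j.+1]
      & s = \sum_(j < m) poincare_dist (a j) (b j)]].

Definition kobayashi (p q : M) : R := inf (disc_chain_length p q).

End Kobayashi.

Section Distance.
Variables (R : realType) (T : Type) (d : T -> T -> R).

Definition is_distance :=
  [/\ forall x y, 0 <= d x y,
      forall x y, d x y = 0 <-> x = y,
      forall x y, d x y = d y x
    & forall x y z, d x z <= d x y + d y z].

Definition complete_distance :=
  forall u : nat -> T,
    (forall e, 0 < e -> exists N, forall k l, (N <= k)%N -> (N <= l)%N ->
       d (u k) (u l) < e) ->
    exists x, (fun k => d (u k) x) @ \oo --> (0 : R).

End Distance.

Definition complete_hyperbolic (R : realType) (n : nat)
    (M : complexManifold R n) :=
  is_distance (@kobayashi R n M) /\ complete_distance (@kobayashi R n M).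

Section VectorFields.
Variables (R : realType) (n : nat) (M : complexManifold R n).

Local Notation pre_vfield := (index M -> M -> Cn R n).

(* A vector field is given by its expressions [X i] in the charts, which
   transform by the differentials of the transition maps. Extending [X i] by 0
   off its chart makes this representation unique. *)
Definition is_vfield (X : pre_vfield) :=
  [/\ forall i p, ~ cdom i p -> X i p = 0,
      forall i j p, cdom i p -> cdom j p ->
        X j p = 'd (@cmap R n M j \o cinv i) (cmap i p) (X i p)
    & forall i, holomorphic_on (cmap i @` cdom i) (X i \o cinv i)].

Definition vfield_pred : {pred pre_vfield} := [pred X | `[< is_vfield X >]].

Lemma is_vfield0 : is_vfield 0.
Proof.
split; first by [].
- move=> i j p _ _; change (0 = 'd (@cmap R n M j \o cinv i) (cmap i p) 0).
  by rewrite linear0.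
- by move=> i x _; apply: differentiable_cst.
Qed.

Lemma is_vfieldB X Y : is_vfield X -> is_vfield Y -> is_vfield (X - Y).
Proof.
move=> [X0 Xt Xh] [Y0 Yt Yh]; split=> [i p ip|i j p ip jp|i x ix].
- change (X i p - Y i p = 0).
  by rewrite (X0 _ _ ip) (Y0 _ _ ip) subrr.
- change (X j p - Y j p =
    'd (@cmap R n M j \o cinv i) (cmap i p) (X i p - Y i p)).
  by rewrite linearB -(Xt _ _ _ ip jp) -(Yt _ _ _ ip jp).
- have -> : (X - Y) i \o cinv i = (X i \o cinv i) - (Y i \o cinv i) by [].
  by apply: differentiableB; [exact: Xh | exact: Yh].
Qed.

Definition pre_scale (a : R) (X : pre_vfield) : pre_vfield :=
  fun i p => (a%:C : Cplx R) *: X i p.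

Lemma is_vfieldZ a X : is_vfield X -> is_vfield (pre_scale a X).
Proof.
move=> [X0 Xt Xh]; split=> [i p ip|i j p ip jp|i x ix].
- by rewrite /pre_scale (X0 _ _ ip) scaler0.
- by rewrite /pre_scale linearZ -(Xt _ _ _ ip jp).
- have -> : pre_scale a X i \o cinv i = (a%:C : Cplx R) *: (X i \o cinv i) by [].
  by apply: differentiableZ; exact: Xh.
Qed.

Lemma vfield_zmod_closed : zmod_closed vfield_pred.
Proof.
split; first exact/asboolP/is_vfield0.
by move=> X Y /asboolP hX /asboolP hY; apply/asboolP/is_vfieldB.
Qed.

HB.instance Definition _ :=
  GRing.isZmodClosed.Build pre_vfield vfield_pred vfield_zmod_closed.

Record vfield := VField { vf :> pre_vfield ; _ : vf \in vfield_pred }.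

HB.instance Definition _ := [isSub for vf].
HB.instance Definition _ := [Choice of vfield by <:].
HB.instance Definition _ := [SubChoice_isSubZmodule of vfield by <:].

Lemma vfieldP (X : vfield) : is_vfield X.
Proof. by case: X => X /= /asboolP. Qed.

Definition vfield_scale (a : R) (X : vfield) : vfield :=
  VField (asboolT (is_vfieldZ a (vfieldP X))).

Lemma vfield_scaleA a b X :
  vfield_scale a (vfield_scale b X) = vfield_scale (a * b) X.
Proof.
apply/val_inj/funext => i; apply/funext => p /=.
by rewrite /pre_scale scalerA -rmorphM.
Qed.

Lemma vfield_scale1 : left_id 1 vfield_scale.
Proof.
by move=> X; apply/val_inj/funext => i; apply/funext => p /=; exact: scale1r.
Qed.

Lemma vfield_scaleDr : right_distributive vfield_scale +%R.
Proof.
by move=> a X Y; apply/val_inj/funext => i; apply/funext => p /=; exact: scalerDr.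
Qed.

Lemma vfield_scaleDl X : {morph vfield_scale^~ X : a b / a + b}.
Proof.
move=> a b; apply/val_inj/funext => i; apply/funext => p /=.
by rewrite /pre_scale rmorphD scalerDl.
Qed.

HB.instance Definition _ := GRing.Zmodule_isLmodule.Build R vfield
  vfield_scaleA vfield_scale1 vfield_scaleDr vfield_scaleDl.

(* Uniform convergence on compacta: the coarsest topology for which, in every
   chart [i], the map sending [X] to [X i] is continuous for uniform convergence
   on the compact subsets of [cdom i]. Every compact subset of [M] is a finite
   union of compact sets contained in charts. *)
Definition vfield_chart (i : index M) (X : vfield) :
  {family compactly_in (cdom i), M -> Cn R n} := X i.

HB.instance Definition _ := Topological.copy vfield
  (sup_topology (fun i => Topological.class (initial_topology (vfield_chart i)))).

(* [z] is only relevant on [0, +oo[; its derivative at 0 is one-sided. *)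
Definition integral_curve (X : vfield) (z : R -> M) :=
  {within `[0, +oo[, continuous z} /\
  forall t, 0 <= t -> forall i, cdom i (z t) ->
    ((h^-1)%:C : Cplx R) *: (cmap i (z (t + h)) - cmap i (z t))
      @[h --> within [set h | 0 <= t + h] (0 : R)^'] --> X i (z t).

Definition infinitesimal_generator : set vfield :=
  [set X | forall z0, exists z : R -> M, z 0 = z0 /\ integral_curve X z].

End VectorFields.
Arguments infinitesimal_generator {R n} M _.

Definition convex_cone0 (R : realType) (V : lmodType R) (A : set V) :=
  [/\ A 0,
      forall x y, A x -> A y -> A (x + y)
    & forall (a : R) x, 0 <= a -> A x -> A (a *: x)].

(* Main.v *)
From HB Require Import structures.
From mathcomp Require Import all_boot all_order all_algebra.
From mathcomp Require Import complex.
From mathcomp Require Import all_classical all_reals all_analysis.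
From mathcomp Require Import ring lra.
Require Import Defs.

(* The flow of an infinitesimal generator maps holomorphic discs to holomorphic
   discs, hence does not increase the Kobayashi distance k. Let X be a vector field
   which, to first order at any two given points, is approximated by maps that do not
   increase k: for X + Y take the composition of the two flows at time h, and for a
   limit of generators the flow of a generator close to X at the two points. Since k
   is bounded above by a multiple of the coordinate distance in every chart,
   comparing two integral curves of X with these maps shows that the upper Dini
   derivative of their k-distance is nonpositive. Thus an integral curve z satisfies
   k(z(t), z(t + s)) <= k(z(0), z(s)), and it is k-Cauchy when the time increases to
   a finite bound. As k is complete and induces the topology of M, the curve has a
   limit and extends past the bound, so X is a generator. *)

Set Implicit Arguments.
Unset Strict Implicit.
Unset Printing Implicit Defensive.

Import Order.TTheory GRing.Theory Num.Theory.
Import numFieldNormedType.Exports.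

Local Open Scope classical_set_scope.
Local Open Scope ring_scope.
Local Open Scope complex_scope.

(** * Linear identities in a module *)

Section LmodReflection.
Variables (K : comPzRingType) (V : lmodType K).

(** An integral curve is a bare solution of a differential equation, with no regularity in its
    starting point, so holomorphy of the flow has to be proved. Euler polygons are holomorphic in
    the disc parameter, and Weierstrass's theorem passes this to their limit; the Cauchy estimates
    behind it come from Goursat's lemma on rectangles. The same estimates make holomorphic fields
    locally Lipschitz, as Picard iteration requires.

    A sum or a limit of generators has no flow yet, and [k] has no derivative. Hence the comparison
    is infinitesimal and concerns two points at a time: the triangle inequality turns first order
    contact into an error proportional to the elapsed time. Only forward increments enter, which is
    why derivatives are taken from the right throughout. The resulting inequality is applied to a
    curve and its own translate by [s]. Their initial distance tends to 0 with [s] by continuity of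
    the curve, so nonexpansion yields the Cauchy condition with no bound on the speed of the
    curve. *)

Inductive vexp :=
  | VAtom of nat | VZero | VAdd of vexp & vexp | VOpp of vexp | VScale of K & vexp.

Fixpoint vdenote (env : seq V) (e : vexp) : V :=
  match e with
  | VAtom i => nth 0 env i
  | VZero => 0
  | VAdd e1 e2 => vdenote env e1 + vdenote env e2
  | VOpp e1 => - vdenote env e1
  | VScale a e1 => a *: vdenote env e1
  end.

Fixpoint vcoef (e : vexp) (j : nat) : K :=
  match e with
  | VAtom i => if eqn i j then 1 else 0
  | VZero => 0
  | VAdd e1 e2 => vcoef e1 j + vcoef e2 j
  | VOpp e1 => - vcoef e1 j
  | VScale a e1 => a * vcoef e1 j
  end.

(** A recursive conjunction instead of a quantifier, so that [cbn] unfolds it into one [ring] goal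
    for each atom. *)
Fixpoint vall (P : nat -> Prop) (m n : nat) : Prop :=
  if n is n'.+1 then P m /\ vall P m.+1 n' else True.

Lemma vallP P m n i : vall P m n -> (m <= i < m + n)%N -> P i.
Proof.
elim: n m => [|n IH] m /=; first by rewrite addn0 leqNgt andNb.
move=> [Pm Pn] /andP[]; rewrite leq_eqVlt => /orP[/eqP<- //|mi im].
by apply: IH Pn _; rewrite mi addSnnS.
Qed.

Lemma vdenoteE env e : vdenote env e = \sum_(i < size env) vcoef e i *: nth 0 env i.
Proof.
elim: e => [k||e1 IH1 e2 IH2|e IH|a e IH] /=.
- have [ks|ks] := ltnP k (size env); last first.
    rewrite nth_default // big1 // => i _; case: eqnP => [ki|_]; last by rewrite scale0r.
    by move: ks; rewrite ki leqNgt ltn_ord.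
  rewrite (bigD1 (Ordinal ks)) //= big1 => [|i ik]; first by case: eqnP => // _; rewrite scale1r addr0.
  by case: eqnP => [ki|_]; rewrite ?scale0r //; move: ik; rewrite -val_eqE /= -ki eqxx.
- by rewrite big1 // => i _; rewrite scale0r.
- by rewrite IH1 IH2 -big_split /=; apply: eq_bigr => i _; rewrite scalerDl.
- by rewrite IH -sumrN; apply: eq_bigr => i _; rewrite scaleNr.
- by rewrite IH scaler_sumr; apply: eq_bigr => i _; rewrite scalerA.
Qed.

Lemma vdenote_eq env e1 e2 :
  vall (fun i => vcoef e1 i = vcoef e2 i) 0 (size env) -> vdenote env e1 = vdenote env e2.
Proof.
move=> h; rewrite !vdenoteE; apply: eq_bigr => i _.
by rewrite (vallP h) // add0n ltn_ord.
Qed.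

End LmodReflection.

(* [ring] does not apply to module identities: [lmod] reifies both sides as linear
   combinations of atoms and compares the coefficients with [ring]. *)
Ltac lmod_index x env :=
  lazymatch env with
  | cons x _ => constr:(0%N)
  | cons _ ?env' => let i := lmod_index x env' in constr:(S i)
  end.
Ltac lmod_mem x env :=
  lazymatch env with
  | nil => constr:(false)
  | cons x _ => constr:(true)
  | cons _ ?env' => lmod_mem x env'
  end.
Ltac lmod_env t env :=
  lazymatch t with
  | GRing.add ?a ?b => let env := lmod_env a env in lmod_env b env
  | GRing.opp ?a => lmod_env a env
  | GRing.scale _ ?a => lmod_env a env
  | GRing.zero => env
  | _ => lazymatch lmod_mem t env with
         | true => env
         | false => constr:(cons t env)
         end
  end.
Ltac lmod_reify K V t env :=
  lazymatch t with
  | GRing.add ?a ?b =>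
      let x := lmod_reify K V a env in let y := lmod_reify K V b env in
      constr:(@VAdd K x y)
  | GRing.opp ?a => let x := lmod_reify K V a env in constr:(@VOpp K x)
  | GRing.scale ?k ?a => let x := lmod_reify K V a env in constr:(@VScale K k x)
  | GRing.zero => constr:(@VZero K)
  | _ => let i := lmod_index t env in constr:(@VAtom K i)
  end.
Tactic Notation "lmod" constr(K0) constr(V0) :=
  let K := constr:(K0 : comPzRingType) in
  let V := constr:(V0 : lmodType K) in
  lazymatch goal with
  | |- ?l = ?r =>
    let env := lmod_env l (@nil (GRing.Lmodule.sort V)) in let env := lmod_env r env in
    let x := lmod_reify K V l env in let y := lmod_reify K V r env in
    change (@vdenote K V env x = @vdenote K V env y);
    apply: vdenote_eq; cbn [vall size vcoef eqn]; repeat split; ring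
  end.

(** * Real induction and Dini derivatives *)

Section RealAnalysis.
Variable R : realType.
Implicit Types (a b t s : R).

(** The supremum [S] of the times up to which [P] holds throughout satisfies [P] by the limit
    hypothesis; the extension hypothesis then forces [S = T]. *)
Lemma real_induction (P : R -> Prop) (T : R) : 0 <= T -> P 0 ->
  (forall t, 0 <= t < T -> P t ->
     exists2 d, 0 < d & forall s, t < s < t + d -> s <= T -> P s) ->
  (forall t, 0 < t <= T -> (forall s, 0 <= s < t -> P s) -> P t) ->
  forall t, 0 <= t <= T -> P t.
Proof.
move=> T0 P0 Pext Plim.
pose E := [set s : R | 0 <= s <= T /\ forall u, 0 <= u <= s -> P u].
have E0 : E 0.
  by split=> [|u u0]; [rewrite lexx T0 | have -> : u = 0 by lra].
have Eub : has_ubound E by exists T => s [] /andP[].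
have Esup : has_sup E by split; [exists 0 | exact: Eub].
set S := sup E.
have S0 : 0 <= S by apply: ub_le_sup.
have ST : S <= T by apply: ge_sup => [|s []/andP[]//]; exists 0.
have Plt s : 0 <= s < S -> P s.
  move=> /andP[s0 sS]; have [e [_ Pe] se] := sup_adherent (ltac:(lra) : 0 < S - s) Esup.
  by apply: Pe; rewrite s0 /=; move: se; rewrite -/S; lra.
have PS : P S.
  have [->//|S0'] := eqVneq S 0.
  by apply: Plim => //; rewrite ST lt0r S0' S0.
have Ple s : 0 <= s <= S -> P s.
  move=> /andP[s0]; rewrite le_eqVlt => /orP[/eqP->//|sS].
  by apply: Plt; rewrite s0.
have [<-|ST'] := eqVneq S T; first exact: Ple.
have STlt : S < T by rewrite lt_neqAle ST' ST.
have [d d0 Pd] := Pext S (ltac:(by rewrite S0 STlt)) PS.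
pose m := Num.min T (S + d / 2).
have mT : m <= T by rewrite /m ge_min lexx.
have md : m <= S + d / 2 by rewrite /m ge_min lexx orbT.
have Sm : S < m by rewrite /m lt_min STlt /=; lra.
have : E m.
  split; first by rewrite mT; lra.
  move=> u /andP[u0 um]; have [uS|Su] := leP u S; first by apply: Ple; rewrite u0.
  by apply: Pd; lra.
by move=> /(ub_le_sup Eub); rewrite -/S; lra.
Qed.

(** The distance is a parameter so that real functions and curves in complex normed modules share
    one predicate with real radii. *)
Definition contd (T : Type) (d : T -> T -> R) (c : R -> T) a b :=
  forall t, a <= t <= b -> forall e : R, 0 < e -> exists2 r : R, 0 < r &
    forall s, a <= s <= b -> `|s - t| < r -> d (c s) (c t) < e.

Definition distR (x y : R) : R := `|x - y|.

(** If [g] rose, let [e] be half the slope of its chord: the bound by the line of slope [e] through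
    the left endpoint propagates up to [b] by real induction, which is absurd. *)
Lemma dini_le (g : R -> R) a b : a <= b -> contd distR g a b ->
  (forall t, a <= t < b -> forall e : R, 0 < e -> exists2 r : R, 0 < r &
     forall h : R, 0 < h < r -> t + h <= b -> g (t + h) <= g t + e * h) ->
  g b <= g a.
Proof.
move=> ab gc gd; rewrite leNgt; apply/negP => gab.
have [ab'|ab'] := eqVneq a b; first by move: gab; rewrite ab' ltxx.
have {ab'} ab' : 0 < b - a by rewrite subr_gt0 lt_neqAle ab' ab.
pose e := (g b - g a) / (b - a) / 2.
have e0 : 0 < e by rewrite divr_gt0 // divr_gt0 // subr_gt0.
suff : g (a + (b - a)) <= g a + e * (b - a).
  rewrite (_ : a + (b - a) = b); last by ring.
  have -> : e * (b - a) = (g b - g a) / 2 by rewrite /e; field; lra.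
  lra.
apply: (@real_induction (fun t => g (a + t) <= g a + e * t) (b - a)) => /=; try lra.
- by rewrite addr0 mulr0 addr0.
- move=> t t0 Pt; have [r r0 gr] := gd (a + t) (ltac:(lra)) e e0.
  exists r => // s s0 sb; have := gr (s - t) (ltac:(lra)) (ltac:(lra)).
  rewrite (_ : a + t + (s - t) = a + s); last by ring.
  nra.
- move=> t t0 Ps; apply/ler_addgt0Pr => x x0.
  have [r r0 gr] := gc (a + t) (ltac:(lra)) x x0.
  pose s := Num.max 0 (t - r / 2).
  have s1 : 0 <= s by rewrite /s le_max lexx.
  have s2 : s < t by rewrite /s gt_max; lra.
  have s3 : t - r / 2 <= s by rewrite /s le_max lexx orbT.
  have := gr (a + s) (ltac:(lra)) (ltac:(rewrite ltr_norml; lra)).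
  have := Ps s (ltac:(lra)).
  rewrite /distR ltr_norml => h1 /andP[h2 h3].
  have : e * s <= e * t by rewrite ler_pM2l // ltW.
  lra.
Qed.

End RealAnalysis.

(** * The real-valued norm on complex normed modules *)

Section RealNorm.
Variable R : realType.

Definition rc (r : R) : Cplx R := r%:C.

Lemma rc0 : rc 0 = 0. Proof. by []. Qed.
Lemma rc1 : rc 1 = 1. Proof. by []. Qed.
Lemma rcD r s : rc (r + s) = rc r + rc s. Proof. exact: (rmorphD (real_complex R)). Qed.
Lemma rcN r : rc (- r) = - rc r. Proof. exact: (rmorphN (real_complex R)). Qed.
Lemma rcB r s : rc (r - s) = rc r - rc s. Proof. exact: (rmorphB (real_complex R)). Qed.
Lemma rcM r s : rc (r * s) = rc r * rc s. Proof. exact: (rmorphM (real_complex R)). Qed.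
Lemma rcV r : rc r^-1 = (rc r)^-1. Proof. exact: (fmorphV (real_complex R)). Qed.
Lemma rc_inj : injective rc. Proof. by move=> r s []. Qed.
Lemma rc_eq0 r : (rc r == 0) = (r == 0). Proof. exact: (fmorph_eq0 (real_complex R)). Qed.
Lemma ltr_rc r s : (rc r < rc s) = (r < s). Proof. exact: ltcR. Qed.
Lemma ler_rc r s : (rc r <= rc s) = (r <= s). Proof. exact: lecR. Qed.

Definition re (z : Cplx R) : R := complex.Re z.
Definition im (z : Cplx R) : R := complex.Im z.
Definition ci : Cplx R := 'i%C.
Lemma cE z : z = rc (re z) + ci * rc (im z).
Proof. by rewrite [LHS]complexE. Qed.
Lemma reD z w : re (z + w) = re z + re w. Proof. by case: z; case: w. Qed.
Lemma imD z w : im (z + w) = im z + im w. Proof. by case: z; case: w. Qed.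
Lemma reN z : re (- z) = - re z. Proof. by case: z. Qed.
Lemma imN z : im (- z) = - im z. Proof. by case: z. Qed.
Lemma reM z w : re (z * w) = re z * re w - im z * im w. Proof. by case: z; case: w. Qed.
Lemma imM z w : im (z * w) = re z * im w + im z * re w.
Proof. by case: z => a b; case: w => c d. Qed.
Lemma re_rc r : re (rc r) = r. Proof. by []. Qed.
Lemma im_rc r : im (rc r) = 0. Proof. by []. Qed.
Lemma re_ci : re ci = 0. Proof. by []. Qed.
Lemma im_ci : im ci = 1. Proof. by []. Qed.
Lemma ci2 : ci * ci = -1.
Proof. by rewrite -expr2; exact: sqr_i. Qed.
Lemma c_ext z w : re z = re w -> im z = im w -> z = w.
Proof. by move=> h1 h2; rewrite (cE z) (cE w) h1 h2. Qed.

Section Mod.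
Variable V : normedModType (Cplx R).
Implicit Types (v w : V) (z : Cplx R).

(* The norm of a normed module over [R[i]] takes its values in [R[i]]; [nr] is the
   same norm with values in [R]. *)
Definition nr (v : V) : R := complex.Re `|v|.

Lemma nrE v : `|v| = rc (nr v).
Proof.
have : (0 : Cplx R) <= `|v| by [].
rewrite /nr; case: (`|v|) => a b /=.
by rewrite lecE /= => /andP[/eqP -> _].
Qed.

Lemma nr_ge0 v : 0 <= nr v.
Proof. by rewrite -ler_rc rc0 -nrE. Qed.
Lemma nr0 : nr 0 = 0.
Proof. by apply: rc_inj; rewrite -nrE normr0. Qed.
Lemma nrN v : nr (- v) = nr v.
Proof. by apply: rc_inj; rewrite -!nrE normrN. Qed.
Lemma nr_distC v w : nr (v - w) = nr (w - v).
Proof. by rewrite -nrN opprB. Qed.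
Lemma nrD v w : nr (v + w) <= nr v + nr w.
Proof. by rewrite -ler_rc rcD -!nrE; exact: ler_normD. Qed.
Lemma nrB v w : nr (v - w) <= nr v + nr w.
Proof. by rewrite (le_trans (nrD _ _)) ?nrN. Qed.
Lemma nr_dist v w u : nr (v - u) <= nr (v - w) + nr (w - u).
Proof. by rewrite -{1}(subrKA w); exact: nrD. Qed.
Lemma nr_eq0 v : nr v = 0 -> v = 0.
Proof. by move=> h; apply/eqP; rewrite -normr_eq0 nrE h. Qed.
Lemma nr_le0 v : nr v <= 0 -> v = 0.
Proof. by move=> h; apply: nr_eq0; apply/eqP; rewrite eq_le h nr_ge0. Qed.

Lemma nbhs_nr (x : V) (A : set V) :
  nbhs x A <-> exists2 e : R, 0 < e & forall y, nr (y - x) < e -> A y.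
Proof.
split=> [/nbhs_ballP[e e0 eA]|[e e0 eA]].
- have e0' : 0 < re e by move: e0; rewrite /= ltcE => /andP[].
  have eE : e = rc (re e).
    by move: e0; rewrite /= ltcE /= => /andP[/eqP h _]; apply: c_ext.
  exists (re e) => // y yx; apply: eA.
  by rewrite -ball_normE /ball_ /= eE nrE ltr_rc nr_distC.
- apply/nbhs_ballP; exists (rc e); first by rewrite /= -rc0 ltr_rc.
  by move=> y; rewrite -ball_normE /ball_ /= nrE ltr_rc nr_distC => /eA.
Qed.

End Mod.

Lemma nrM (z w : Cplx R) : nr (z * w) = nr z * nr w.
Proof. by apply: rc_inj; rewrite rcM -!nrE normrM. Qed.
Lemma nrV (z : Cplx R) : nr z^-1 = (nr z)^-1.
Proof. by apply: rc_inj; rewrite rcV -!nrE normfV. Qed.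
Lemma nr_rc r : nr (rc r : Cplx R) = `|r|.
Proof. by rewrite /nr /= expr0n addr0 sqrtr_sqr. Qed.
Lemma nr1 : nr (1 : Cplx R) = 1.
Proof. by rewrite -rc1 nr_rc normr1. Qed.
Lemma nr_ci : nr ci = 1.
Proof. by rewrite /nr /= expr0n expr1n add0r sqrtr1. Qed.
Lemma nrZ (V : normedModType (Cplx R)) (z : Cplx R) (v : V) :
  nr (z *: v) = nr z * nr v.
Proof. by apply: rc_inj; rewrite rcM -!nrE normrZ. Qed.
Lemma nrZr (V : normedModType (Cplx R)) r (v : V) : nr (rc r *: v) = `|r| * nr v.
Proof. by rewrite nrZ nr_rc. Qed.
Lemma re_le (z : Cplx R) : `|re z| <= nr z.
Proof. by rewrite -ler_rc -nrE; case: z => a b; exact: normc_ge_Re. Qed.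
Lemma im_le (z : Cplx R) : `|im z| <= nr z.
Proof.
have -> : im z = re (- ci * z) by rewrite reM reN imN re_ci im_ci oppr0 mul0r sub0r mulN1r opprK.
by rewrite (le_trans (re_le _)) // nrM nrN nr_ci mul1r.
Qed.
Lemma nr_le_reim (z : Cplx R) : nr z <= `|re z| + `|im z|.
Proof. by rewrite {1}(cE z) (le_trans (nrD _ _)) // nrM nr_ci mul1r !nr_rc. Qed.
Lemma nr_gt0 (z : Cplx R) : z != 0 -> 0 < nr z.
Proof. by move=> z0; rewrite -ltr_rc -nrE normr_gt0. Qed.
Lemma nr_sq (z : Cplx R) : nr z ^+ 2 = re z ^+ 2 + im z ^+ 2.
Proof.
rewrite /nr; case: z => a b /=; rewrite sqr_sqrtr //.
by rewrite addr_ge0 ?sqr_ge0.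
Qed.

Section Vec.
Variable n : nat.
Implicit Types v w : Cn R n.

(** The norm of a row vector is the maximum norm, read off from the description of its balls as
    products. *)
Lemma nr_lt_coord v e : 0 < e ->
  nr v < e <-> forall j, nr (v ord0 j : Cplx R) < e.
Proof.
move=> e0.
have bE : ball_ [eta Num.Def.normr] (0 : 'rV[Cplx R]_n) (rc e) v =
          ball (0 : 'rV[Cplx R]_n) (rc e) v by rewrite -mx_norm_ball.
have e0' : 0 < rc e by rewrite -rc0 ltr_rc.
rewrite -ltr_rc -nrE -normrN -sub0r; split=> [h j|h].
- have : ball (0 : 'rV[Cplx R]_n) (rc e) v by rewrite -bE.
  move=> [_ /(_ ord0 j)]; rewrite -ball_normE /ball_ /= mxE sub0r normrN.
  by rewrite nrE ltr_rc.
- suff : ball (0 : 'rV[Cplx R]_n) (rc e) v by rewrite -bE.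
  split=> // i j; rewrite -ball_normE /ball_ /= mxE sub0r normrN (ord1 i).
  by rewrite nrE ltr_rc.
Qed.

Lemma nr_coord v j : nr (v ord0 j : Cplx R) <= nr v.
Proof.
rewrite leNgt; apply/negP => h.
have vj0 : 0 < nr (v ord0 j : Cplx R) by rewrite (le_lt_trans _ h) ?nr_ge0.
by have /(nr_lt_coord _ vj0)/(_ j) := h; rewrite ltxx.
Qed.

Lemma nr_le_coord v e : 0 <= e -> (forall j, nr (v ord0 j : Cplx R) <= e) -> nr v <= e.
Proof.
move=> e0 h; apply/ler_addgt0Pr => x x0; apply/ltW.
have ex : 0 < e + x by rewrite ltr_wpDl.
by apply/(nr_lt_coord _ ex) => j; rewrite (le_lt_trans (h j)) // ltrDl.
Qed.

End Vec.

Lemma r_cauchy (u : nat -> R) :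
  (forall e : R, 0 < e -> exists N, forall k l, (N <= k)%N -> (N <= l)%N ->
    `|u k - u l| < e) ->
  exists l : R, forall e : R, 0 < e -> exists N, forall k, (N <= k)%N ->
    `|u k - l| < e.
Proof.
move=> uc.
have : cvg (u @ \oo).
  apply: R_complete; apply: cauchy_exP => e e0.
  have [N uN] := uc e e0; exists (u N); exists N => // k /= Nk.
  by rewrite -ball_normE /ball_ /=; apply: uN.
move=> /cvg_ex[l /cvgrPdist_lt ul]; exists l => e e0.
have [N _ uN] := ul e e0; exists N => k Nk.
by rewrite distrC; apply: uN.
Qed.

Lemma c_cauchy (u : nat -> Cplx R) :
  (forall e : R, 0 < e -> exists N, forall k l, (N <= k)%N -> (N <= l)%N ->
    nr (u k - u l) < e) ->
  exists l : Cplx R, forall e : R, 0 < e -> exists N, forall k, (N <= k)%N ->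
    nr (u k - l) < e.
Proof.
move=> uc.
have [|a ua] := @r_cauchy (fun k => re (u k)).
  move=> e e0; have [N uN] := uc e e0; exists N => k l Nk Nl.
  by rewrite -reN -reD (le_lt_trans (re_le _)) // uN.
have [|b ub] := @r_cauchy (fun k => im (u k)).
  move=> e e0; have [N uN] := uc e e0; exists N => k l Nk Nl.
  by rewrite -imN -imD (le_lt_trans (im_le _)) // uN.
exists (rc a + ci * rc b) => e e0.
have [N1 h1] := ua (e / 2) (ltac:(lra)).
have [N2 h2] := ub (e / 2) (ltac:(lra)).
exists (maxn N1 N2) => k; rewrite geq_max => /andP[k1 k2].
apply: (le_lt_trans (nr_le_reim _)).
rewrite reD imD reN imN reD imD reM imM !re_rc !im_rc re_ci im_ci.
have := h1 k k1; have := h2 k k2; rewrite !(mul0r, mul1r, mulr0, subr0, addr0, add0r).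
by lra.
Qed.

Lemma v_cauchy n (u : nat -> Cn R n) :
  (forall e : R, 0 < e -> exists N, forall k l, (N <= k)%N -> (N <= l)%N ->
    nr (u k - u l) < e) ->
  exists l : Cn R n, forall e : R, 0 < e -> exists N, forall k, (N <= k)%N ->
    nr (u k - l) < e.
Proof.
move=> uc.
have ex j : exists l : Cplx R, forall e : R, 0 < e -> exists N, forall k, (N <= k)%N ->
    nr ((u k ord0 j : Cplx R) - l) < e.
  apply: c_cauchy => e e0; have [N uN] := uc e e0; exists N => k l Nk Nl.
  by apply: le_lt_trans (uN k l Nk Nl); have := nr_coord (u k - u l) j; rewrite !mxE.
have [l lP] := choice ex.
exists (\row_j l j : 'rV[Cplx R]_n) => e e0.
have ex2 j : exists N, forall k, (N <= k)%N -> nr ((u k ord0 j : Cplx R) - l j) < e.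
  exact: lP.
have [N NP] := choice ex2.
exists (\max_j N j) => k kN; apply/(nr_lt_coord _ e0) => j.
by rewrite !mxE; apply: NP; rewrite (leq_trans _ kN) // leq_bigmax.
Qed.

End RealNorm.

(** * Right derivatives and primitives of curves *)

Section Primitives.
Variable R : realType.

Section Mod.
Variable V : normedModType (Cplx R).

Lemma addrBB_split (u v w x y z : V) :
  (u + x) - (v + y) - (w + z) = (u - v - w) + (x - y - z).
Proof. by rewrite (opprD v) (addrACA u) (opprD w) (addrACA (u - v)). Qed.

Definition nrdist (v w : V) : R := nr (v - w).

(* [v] is the right derivative of [c] at [t]; nothing is asked of [c] beyond [b]. *)
Definition rder (c : R -> V) (t b : R) (v : V) :=
  forall e : R, 0 < e -> exists2 r : R, 0 < r &
  forall h : R, 0 < h < r -> t + h <= b ->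
    nr (c (t + h) - c t - rc h *: v) <= e * h.

(** Continuity and a right derivative restrict well to subintervals, and by [mvi] they still
    determine [P] up to a constant. *)
Definition rprim (a b : R) (P c : R -> V) :=
  contd nrdist P a b /\ forall t, a <= t < b -> rder P t b (c t).

(** The mean value inequality: [nr (P t - P a) - M * (t - a)] has nonpositive upper right Dini
    derivative, so [dini_le] applies. *)
Lemma mvi a b P c (M : R) : a <= b -> rprim a b P c ->
  (forall t, a <= t < b -> nr (c t) <= M) -> nr (P b - P a) <= M * (b - a).
Proof.
move=> ab [Pc Pd] cM.
pose g t := nr (P t - P a) - M * (t - a).
suff : g b <= g a by rewrite /g !subrr mulr0 nr0 subr0 subr_le0.
apply: dini_le => //.
- move=> t tab e e0; have [r r0 Pr] := Pc t tab (e / 2) (ltac:(lra)).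
  pose r' := e / 2 / (`|M| + 1).
  have M0 := normr_ge0 M.
  have r'0 : 0 < r' by rewrite /r' !divr_gt0 //; lra.
  exists (Num.min r r'); first by rewrite lt_min r0 r'0.
  move=> s sab; rewrite lt_min => /andP[sr sr'].
  have h1 : nr (P s - P a) - nr (P t - P a) <= nr (P s - P t).
    by rewrite lerBlDr nr_dist.
  have h2 : nr (P t - P a) - nr (P s - P a) <= nr (P s - P t).
    by rewrite lerBlDr (nr_distC (P s)) nr_dist.
  have h3 := Pr s sab sr; rewrite /nrdist in h3.
  have h4 : `|M * (s - t)| <= e / 2.
    rewrite normrM (@le_trans _ _ ((`|M| + 1) * r')) //; last first.
      by rewrite /r' mulrCA mulfV ?mulr1 //; lra.
    by apply: ler_pM => //; lra.
  move: h4; rewrite /distR /g ler_norml ltr_norml => /andP[h4 h5]; lra.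
- move=> t tab e e0; have [r r0 Pr] := Pd t tab e e0.
  exists r => // h h0 hb; have := Pr h h0 hb => {}Pr.
  have h1 : nr (P (t + h) - P a) <= nr (P (t + h) - P t - rc h *: c t)
      + nr (rc h *: c t) + nr (P t - P a).
    apply: (le_trans (nr_dist _ (P t) _)); rewrite lerD2r.
    by rewrite -{1}(subrK (rc h *: c t) (P (t + h) - P t)) nrD.
  move: h1; rewrite nrZr ger0_norm; last lra.
  have := cM t tab => h2 h1.
  have : h * nr (c t) <= h * M by rewrite ler_pM2l //; lra.
  by rewrite /g; lra.
Qed.

Lemma rprim_sub a b a' b' P c : a <= a' -> b' <= b -> rprim a b P c -> rprim a' b' P c.
Proof.
move=> aa bb [Pc Pd]; split=> [t tab e e0|t tab e e0].
  have [r r0 Pr] := Pc t (ltac:(lra)) e e0; exists r => // s sab; apply: Pr; lra.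
have [r r0 Pr] := Pd t (ltac:(lra)) e e0; exists r => // h h0 hb; apply: Pr => //; lra.
Qed.

Lemma rprim_ext a b P P' c c' : (forall t, a <= t <= b -> P' t = P t) ->
  (forall t, a <= t < b -> c' t = c t) -> rprim a b P c -> rprim a b P' c'.
Proof.
move=> PP cc [Pc Pd]; split=> [t tab e e0|t tab e e0].
  have [r r0 Pr] := Pc t (ltac:(lra)) e e0; exists r => // s sab.
  by rewrite !PP //; apply: Pr.
have [r r0 Pr] := Pd t (ltac:(lra)) e e0; exists r => // h h0 hb.
by rewrite !PP ?cc //; [apply: Pr | lra | lra].
Qed.

Lemma rprim_aff a b (v0 v : V) : rprim a b (fun t => v0 + rc t *: v) (fun=> v).
Proof.
split=> [t tab e e0|t tab e e0].
  have v0' := nr_ge0 v.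
  exists (e / (nr v + 1)); first by rewrite divr_gt0 //; lra.
  move=> s sab st; rewrite /nrdist opprD addrACA subrr add0r -scalerBl -rcB nrZr.
  rewrite (@le_lt_trans _ _ (`|s - t| * (nr v + 1))) //; last first.
    by rewrite -ltr_pdivlMr //; lra.
  by apply: ler_wpM2l => //; lra.
exists 1 => // h h0 hb.
rewrite (_ : _ - _ = 0); first by rewrite nr0 mulr_ge0; lra.
by rewrite rcD scalerDl addrA (addrC _ (rc h *: v)) addrK subrr.
Qed.

Lemma rprim_lin a b (k : Cplx R) P Q c d : rprim a b P c -> rprim a b Q d ->
  rprim a b (fun t => P t + k *: Q t) (fun t => c t + k *: d t).
Proof.
move=> [Pc Pd] [Qc Qd].
have k0 := nr_ge0 (k : Cplx R).
split=> [t tab e e0|t tab e e0].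
  have [r r0 Pr] := Pc t tab (e / 2) (ltac:(lra)).
  have [s s0 Qs] := Qc t tab (e / 2 / (nr (k : Cplx R) + 1)) (ltac:(rewrite !divr_gt0 //; lra)).
  exists (Num.min r s); first by rewrite lt_min r0.
  move=> u uab; rewrite lt_min => /andP[ur us].
  have := Pr u uab ur; have := Qs u uab us.
  rewrite /nrdist ltr_pdivlMr; last lra.
  move=> h1 h2; rewrite opprD addrACA -scalerBr.
  apply: (le_lt_trans (nrD _ _)); rewrite nrZ.
  have := nr_ge0 (Q u - Q t); nra.
have [r r0 Pr] := Pd t tab (e / 2) (ltac:(lra)).
have [s s0 Qs] := Qd t tab (e / 2 / (nr (k : Cplx R) + 1)) (ltac:(rewrite !divr_gt0 //; lra)).
exists (Num.min r s); first by rewrite lt_min r0.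
move=> h h0 hb; have hr : h < r by have := h0; rewrite lt_min; lra.
have hs : h < s by have := h0; rewrite lt_min; lra.
have := Pr h (ltac:(lra)) hb; have := Qs h (ltac:(lra)) hb.
rewrite mulrAC ler_pdivlMr; last lra.
move=> h1 h2.
rewrite scalerDr addrBB_split scalerA (mulrC (rc h)) -scalerA -!scalerBr.
apply: (le_trans (nrD _ _)); rewrite nrZ.
have := nr_ge0 (Q (t + h) - Q t - rc h *: d t); nra.
Qed.

End Mod.

(** The clamp [cl] extends [g] by constants to a continuous function on the line. Integrating from
    [a - 1] and working below [b + 1] makes every [t] in [[a, b]] interior, so the fundamental
    theorem of calculus gives a two-sided derivative. *)
Lemma real_primitive (g : R -> R) a b : a < b -> contd (@distR R) g a b ->
  exists F : R -> R, forall t, a <= t <= b -> forall e : R, 0 < e ->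
   exists2 r : R, 0 < r & forall h, `|h| < r -> a <= t + h <= b ->
    `|F (t + h) - F t - h * g t| <= e * `|h|.
Proof.
move=> ab gc.
pose cl (t : R) := Num.max a (Num.min b t).
have cl_in t : a <= cl t <= b.
  by rewrite /cl le_max lexx /= ge_max (ltW ab) ge_min lexx.
have cl_id t : a <= t <= b -> cl t = t.
  by move=> /andP[at_ tb]; rewrite /cl (min_idPr tb) (max_idPr at_).
have cl_lip s t : `|cl s - cl t| <= `|s - t|.
  wlog st : s t / s <= t.
    by move=> h; have [/h//|/ltW/h] := leP s t; rewrite distrC (distrC t).
  rewrite distrC (distrC s) !ger0_norm ?subr_ge0 //.
    by rewrite /cl /Num.max /Num.min; case: (ltP b s) => ?; case: (ltP b t) => ?;
      repeat (case: ltP => ?); lra.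
  by rewrite /cl ge_max !le_max lexx /= le_min !ge_min lexx st !orbT.
have gcont : continuous (g \o cl).
  move=> t; apply/cvgrPdist_lt => e e0.
  have [r r0 gr] := gc (cl t) (cl_in t) e e0.
  near=> s; rewrite distrC; apply: gr => //.
  apply: (le_lt_trans (cl_lip _ _)); rewrite distrC.
  by near: s; apply: cvgr_dist_lt => //; exact: cvg_id.
pose F x : R := (\int[lebesgue_measure]_(t in `[a - 1, x]) (g \o cl) t)%R.
exists F => t tab e e0.
have tlt : t < b + 1 by lra.
have int : lebesgue_measure.-integrable `[a - 1, b + 1] (EFin \o (g \o cl)).
  apply: continuous_compact_integrable; first exact: segment_compact.
  exact: continuous_subspaceT.
have [dF] := continuous_FTC1_closed tlt int (ltac:(lra) : a - 1 < t) (gcont t).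
rewrite /= cl_id // derive1E => dE.
have /cvgrPdist_le/(_ e e0) : (h^-1 *: ((F \o shift t) (h *: (1 : R)) - F t)) @[h --> 0^'] --> g t.
  by rewrite -dE; exact: dF.
move=> /nbhs_ballP[r /= r0 rF]; exists r => // h hr _.
have [->|h0] := eqVneq h 0; first by rewrite addr0 subrr mul0r subrr normr0 mulr0.
have := rF h; rewrite -ball_normE /ball_ /= sub0r normrN => /(_ hr h0).
rewrite /= (_ : h *: (1 : R) = h :> R) ?(addrC h); last exact: mulr1.
change (_ *: _) with (h^-1 * (F (t + h) - F t)) => hF.
have -> : F (t + h) - F t - h * g t = - (h * (g t - h^-1 * (F (t + h) - F t))).
  by rewrite mulrBr mulrA mulfV // mul1r opprB.
by rewrite normrN normrM mulrC ler_wpM2r.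
Unshelve. all: by end_near.
Qed.

Lemma rprim_exists_scalar (c : R -> Cplx R) a b : a < b -> contd (@nrdist (Cplx R)) c a b ->
  exists P, rprim a b P c.
Proof.
move=> ab cc.
have prim (g : R -> R) : contd (@distR R) g a b -> exists F : R -> R,
    rprim a b (fun t => rc (F t) : Cplx R) (fun t => rc (g t)).
  move=> gc; have [F FP] := real_primitive ab gc; exists F; split.
    move=> t tab e e0; have [r r0 Fr] := FP t tab 1 ltr01.
    have g0 := normr_ge0 (g t).
    pose r' := e / (`|g t| + 2).
    have r'0 : 0 < r' by rewrite /r' divr_gt0 //; lra.
    exists (Num.min r r'); first by rewrite lt_min r0.
    move=> s sab; rewrite lt_min => /andP[sr sr'].
    have := Fr (s - t) sr (ltac:(lra)); rewrite (_ : t + (s - t) = s); last by ring.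
    rewrite /nrdist -rcB nr_rc mul1r => h1.
    apply: (@le_lt_trans _ _ (`|s - t| * (`|g t| + 1))).
      rewrite -{1}(subrK ((s - t) * g t) (F s - F t)) (le_trans (ler_normD _ _)) // normrM.
      lra.
    apply: (@le_lt_trans _ _ (r' * (`|g t| + 1))); first by rewrite ler_wpM2r; lra.
    by rewrite /r' mulrAC ltr_pdivrMr; [rewrite ltr_pM2l //; lra | lra].
  move=> t tab e e0; have [r r0 Fr] := FP t (ltac:(lra)) e e0.
  exists r => // h h0 hb; rewrite /GRing.scale /= -rcM -!rcB nr_rc.
  have := Fr h; rewrite (ger0_norm (ltac:(lra) : 0 <= h)); apply; lra.
have [|F hF] := prim (fun t => re (c t)).
  move=> t tab e e0; have [r r0 cr] := cc t tab e e0; exists r => // s sab st.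
  by rewrite /distR -reN -reD (le_lt_trans (re_le _)) // cr.
have [|G hG] := prim (fun t => im (c t)).
  move=> t tab e e0; have [r r0 cr] := cc t tab e e0; exists r => // s sab st.
  by rewrite /distR -imN -imD (le_lt_trans (im_le _)) // cr.
exists (fun t => rc (F t) + ci R * rc (G t)).
have := rprim_lin (ci R) hF hG; apply: rprim_ext => // t _; exact: cE.
Qed.

Lemma rprim_exists n (c : R -> Cn R n) a b : a < b -> contd (@nrdist (Cn R n)) c a b ->
  exists P, rprim a b P c.
Proof.
move=> ab cc.
have ex j : exists P, rprim a b P (fun t => c t ord0 j : Cplx R).
  apply: rprim_exists_scalar => // t tab e e0.
  have [r r0 cr] := cc t tab e e0; exists r => // s sab st.
  rewrite /nrdist; apply: le_lt_trans (cr s sab st).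
  by have := nr_coord (c s - c t) j; rewrite !mxE.
have [P PP] := choice ex.
exists (fun t => \row_j P j t : 'rV[Cplx R]_n); split=> [t tab e e0|t tab e e0].
  have ex2 j : exists r : R, 0 < r /\ forall s, a <= s <= b -> `|s - t| < r ->
      nr (P j s - P j t) < e.
    by have [/(_ t tab e e0)[r r0 Pr] _] := PP j; exists r.
  have [r rP] := choice ex2.
  have [r0 r00 r0P] : exists2 r0, 0 < r0 & forall j, r0 <= r j.
    exists (\big[Num.min/1]_j r j).
      by elim/big_ind: _ => // [x y x0 y0|j _]; [rewrite lt_min x0 | case: (rP j)].
    by move=> j; exact: bigmin_le_cond.
  exists r0 => // s sab st; apply/(nr_lt_coord _ e0) => j; rewrite !mxE.
  by apply: (rP j).2 => //; apply: (lt_le_trans st).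
have ex2 j : exists r : R, 0 < r /\ forall h, 0 < h < r -> t + h <= b ->
    nr (P j (t + h) - P j t - rc h *: (c t ord0 j : Cplx R)) <= e * h.
  by have [_ /(_ t tab e e0)[r r0 Pr]] := PP j; exists r.
have [r rP] := choice ex2.
have [r0 r00 r0P] : exists2 r0, 0 < r0 & forall j, r0 <= r j.
  exists (\big[Num.min/1]_j r j).
    by elim/big_ind: _ => // [x y x0 y0|j _]; [rewrite lt_min x0 | case: (rP j)].
  by move=> j; exact: bigmin_le_cond.
exists r0 => // h h0 hb; apply: nr_le_coord => [|j]; first by rewrite mulr_ge0; lra.
rewrite !mxE; apply: (rP j).2 => //.
by have := r0P j; lra.
Qed.

End Primitives.

(** * Integrals along rectangles *)

Section Integrals.
Variable R : realType.
Local Notation C := (Cplx R).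
Implicit Types (a b t : R) (c d : R -> C).

(* Junk value 0 when [c] has no primitive. *)
Definition rint (c : R -> C) (a b : R) : C :=
  xget 0 [set v | exists2 P, rprim a b P c & v = P b - P a].

Lemma rint_prim a b P c : a <= b -> rprim a b P c -> rint c a b = P b - P a.
Proof.
move=> ab Pc; rewrite /rint; case: xgetP => [v _ [Q Qc ->]|/(_ (P b - P a))[]]; last by exists P.
have := mvi ab (rprim_lin (-1) Qc Pc) (M := 0).
rewrite mul0r => h; apply/eqP; rewrite -subr_eq0; apply/eqP.
apply: nr_le0; apply: le_trans (h _).
  rewrite !scaleN1r (_ : _ - _ = Q b - P b - (Q a - P a)) //; ring.
by move=> t _; rewrite scaleN1r subrr nr0.
Qed.

Lemma rprim_ex a b c : a <= b -> contd (@nrdist _ C) c a b -> exists P, rprim a b P c.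
Proof.
rewrite le_eqVlt => /orP[/eqP<- _|ab]; last exact: rprim_exists_scalar.
exists (fun=> 0); split=> [t _ e e0|t tab]; last lra.
by exists 1 => // s _ _; rewrite /nrdist subrr nr0.
Qed.

Lemma rint_split a m b c : a <= m -> m <= b -> contd (@nrdist _ C) c a b ->
  rint c a b = rint c a m + rint c m b.
Proof.
move=> am mb cc; have ab : a <= b by lra.
have [P Pc] := rprim_ex ab cc.
rewrite (rint_prim ab Pc) (rint_prim am (rprim_sub (lexx _) mb Pc)).
rewrite (rint_prim mb (rprim_sub am (lexx _) Pc)); ring.
Qed.

Lemma rint_lin a b k c d : a <= b -> contd (@nrdist _ C) c a b ->
  contd (@nrdist _ C) d a b ->
  rint (fun t => c t + k * d t) a b = rint c a b + k * rint d a b.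
Proof.
move=> ab /(rprim_ex ab)[P Pc] /(rprim_ex ab)[Q Qd].
rewrite (rint_prim ab Pc) (rint_prim ab Qd) (rint_prim ab (rprim_lin k Pc Qd)).
rewrite /GRing.scale /=; ring.
Qed.

Lemma rint_ext a b c d : a <= b -> (forall t, a <= t <= b -> c t = d t) ->
  contd (@nrdist _ C) d a b -> rint c a b = rint d a b.
Proof.
move=> ab cd dc; have [P Pd] := rprim_ex ab dc.
rewrite (rint_prim ab Pd); apply: rint_prim => //.
by apply: rprim_ext Pd => // t tab; apply: cd; lra.
Qed.

Lemma rint_le a b c M : a <= b -> contd (@nrdist _ C) c a b ->
  (forall t, a <= t <= b -> nr (c t : C) <= M) -> nr (rint c a b : C) <= M * (b - a).
Proof.
move=> ab cc cM; have [P Pc] := rprim_ex ab cc.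
by rewrite (rint_prim ab Pc); apply: mvi Pc _ => // t tab; apply: cM; lra.
Qed.

Lemma rint_re_ge a b c m : a <= b -> contd (@nrdist _ C) c a b ->
  (forall t, a <= t <= b -> m <= re (c t)) -> m * (b - a) <= re (rint c a b).
Proof.
move=> ab cc cm; have [P [Pc Pd]] := rprim_ex ab cc.
rewrite (rint_prim ab (conj Pc Pd)).
pose g t := m * (t - a) - re (P t).
suff : g b <= g a by rewrite /g subrr mulr0 reD reN; lra.
apply: dini_le => // [t tab e e0|t tab e e0].
  have [r r0 Pr] := Pc t tab (e / 2) (ltac:(lra)).
  have m0 := normr_ge0 m.
  have r'0 : 0 < e / 2 / (`|m| + 1) by rewrite !divr_gt0 //; lra.
  exists (Num.min r (e / 2 / (`|m| + 1))); first by rewrite lt_min r0.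
  move=> s sab; rewrite lt_min => /andP[sr]; rewrite ltr_pdivlMr; last lra.
  move=> sm; have := Pr s sab sr; rewrite /nrdist => h.
  have := re_le (P s - P t); rewrite reD reN => h2.
  rewrite /distR /g (_ : _ - _ = m * (s - t) - (re (P s) - re (P t))); last ring.
  rewrite (le_lt_trans (ler_normB _ _)) // normrM.
  have := normr_ge0 (s - t); nra.
have [r r0 Pr] := Pd t tab e e0; exists r => // h h0 hb.
have := Pr h h0 hb => h1; have := re_le (P (t + h) - P t - rc h *: c t).
rewrite /GRing.scale /= !(reD, reN, reM) re_rc im_rc ler_norml /g.
have := cm t (ltac:(lra)); nra.
Qed.

Lemma contdM_const k c a b : contd (@nrdist _ C) c a b ->
  contd (@nrdist _ C) (fun t => k * c t) a b.
Proof.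
move=> cc t tab e e0; have k0 := nr_ge0 (k : C).
have [r r0 cr] := cc t tab (e / (nr (k : C) + 1)) (ltac:(rewrite divr_gt0 //; lra)).
exists r => // s sab st; have := cr s sab st; rewrite /nrdist ltr_pdivlMr; last lra.
rewrite -mulrBr nrM; have := nr_ge0 (c s - c t); nra.
Qed.

Lemma rint_scal a b k c : a <= b -> contd (@nrdist _ C) c a b ->
  rint (fun t => k * c t) a b = k * rint c a b.
Proof.
move=> ab cc.
have := rint_lin (k - 1) ab cc cc => h.
rewrite (rint_ext (d := fun t => c t + (k - 1) * c t) ab) ?h; first by ring.
  by move=> t _; ring.
have := contdM_const k cc; congr (contd _ _ _ _); apply/funext => t; ring.
Qed.

Lemma rint_im_ge a b c m : a <= b -> contd (@nrdist _ C) c a b ->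
  (forall t, a <= t <= b -> m <= im (c t)) -> m * (b - a) <= im (rint c a b).
Proof.
move=> ab cc cm.
have imE z : im z = re (- ci R * z) by rewrite reM reN imN re_ci im_ci; ring.
rewrite imE -rint_scal //; apply: rint_re_ge => // [|t tab]; first exact: contdM_const.
by rewrite -imE; apply: cm.
Qed.

Definition cp (x y : R) : C := rc x + ci R * rc y.

(* The counterclockwise integral of [f] along the boundary of the rectangle
   [x1, x2] x [y1, y2]. *)
Definition bd (f : C -> C) (x1 x2 y1 y2 : R) : C :=
  rint (fun x => f (cp x y1)) x1 x2 + ci R * rint (fun y => f (cp x2 y)) y1 y2
  - rint (fun x => f (cp x y2)) x1 x2 - ci R * rint (fun y => f (cp x1 y)) y1 y2.

Definition edge_cont (f : C -> C) (x1 x2 y1 y2 : R) :=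
  [/\ contd (@nrdist _ C) (fun x => f (cp x y1)) x1 x2,
      contd (@nrdist _ C) (fun x => f (cp x y2)) x1 x2,
      contd (@nrdist _ C) (fun y => f (cp x1 y)) y1 y2 &
      contd (@nrdist _ C) (fun y => f (cp x2 y)) y1 y2].

Lemma bd_splitx f x1 x x2 y1 y2 : x1 <= x -> x <= x2 -> edge_cont f x1 x2 y1 y2 ->
  bd f x1 x2 y1 y2 = bd f x1 x y1 y2 + bd f x x2 y1 y2.
Proof.
by move=> h1 h2 [c1 c2 c3 c4]; rewrite /bd (rint_split h1 h2 c1) (rint_split h1 h2 c2); ring.
Qed.

Lemma bd_splity f x1 x2 y1 y y2 : y1 <= y -> y <= y2 -> edge_cont f x1 x2 y1 y2 ->
  bd f x1 x2 y1 y2 = bd f x1 x2 y1 y + bd f x1 x2 y y2.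
Proof.
by move=> h1 h2 [c1 c2 c3 c4]; rewrite /bd (rint_split h1 h2 c3) (rint_split h1 h2 c4); ring.
Qed.

Lemma bd_lin f g k x1 x2 y1 y2 : x1 <= x2 -> y1 <= y2 ->
  edge_cont f x1 x2 y1 y2 -> edge_cont g x1 x2 y1 y2 ->
  bd (fun z => f z + k * g z) x1 x2 y1 y2 = bd f x1 x2 y1 y2 + k * bd g x1 x2 y1 y2.
Proof. by move=> h1 h2 [f1 f2 f3 f4] [g1 g2 g3 g4]; rewrite /bd !rint_lin //; ring. Qed.

Definition on_edge x1 x2 y1 y2 (z : C) :=
  [/\ x1 <= re z <= x2, y1 <= im z <= y2 &
    [\/ re z = x1, re z = x2, im z = y1 | im z = y2]].

Lemma re_cp x y : re (cp x y) = x.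
Proof. by rewrite /cp reD reM !re_rc !im_rc re_ci im_ci; ring. Qed.
Lemma im_cp x y : im (cp x y) = y.
Proof. by rewrite /cp imD imM !re_rc !im_rc re_ci im_ci; ring. Qed.
Lemma cp_reim z : cp (re z) (im z) = z.
Proof. by apply: c_ext; rewrite ?re_cp ?im_cp. Qed.

Lemma bd_le f x1 x2 y1 y2 M : x1 <= x2 -> y1 <= y2 -> edge_cont f x1 x2 y1 y2 ->
  (forall z, on_edge x1 x2 y1 y2 z -> nr (f z : C) <= M) ->
  nr (bd f x1 x2 y1 y2 : C) <= M * (2 * (x2 - x1) + 2 * (y2 - y1)).
Proof.
move=> h1 h2 [c1 c2 c3 c4] fM; rewrite /bd.
have e1 : nr (rint (fun x => f (cp x y1)) x1 x2 : C) <= M * (x2 - x1).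
  apply: rint_le => // t tx; apply: fM; split; rewrite ?re_cp ?im_cp ?lexx //.
  exact: Or43.
have e2 : nr (rint (fun x => f (cp x y2)) x1 x2 : C) <= M * (x2 - x1).
  apply: rint_le => // t tx; apply: fM; split; rewrite ?re_cp ?im_cp ?lexx ?h2 //.
  exact: Or44.
have e3 : nr (rint (fun y => f (cp x1 y)) y1 y2 : C) <= M * (y2 - y1).
  apply: rint_le => // t tx; apply: fM; split; rewrite ?re_cp ?im_cp ?lexx //.
  exact: Or41.
have e4 : nr (rint (fun y => f (cp x2 y)) y1 y2 : C) <= M * (y2 - y1).
  apply: rint_le => // t tx; apply: fM; split; rewrite ?re_cp ?im_cp ?lexx ?h1 //.
  exact: Or42.
apply: (le_trans (nrB _ _)); rewrite nrM nr_ci mul1r.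
have := nrB (rint (fun x => f (cp x y1)) x1 x2 + ci R * rint (fun y => f (cp x2 y)) y1 y2)
   (rint (fun x => f (cp x y2)) x1 x2).
have := nrD (rint (fun x => f (cp x y1)) x1 x2) (ci R * rint (fun y => f (cp x2 y)) y1 y2 : C).
rewrite nrM nr_ci mul1r; lra.
Qed.

Lemma bd_ext f g x1 x2 y1 y2 : x1 <= x2 -> y1 <= y2 -> edge_cont g x1 x2 y1 y2 ->
  (forall z, on_edge x1 x2 y1 y2 z -> f z = g z) ->
  bd f x1 x2 y1 y2 = bd g x1 x2 y1 y2.
Proof.
move=> h1 h2 [c1 c2 c3 c4] fg; rewrite /bd.
by congr (_ + _ * _ - _ - _ * _); apply: rint_ext => // t tx; apply: fg; split;
  rewrite ?re_cp ?im_cp ?lexx ?h1 ?h2 //;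
  [exact: Or43 | exact: Or42 | exact: Or44 | exact: Or41].
Qed.

(** Complex differentiability with real radii and the derivative as a parameter; [derivable_cdiff]
    and [cdiff_is_derive] translate from and to the topological notion. *)
Definition cdiff (f : C -> C) (z a : C) := forall e : R, 0 < e ->
  exists2 r : R, 0 < r & forall w, nr (w - z : C) < r ->
    nr (f w - f z - a * (w - z) : C) <= e * nr (w - z : C).

Lemma cdiff_cont f z (a : C) : cdiff f z a -> forall e : R, 0 < e ->
  exists2 r : R, 0 < r & forall w, nr (w - z : C) < r -> nr (f w - f z : C) < e.
Proof.
move=> fz e e0; have [r r0 fr] := fz 1 ltr01.
have a0 := nr_ge0 (a : C).
have r'0 : 0 < e / (nr (a : C) + 2) by rewrite divr_gt0 //; lra.
exists (Num.min r (e / (nr (a : C) + 2))); first by rewrite lt_min r0.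
move=> w; rewrite lt_min => /andP[/fr h]; rewrite ltr_pdivlMr; last lra.
have := nrD (f w - f z - a * (w - z)) (a * (w - z)); rewrite subrK nrM.
have := nr_ge0 (w - z); nra.
Qed.

Lemma cp_x x x' y : cp x y - cp x' y = rc (x - x').
Proof. by rewrite /cp rcB; ring. Qed.
Lemma cp_y x y y' : cp x y - cp x y' = ci R * rc (y - y').
Proof. by rewrite /cp rcB; ring. Qed.

Lemma contd_x f y a b : (forall x, a <= x <= b -> exists k, cdiff f (cp x y) k) ->
  contd (@nrdist _ C) (fun x => f (cp x y)) a b.
Proof.
move=> fd t tab e e0; have [k /cdiff_cont/(_ e e0)[r r0 fr]] := fd t tab.
by exists r => // s sab st; apply: fr; rewrite cp_x nr_rc.
Qed.

Lemma contd_y f x a b : (forall y, a <= y <= b -> exists k, cdiff f (cp x y) k) ->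
  contd (@nrdist _ C) (fun y => f (cp x y)) a b.
Proof.
move=> fd t tab e e0; have [k /cdiff_cont/(_ e e0)[r r0 fr]] := fd t tab.
by exists r => // s sab st; apply: fr; rewrite cp_y nrM nr_ci mul1r nr_rc.
Qed.

Lemma edge_contP f x1 x2 y1 y2 : x1 <= x2 -> y1 <= y2 ->
  (forall z, on_edge x1 x2 y1 y2 z -> exists k, cdiff f z k) -> edge_cont f x1 x2 y1 y2.
Proof.
move=> h1 h2 fd; split; [apply: contd_x|apply: contd_x|apply: contd_y|apply: contd_y] => t tx;
 apply: fd; split; rewrite ?re_cp ?im_cp ?lexx ?h1 ?h2 //;
 [exact: Or43 | exact: Or44 | exact: Or41 | exact: Or42].
Qed.

(** Each edge contributes the difference of [F] at its two corners, and the four differences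
    cancel. *)
Lemma bd_prim F f x1 x2 y1 y2 : x1 <= x2 -> y1 <= y2 ->
  (forall z, on_edge x1 x2 y1 y2 z -> cdiff F z (f z)) -> bd f x1 x2 y1 y2 = 0.
Proof.
move=> h1 h2 Ff.
have [F1 F2 F3 F4] : edge_cont F x1 x2 y1 y2.
  by apply: edge_contP => // z /Ff; exists (f z).
have px y : (y = y1 \/ y = y2) -> contd (@nrdist _ C) (fun x => F (cp x y)) x1 x2 ->
    rint (fun x => f (cp x y)) x1 x2 = F (cp x2 y) - F (cp x1 y).
  move=> yy Fy; apply: (rint_prim (P := fun x => F (cp x y))) => //; split=> // t tx e e0.
  have [] := Ff (cp t y) _ e e0.
    split; rewrite ?re_cp ?im_cp; [lra | by case: yy => ->; rewrite ?lexx ?h2 |].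
    by case: yy => ->; [exact: Or43 | exact: Or44].
  move=> r r0 Fr; exists r => // h h0 hb; have := Fr (cp (t + h) y).
  rewrite cp_x (_ : t + h - t = h); last by ring.
  rewrite nr_rc (mulrC (f _)) ger0_norm; last lra.
  by apply; lra.
have py x : (x = x1 \/ x = x2) -> contd (@nrdist _ C) (fun y => F (cp x y)) y1 y2 ->
    ci R * rint (fun y => f (cp x y)) y1 y2 = F (cp x y2) - F (cp x y1).
  move=> xx Fx.
  (* Along a vertical edge [F] has derivative [ci * f], so [- ci * F] is a primitive of [f]. *)
  rewrite (@rint_prim _ _ (fun y => - ci R * F (cp x y))) //.
    rewrite -mulrBr mulrA mulrN ci2; ring.
  split=> [|t tx e e0]; first exact: contdM_const.
  have [] := Ff (cp x t) _ e e0.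
    split; rewrite ?re_cp ?im_cp; [by case: xx => ->; rewrite ?lexx ?h1 | lra |].
    by case: xx => ->; [exact: Or41 | exact: Or42].
  move=> r r0 Fr; exists r => // h h0 hb; have := Fr (cp x (t + h)).
  rewrite cp_y (_ : t + h - t = h); last by ring.
  rewrite !nrM nr_ci mul1r nr_rc ger0_norm; last lra.
  move=> /(_ (ltac:(lra))); congr (_ <= _).
  rewrite -[LHS]mul1r -{1}(nr_ci R) -(nrN (ci R)) -nrM; congr nr.
  rewrite /GRing.scale /=.
  have := ci2 R; move: (ci R) => i i2.
  ring: i2.
rewrite /bd (px _ (or_introl erefl) F1) (px _ (or_intror erefl) F2).
by rewrite (py _ (or_introl erefl) F3) (py _ (or_intror erefl) F4); ring.
Qed.

End Integrals.

(** * Goursat's lemma *)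

Section Goursat.
Variable R : realType.
Local Notation C := (Cplx R).
Implicit Types (a b t : R) (f : C -> C).

Definition in_rect x1 x2 y1 y2 (z : C) := x1 <= re z <= x2 /\ y1 <= im z <= y2.

(** Affine functions have primitives, so they drop out of the boundary integrals in
    [goursat_local]. *)
Lemma cdiff_aff (c a p z : C) :
  cdiff (fun w => c * w + a * (w - p) * (w - p) / 2) z (c + a * (z - p)).
Proof.
move=> e e0; have a0 := nr_ge0 (a : C).
exists (e / (nr (a : C) + 1)) => [|w]; first by rewrite divr_gt0 //; lra.
rewrite ltr_pdivlMr; last lra.
move=> wz.
have -> : c * w + a * (w - p) * (w - p) / 2 - (c * z + a * (z - p) * (z - p) / 2)
   - (c + a * (z - p)) * (w - z) = a * (w - z) * (w - z) / 2 by field.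
rewrite !nrM nrV (_ : (2 : C) = rc 2); last by rewrite -[2]/(1 + 1) rcD.
rewrite nr_rc normr_nat; have := nr_ge0 (w - z); nra.
Qed.

Lemma nr_in_rect x y a b z w : in_rect x (x + a) y (y + b) z -> in_rect x (x + a) y (y + b) w ->
  nr (w - z : C) <= a + b.
Proof.
move=> [z1 z2] [w1 w2]; apply: (le_trans (nr_le_reim _)).
have h1 : `|re (w - z)| <= a by rewrite reD reN ler_norml; lra.
have h2 : `|im (w - z)| <= b by rewrite imD imN ler_norml; lra.
lra.
Qed.

Lemma on_edge_rect x1 x2 y1 y2 z : on_edge x1 x2 y1 y2 z -> in_rect x1 x2 y1 y2 z.
Proof. by case. Qed.

(** Subtracting the first order expansion [g] at [p] does not change the boundary integral. What
    remains is at most [m / 2 * (a + b)] on a perimeter of length [2 * (a + b)]. *)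
Lemma goursat_local f p k (m : R) : cdiff f p k -> 0 < m ->
  exists2 r : R, 0 < r & forall x y a b, 0 <= a -> 0 <= b -> a + b < r ->
    in_rect x (x + a) y (y + b) p ->
    (forall z, in_rect x (x + a) y (y + b) z -> exists k', cdiff f z k') ->
    nr (bd f x (x + a) y (y + b) : C) <= m * (a + b) ^+ 2.
Proof.
move=> fp m0; have [r r0 fr] := fp (m / 2) (ltac:(lra)).
exists r => // x y a b a0 b0 abr pin fd.
pose g (z : C) := f p + k * (z - p).
have xa : x <= x + a by lra.
have yb : y <= y + b by lra.
have gP z : cdiff (fun w => f p * w + k * (w - p) * (w - p) / 2) z (g z) by exact: cdiff_aff.
have gcont z : cdiff g z k.
  move=> e e0; exists 1 => // w _.
  have -> : g w - g z - k * (w - z) = 0 by rewrite /g; ring.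
  by rewrite nr0 mulr_ge0 ?nr_ge0 // ltW.
have g0 : bd g x (x + a) y (y + b) = 0.
  by apply: bd_prim (fun w => f p * w + k * (w - p) * (w - p) / 2) _ _ _ _ _ _ _ _.
have gE : edge_cont g x (x + a) y (y + b).
  by apply: edge_contP => // z _; exists k.
have fE : edge_cont f x (x + a) y (y + b).
  by apply: edge_contP => // z /on_edge_rect; apply: fd.
have hE : edge_cont (fun z => f z + (-1) * g z) x (x + a) y (y + b).
  case: fE => f1 f2 f3 f4; case: gE => g1 g2 g3 g4.
  have L c d s t : contd (@nrdist _ C) c s t -> contd (@nrdist _ C) d s t ->
     contd (@nrdist _ C) (fun u => c u + (-1) * d u) s t.
    move=> cc dd u ust e e0; have [r1 r10 h1] := cc u ust (e / 2) (ltac:(lra)).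
    have [r2 r20 h2] := dd u ust (e / 2) (ltac:(lra)).
    exists (Num.min r1 r2); first by rewrite lt_min r10.
    move=> v vst; rewrite lt_min => /andP[/(h1 _ vst) h3 /(h2 _ vst) h4].
    rewrite /nrdist (_ : _ - _ = (c v - c u) - (d v - d u)); last by ring.
    apply: (le_lt_trans (nrB _ _)); rewrite /nrdist in h3 h4; lra.
  by split; apply: L.
have := bd_lin (-1) xa yb fE gE; rewrite g0 mulr0 addr0 => <-.
apply: (le_trans (bd_le (M := m / 2 * (a + b)) xa yb hE _)); last by rewrite expr2; nra.
move=> z /on_edge_rect zin; have dz := nr_in_rect pin zin.
have := fr z (le_lt_trans dz abr).
have -> : f z + -1 * g z = f z - f p - k * (z - p) by rewrite /g; ring.
by move=> /le_trans; apply; rewrite ler_pM2l //; lra.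
Qed.

(** The integrals over the four quarters add up to the whole, so they cannot all have less than a
    quarter of its modulus. Sides written as [a + a] and [b + b] avoid halving. *)
Lemma bd_quarter f x y a b : 0 <= a -> 0 <= b ->
  (forall z, in_rect x (x + a + a) y (y + b + b) z -> exists k, cdiff f z k) ->
  exists p : R * R, [/\ p.1 = x \/ p.1 = x + a, p.2 = y \/ p.2 = y + b &
    nr (bd f x (x + a + a) y (y + b + b) : C) <= 4 * nr (bd f p.1 (p.1 + a) p.2 (p.2 + b) : C)].
Proof.
move=> a0 b0 fd.
have ec u u' v v' : u <= u' -> v <= v' -> x <= u -> u' <= x + a + a -> y <= v ->
    v' <= y + b + b -> edge_cont f u u' v v'.
  move=> uu vv h1 h2 h3 h4; apply: edge_contP => // z /on_edge_rect[z1 z2].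
  by apply: fd; split; lra.
pose B u v := bd f u (u + a) v (v + b).
have spl : bd f x (x + a + a) y (y + b + b) =
    B x y + B x (y + b) + (B (x + a) y + B (x + a) (y + b)).
  rewrite (@bd_splitx _ f _ (x + a)); [|lra|lra|by apply: ec; lra].
  rewrite (@bd_splity _ f x _ _ (y + b)); [|lra|lra|by apply: ec; lra].
  by rewrite (@bd_splity _ f (x + a) _ _ (y + b)); [|lra|lra|by apply: ec; lra].
set m := nr _.
have tri : m <= nr (B x y : C) + nr (B x (y + b) : C)
    + (nr (B (x + a) y : C) + nr (B (x + a) (y + b) : C)).
  by rewrite /m spl (le_trans (nrD _ _)) // lerD // nrD.
have [h1|h1] := leP m (4 * nr (B x y : C)).
  by exists (x, y); split=> //; left.
have [h2|h2] := leP m (4 * nr (B x (y + b) : C)).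
  by exists (x, y + b); split=> //; [left|right].
have [h3|h3] := leP m (4 * nr (B (x + a) y : C)).
  by exists (x + a, y); split=> //; [right|left].
exists (x + a, y + b); split; try by right.
by rewrite /= -/(B _ _); lra.
Qed.

(** After [k] quarterings at least the fraction [4 ^ -k] of the modulus [m] survives, while the
    rectangles shrink to a point [p]; there [goursat_local] bounds the same integral by something
    smaller. *)
Lemma goursat f x1 x2 y1 y2 : x1 <= x2 -> y1 <= y2 ->
  (forall z, in_rect x1 x2 y1 y2 z -> exists k, cdiff f z k) ->
  bd f x1 x2 y1 y2 = 0.
Proof.
move=> x12 y12 fd; apply: nr_le0; rewrite leNgt; apply/negP.
set m := nr _ => m0.
pose a k : R := (x2 - x1) * 2^-1 ^+ k.
pose b k : R := (y2 - y1) * 2^-1 ^+ k.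
have p2 k : 0 < (2^-1 : R) ^+ k by rewrite exprn_gt0 // invr_gt0.
have a0 k : 0 <= a k by rewrite mulr_ge0 ?subr_ge0 // ltW.
have b0 k : 0 <= b k by rewrite mulr_ge0 ?subr_ge0 // ltW.
have aS k : a k = a k.+1 + a k.+1 by rewrite /a exprS; field.
have bS k : b k = b k.+1 + b k.+1 by rewrite /b exprS; field.
pose good k (p : R * R) := [/\ x1 <= p.1, p.1 + a k <= x2, y1 <= p.2, p.2 + b k <= y2 &
  m * (4^-1) ^+ k <= nr (bd f p.1 (p.1 + a k) p.2 (p.2 + b k) : C)].
(* [good] stands under the existential so that [choice] yields a total step function. *)
have step (kp : nat * (R * R)) : exists p' : R * R, good kp.1 kp.2 ->
    [/\ good kp.1.+1 p', kp.2.1 <= p'.1, p'.1 + a kp.1.+1 <= kp.2.1 + a kp.1,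
      kp.2.2 <= p'.2 & p'.2 + b kp.1.+1 <= kp.2.2 + b kp.1].
  case: kp => k [x y] /=.
  have [[/= g1 g2 g3 g4 g5]|ng] := pselect (good k (x, y)); last by exists (x, y).
  have := aS k; have := bS k; have := a0 k.+1; have := b0 k.+1 => bk0 ak0 bk ak.
  have [|p' [p1 p2' pB]] := @bd_quarter f x y (a k.+1) (b k.+1) ak0 bk0.
    by rewrite -!addrA -ak -bk => z [z1 z2]; apply: fd; split; lra.
  exists p' => _; rewrite -!addrA -ak -bk in pB.
  have g6 : m * 4^-1 ^+ k.+1 <= nr (bd f p'.1 (p'.1 + a k.+1) p'.2 (p'.2 + b k.+1) : C).
    have : m * 4^-1 ^+ k = 4 * (m * 4^-1 ^+ k.+1) by rewrite exprS; field.
    by clear -g5 pB; lra.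
  have [q1 q2] : x <= p'.1 /\ p'.1 + a k.+1 <= x + a k.
    by clear -p1 ak ak0; case: p1 => ->; lra.
  have [q3 q4] : y <= p'.2 /\ p'.2 + b k.+1 <= y + b k.
    by clear -p2' bk bk0; case: p2' => ->; lra.
  split=> //; split=> //; clear -g1 g2 g3 g4 q1 q2 q3 q4; lra.
have [g gP] := choice step.
pose s := fix s k := if k is k'.+1 then g (k', s k') else (x1, y1).
have sg k : good k (s k).
  elim: k => [|k IH]; last by have [] := gP (k, s k) IH.
  by rewrite /good /= /a /b !expr0 !mulr1 !(addrC x1) !(addrC y1) !subrK; split.
have smono1 k : (s k).1 <= (s k.+1).1 by have [] := gP (k, s k) (sg k).
have smono2 k : (s k).2 <= (s k.+1).2 by have [] := gP (k, s k) (sg k).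
have sdec1 k : (s k.+1).1 + a k.+1 <= (s k).1 + a k by have [] := gP (k, s k) (sg k).
have sdec2 k : (s k.+1).2 + b k.+1 <= (s k).2 + b k by have [] := gP (k, s k) (sg k).
have nest (u v : nat -> R) : (forall k, u k <= u k.+1) -> (forall k, v k.+1 <= v k) ->
    (forall k, u k <= v k) -> exists X, forall k, u k <= X <= v k.
  move=> um vm uv.
  have umono k l : (k <= l)%N -> u k <= u l.
    by move=> /subnK<-; elim: (l - k)%N => [|i IH] //; rewrite addSn (le_trans IH).
  have vmono k l : (k <= l)%N -> v l <= v k.
    by move=> /subnK<-; elim: (l - k)%N => [|i IH] //; rewrite addSn (le_trans _ IH).
  have uvkl k l : u k <= v l.
    by apply: le_trans (umono _ _ (leq_maxl k l)) (le_trans (uv _) (vmono _ _ (leq_maxr k l))).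
  exists (sup (range u)) => k; apply/andP; split.
    by apply: ub_le_sup; [exists (v 0%N) => _ [l _ <-] | exists k].
  by apply: ge_sup => [|_ [l _ <-]//]; exists (u 0%N), 0%N.
have [X XP] := nest (fun k => (s k).1) (fun k => (s k).1 + a k) smono1 sdec1 (fun k => ltac:(by rewrite lerDl)).
have [Y YP] := nest (fun k => (s k).2) (fun k => (s k).2 + b k) smono2 sdec2 (fun k => ltac:(by rewrite lerDl)).
pose p := cp X Y.
have pin k : in_rect (s k).1 ((s k).1 + a k) (s k).2 ((s k).2 + b k) p.
  by split; rewrite ?re_cp ?im_cp; [exact: XP | exact: YP].
have [kd fp] : exists k, cdiff f p k.
  apply: fd; have [i1 i2] := pin 0%N; have [j1 j2 j3 j4 _] := sg 0%N.
  by clear -i1 i2 j1 j2 j3 j4; split; lra.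
pose D := x2 - x1 + (y2 - y1).
have D0 : 0 <= D by rewrite /D; lra.
(* With the constant [m / (D ^+ 2 + 1)] the final estimate reads [m * (D ^+ 2 + 1) <= m * D ^+ 2], a
   contradiction even for a degenerate rectangle. *)
have D1 : 0 < D ^+ 2 + 1 by rewrite ltr_wpDl // sqr_ge0.
have [r r0 fr] := goursat_local fp (divr_gt0 m0 D1).
have [N hN] : exists N, D * 2^-1 ^+ N < r.
  have /cvgrPdist_lt/(_ r r0)[N _ hN] : (fun k => D * 2^-1 ^+ k) @ \oo --> (0 : R).
    by apply: cvg_geometric; rewrite ger0_norm ?invr_ge0 // invf_lt1 // ltr1n.
  exists N; have := hN N (leqnn N); rewrite /= sub0r normrN ger0_norm //.
  by rewrite mulr_ge0 // ltW.
have [h1 h2 h3 h4 h5] := sg N.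
have abD : a N + b N = D * 2^-1 ^+ N by rewrite /a /b /D; ring.
have := fr (s N).1 (s N).2 (a N) (b N) (a0 N) (b0 N) (ltac:(by rewrite abD)) (pin N).
have rin z : in_rect (s N).1 ((s N).1 + a N) (s N).2 ((s N).2 + b N) z -> exists k', cdiff f z k'.
  by move=> [z1 z2]; apply: fd; split; lra.
move=> /(_ rin)/(le_trans h5); rewrite abD exprMn -exprM mulnC exprM.
have -> : (2^-1 : R) ^+ 2 = 4^-1 by field.
rewrite mulrA ler_pM2r ?exprn_gt0 ?invr_gt0 // mulrAC ler_pdivlMr //.
nra.
Qed.

End Goursat.

(** * Cauchy estimates *)

Section Cauchy.
Variable R : realType.
Local Notation C := (Cplx R).

Lemma derivable_cdiff (f : C -> C) (z : C) : derivable f z 1 -> cdiff f z (f^`()%classic z).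
Proof.
move=> df e e0; rewrite derive1E.
have e0' : 0 < rc e by rewrite -rc0 ltr_rc.
have /cvgrPdist_le/(_ (rc e) e0') : (h^-1 *: ((f \o shift z) (h *: (1 : C)) - f z)) @[h --> 0^'] --> 'D_1 f z.
  exact: df.
rewrite near_withinE => /nbhs_nr[r r0 rF]; exists r => // w wr.
have [->|h0] := eqVneq w z; first by rewrite !subrr mulr0 subrr nr0 mulr0.
have := rF (w - z); rewrite subr0 subr_eq0 => /(_ wr h0).
rewrite /= (_ : (w - z) *: (1 : C) = w - z :> C) ?subrK; last exact: mulr1.
change (_ *: _) with ((w - z)^-1 * (f w - f z)); rewrite nrE ler_rc => hF.
have -> : f w - f z - 'D_1 f z * (w - z) = - ((w - z) * ('D_1 f z - (w - z)^-1 * (f w - f z))).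
  have wz : w - z != 0 by rewrite subr_eq0.
  by move: ('D_1 f z : C) (f w : C) (f z : C) => A B D; field.
by rewrite nrN nrM mulrC ler_wpM2r ?nr_ge0.
Qed.

Lemma cdiff_is_derive (f : C -> C) (z a : C) : cdiff f z a -> is_derive z 1 f a.
Proof.
move=> df; suff h : (h^-1 *: ((f \o shift z) (h *: (1 : C)) - f z)) @[h --> 0^'] --> a.
  by apply: DeriveDef; [apply/cvg_ex; exists a | apply: cvg_lim].
apply/cvgrPdist_le => e e0.
have eE : e = rc (re e).
  by move: e0; rewrite ltcE /= => /andP[/eqP h _]; apply: c_ext.
have e0' : 0 < re e by move: e0; rewrite ltcE => /andP[].
rewrite near_withinE; apply/nbhs_nr; have [r r0 fr] := df (re e) e0'.
exists r => // h; rewrite subr0 => hr h0.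
have {}h0 : (h : C) != 0 by [].
rewrite /= (_ : h *: (1 : C) = h :> C); last exact: mulr1.
have := fr (h + z); rewrite addrK => /(_ hr).
change (_ *: _) with (h^-1 * (f (h + z) - f z)).
rewrite eE nrE ler_rc => hF.
have -> : a - h^-1 * (f (h + z) - f z) = - h^-1 * (f (h + z) - f z - a * h).
  by move: (f (h + z) : C) (f z : C) (h : C) h0 => A B h' h0; field.
move: hF; move: (f (h + z) - f z - a * h) => D hF.
by rewrite nrM nrN nrV ler_pdivrMl ?nr_gt0 // mulrC.
Qed.

Lemma cdiff_inv (w z : C) : z != w -> cdiff (fun z => (z - w)^-1) z (- (z - w)^-1 ^+ 2).
Proof.
move=> zw; have zw' : z - w != 0 by rewrite subr_eq0.
have d0 := nr_gt0 zw'; set d := nr (z - w) in d0 *.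
move=> e e0.
have c0 : 0 < e * d ^+ 3 / 2 by rewrite divr_gt0 // mulr_gt0 // exprn_gt0.
exists (Num.min (d / 2) (e * d ^+ 3 / 2)); first by rewrite lt_min c0 divr_gt0.
move=> u; rewrite lt_min => /andP[u1 u2].
have uw : d / 2 <= nr (u - w).
  have := nr_dist z u w; rewrite -/d (nr_distC z); lra.
have uw0 : u - w != 0 by apply/eqP => h; move: uw; rewrite h nr0; lra.
have -> : (u - w)^-1 - (z - w)^-1 - - (z - w)^-1 ^+ 2 * (u - z) =
    (u - z) * ((u - z) / ((u - w) * (z - w) ^+ 2)) by field; rewrite zw'.
rewrite nrM mulrC ler_wpM2r ?nr_ge0 // nrM nrV nrM expr2 nrM -/d.
rewrite ler_pdivrMr; last by rewrite !mulr_gt0 //; lra.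
apply: (le_trans (ltW u2)); rewrite -mulrA ler_pM2l // exprS expr2 -/d.
rewrite mulrAC ler_pM2r ?mulr_gt0 //.
Qed.

Lemma rect_center (w : C) (s : R) : 0 < s ->
  in_rect (re w - s) (re w + s) (im w - s) (im w + s) w.
Proof. by move=> s0; split; lra. Qed.

Lemma edge_far (w z : C) (s : R) : 0 < s ->
  on_edge (re w - s) (re w + s) (im w - s) (im w + s) z -> s <= nr (z - w).
Proof.
move=> s0 [_ _ h].
have h1 := re_le (z - w); have h2 := im_le (z - w).
move: h1 h2; rewrite reD reN imD imN !ler_norml.
by case: h => ->; lra.
Qed.

(** The part outside the inner square is cut into four rectangles that avoid [w]; their integrals
    vanish by [goursat]. *)
Lemma bd_shrink (f : C -> C) (w : C) (s t : R) : 0 < t -> t <= s ->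
  (forall z, in_rect (re w - s) (re w + s) (im w - s) (im w + s) z -> z != w ->
    exists k, cdiff f z k) ->
  bd f (re w - s) (re w + s) (im w - s) (im w + s) =
  bd f (re w - t) (re w + t) (im w - t) (im w + t).
Proof.
move=> t0 ts fd; set x := re w in fd *; set y := im w in fd *.
have ec x1 x2 y1 y2 : x1 <= x2 -> y1 <= y2 -> x - s <= x1 -> x2 <= x + s ->
    y - s <= y1 -> y2 <= y + s -> x1 != x -> x2 != x -> y1 != y -> y2 != y ->
    edge_cont f x1 x2 y1 y2.
  move=> h1 h2 h3 h4 h5 h6 n1 n2 n3 n4; apply: edge_contP => // z [z1 z2 z3].
  apply: fd; first by split; lra.
  apply/eqP => zw; case: z3; rewrite zw -/x -/y => /eqP; rewrite eq_sym; exact/negP.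
have gr x1 x2 y1 y2 : x1 <= x2 -> y1 <= y2 -> x - s <= x1 -> x2 <= x + s ->
    y - s <= y1 -> y2 <= y + s -> [\/ x2 < x, x < x1, y2 < y | y < y1] ->
    bd f x1 x2 y1 y2 = 0.
  move=> h1 h2 h3 h4 h5 h6 n; apply: goursat => // z [z1 z2].
  apply: fd; first by split; lra.
  by apply/eqP => zw; move: z1 z2; rewrite zw -/x -/y; case: n; lra.
have ne (u v : R) : u < v -> u != v /\ v != u by move=> uv; rewrite lt_eqF // gt_eqF.
have [n1 _] := ne (x - s) x (ltac:(lra)); have [_ n2] := ne x (x + s) (ltac:(lra)).
have [n3 _] := ne (y - s) y (ltac:(lra)); have [_ n4] := ne y (y + s) (ltac:(lra)).
have [n5 _] := ne (x - t) x (ltac:(lra)); have [_ n6] := ne x (x + t) (ltac:(lra)).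
have [n7 _] := ne (y - t) y (ltac:(lra)); have [_ n8] := ne y (y + t) (ltac:(lra)).
rewrite (@bd_splitx _ f _ (x - t)); [|by clear -t0 ts; lra|by clear -t0 ts; lra|by apply: ec => //; clear -t0 ts; lra].
have -> : bd f (x - s) (x - t) (y - s) (y + s) = 0.
  by apply: gr; [..|apply: Or41]; clear -t0 ts; lra.
rewrite (@bd_splitx _ f _ (x + t)); [|by clear -t0 ts; lra|by clear -t0 ts; lra|by apply: ec => //; clear -t0 ts; lra].
have -> : bd f (x + t) (x + s) (y - s) (y + s) = 0.
  by apply: gr; [..|apply: Or42]; clear -t0 ts; lra.
rewrite (@bd_splity _ f _ _ _ (y - t)); [|by clear -t0 ts; lra|by clear -t0 ts; lra|by apply: ec => //; clear -t0 ts; lra].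
have -> : bd f (x - t) (x + t) (y - s) (y - t) = 0.
  by apply: gr; [..|apply: Or43]; clear -t0 ts; lra.
rewrite (@bd_splity _ f _ _ _ (y + t)); [|by clear -t0 ts; lra|by clear -t0 ts; lra|by apply: ec => //; clear -t0 ts; lra].
have -> : bd f (x - t) (x + t) (y + t) (y + s) = 0.
  by apply: gr; [..|apply: Or44]; clear -t0 ts; lra.
by rewrite !(add0r, addr0).
Qed.

Lemma reV (z : C) : re z^-1 = re z / (re z ^+ 2 + im z ^+ 2).
Proof. by case: z. Qed.
Lemma imV (z : C) : im z^-1 = - im z / (re z ^+ 2 + im z ^+ 2).
Proof. by case: z => a b; rewrite /im /=; rewrite mulNr. Qed.

Lemma re_cpB a b (w : C) : re (cp a b - w) = a - re w.
Proof. by rewrite reD reN re_cp. Qed.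
Lemma im_cpB a b (w : C) : im (cp a b - w) = b - im w.
Proof. by rewrite imD imN im_cp. Qed.

(* The integral is 2 i pi; a lower bound of its modulus is enough, and it follows
   from a pointwise estimate of the imaginary part on the four edges. *)
Lemma winding_ge (w : C) (s : R) : 0 < s ->
  4 <= nr (bd (fun z => (z - w)^-1) (re w - s) (re w + s) (im w - s) (im w + s) : C).
Proof.
move=> s0; set x := re w; set y := im w.
have [xs ys] : x - s <= x + s /\ y - s <= y + s by lra.
have [c1 c2 c3 c4] : edge_cont (fun z => (z - w)^-1) (x - s) (x + s) (y - s) (y + s).
  apply: edge_contP => // z zE; exists (- (z - w)^-1 ^+ 2); apply: cdiff_inv.
  by apply/eqP => zw; have := edge_far s0 zE; rewrite zw subrr nr0; lra.
(* On an edge, at distance [s] from [w], the integrand contributes [s / (u ^+ 2 + s ^+ 2)] to the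
   imaginary part, where [u] is the coordinate along the edge. As the edge has length [2 * s], it
   contributes at least 1. *)
have key (u : R) : `|u| <= s -> (2 * s)^-1 <= s / (u ^+ 2 + s ^+ 2).
  move=> us; have : u ^+ 2 <= s ^+ 2 by rewrite -(real_normK (num_real u)) ler_sqr ?nnegrE // ltW.
  move=> us2; have h : 0 < s ^+ 2 by rewrite exprn_gt0.
  have h' : 0 < u ^+ 2 + s ^+ 2 by rewrite ltr_wpDl ?sqr_ge0.
  rewrite -[leLHS]mul1r ler_pdivrMr ?mulr_gt0 // mulrAC ler_pdivlMr //; nra.
have len (a I : R) : (2 * s)^-1 * (a + s - (a - s)) <= I -> 1 <= I.
  by rewrite (_ : a + s - (a - s) = 2 * s) ?mulVf ?mulf_neq0 ?gt_eqF //; ring.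
apply: le_trans (im_le _); apply: le_trans (ler_norm _).
have i1 : 1 <= im (rint (fun t => (cp t (y - s) - w)^-1) (x - s) (x + s)).
  apply: (len x); apply: rint_im_ge => // t tx.
  rewrite imV re_cpB im_cpB -/x -/y.
  rewrite (_ : - (y - s - y) = s); last by ring.
  rewrite (_ : (y - s - y) ^+ 2 = s ^+ 2); last by ring.
  by apply: key; rewrite ler_norml; lra.
have i2 : 1 <= - im (rint (fun t => (cp t (y + s) - w)^-1) (x - s) (x + s)).
  rewrite -imN -mulN1r -rint_scal //.
  apply: (len x); apply: rint_im_ge => // [|t tx]; first exact: contdM_const.
  rewrite mulN1r imN imV re_cpB im_cpB -/x -/y.
  rewrite (_ : y + s - y = s); last by ring.
  rewrite mulNr opprK.
  by apply: key; rewrite ler_norml; lra.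
have i3 : 1 <= im (ci R * rint (fun t => (cp (x + s) t - w)^-1) (y - s) (y + s)).
  rewrite -rint_scal //.
  apply: (len y); apply: rint_im_ge => // [|t tx]; first exact: contdM_const.
  rewrite imM re_ci im_ci mul0r mul1r add0r reV re_cpB im_cpB -/x -/y.
  rewrite (_ : x + s - x = s) 1?addrC; last by ring.
  by apply: key; rewrite ler_norml; lra.
have i4 : 1 <= - im (ci R * rint (fun t => (cp (x - s) t - w)^-1) (y - s) (y + s)).
  rewrite -imN -mulNr -rint_scal //.
  apply: (len y); apply: rint_im_ge => // [|t tx]; first exact: contdM_const.
  rewrite mulNr imN imM re_ci im_ci mul0r mul1r add0r reV re_cpB im_cpB -/x -/y.
  rewrite -mulNr (_ : - (x - s - x) = s); last by ring.
  rewrite (_ : (x - s - x) ^+ 2 = s ^+ 2) 1?addrC; last by ring.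
  by apply: key; rewrite ler_norml; lra.
rewrite /bd !(imD, imN); move: i1 i2 i3 i4; lra.
Qed.


Lemma cdiff_lin (f g : C -> C) (z a b k : C) : cdiff f z a -> cdiff g z b ->
  cdiff (fun w => f w + k * g w) z (a + k * b).
Proof.
move=> fa gb e e0; have k0 := nr_ge0 (k : C).
have [r r0 fr] := fa (e / 2) (ltac:(lra)).
have [s s0 gs] := gb (e / 2 / (nr (k : C) + 1)) (ltac:(rewrite !divr_gt0 //; lra)).
exists (Num.min r s); first by rewrite lt_min r0.
move=> w; rewrite lt_min => /andP[/fr h1 /gs].
rewrite mulrAC ler_pdivlMr; last lra.
move=> h2.
have -> : f w + k * g w - (f z + k * g z) - (a + k * b) * (w - z) =
  (f w - f z - a * (w - z)) + k * (g w - g z - b * (w - z)) by ring.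
apply: (le_trans (nrD _ _)); rewrite nrM.
have := nr_ge0 (g w - g z - b * (w - z)); nra.
Qed.

Lemma cdiff_mul (f g : C -> C) (z a b : C) : cdiff f z a -> cdiff g z b ->
  cdiff (fun w => f w * g w) z (a * g z + f z * b).
Proof.
move=> fa gb e e0.
set A := nr (a : C); have A0 : 0 <= A by exact: nr_ge0.
set F := nr (f z : C); have F0 : 0 <= F by exact: nr_ge0.
set G := nr (g z : C); have G0 : 0 <= G by exact: nr_ge0.
have [r1 r10 h1] := fa (e / 3 / (G + 1)) (ltac:(rewrite !divr_gt0 //; lra)).
have [r2 r20 h2] := gb (e / 3 / (F + 1)) (ltac:(rewrite !divr_gt0 //; lra)).
have [r3 r30 h3] := cdiff_cont gb (e := Num.min 1 (e / 3 / (A + 1)))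
  (ltac:(rewrite lt_min ltr01 /= !divr_gt0 //; lra)).
exists (Num.min r1 (Num.min r2 r3)); first by rewrite !lt_min r10 r20.
move=> w; rewrite !lt_min => /andP[/h1 {}h1 /andP[/h2 {}h2 /h3]].
rewrite lt_min => /andP[h3a h3b].
move: h1 h2 h3b; set d := nr (w - z); have d0 : 0 <= d by exact: nr_ge0.
have -> : f w * g w - f z * g z - (a * g z + f z * b) * (w - z) =
  (f w - f z - a * (w - z)) * g w + a * (w - z) * (g w - g z)
  + f z * (g w - g z - b * (w - z)) by ring.
move=> h1 h2 h4.
have {}h1 : nr (f w - f z - a * (w - z)) * (G + 1) <= e / 3 * d.
  by rewrite -ler_pdivlMr ?ltr_wpDl // mulrAC.
have {}h2 : nr (g w - g z - b * (w - z)) * (F + 1) <= e / 3 * d.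
  by rewrite -ler_pdivlMr ?ltr_wpDl // mulrAC.
have {}h4 : nr (g w - g z) * (A + 1) < e / 3 by rewrite -ltr_pdivlMr ?ltr_wpDl.
apply: (le_trans (nrD _ _)); rewrite nrM -/F.
have := nrD ((f w - f z - a * (w - z)) * g w) (a * (w - z) * (g w - g z)).
rewrite !nrM -/A -/d.
have gw : nr (g w : C) <= G + 1.
  have := nrD (g w - g z) (g z); rewrite subrK -/G; lra.
have := nr_ge0 (f w - f z - a * (w - z)); have := nr_ge0 (g w - g z).
have := nr_ge0 (g w - g z - b * (w - z)).
move: h1 h2 h4 gw; set P := nr (_ - _ - _); set Q := nr (g w - _ - _); set S := nr (_ - _).
set W := nr (g w : C) => h1 h2 h4 gw Q0 S0 P0 T.
have t1 : P * W <= P * (G + 1) by rewrite ler_wpM2l.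
have t2 : F * Q <= Q * (F + 1) by nra.
have t3 : A * d * S <= e / 3 * d by nra.
lra.
Qed.

(* With [A] the derivative at [w], the function
   [(f z - f w - A (z - w)) / (z - w)^2] is o(1 / |z - w|) at [w], so that its
   integral vanishes on small squares, hence on the large one. As [(z - w)^-2] has
   a primitive, [A] times the winding integral is the integral of
   [f z / (z - w)^2]. *)
Lemma cauchy_deriv (f : C -> C) (w : C) (s M : R) : 0 < s ->
  (forall z, in_rect (re w - s) (re w + s) (im w - s) (im w + s) z -> derivable f z 1) ->
  (forall z, in_rect (re w - s) (re w + s) (im w - s) (im w + s) z -> nr (f z : C) <= M) ->
  nr (f^`()%classic w : C) <= 2 * M / s.
Proof.
move=> s0 fd fM; set A : C := f^`()%classic w.
have fD z : in_rect (re w - s) (re w + s) (im w - s) (im w + s) z ->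
   cdiff f z (f^`()%classic z) by move=> /fd/derivable_cdiff.
pose K (z : C) : C := (z - w)^-1.
pose g (z : C) : C := f w + A * (z - w).
have gD z : cdiff g z A.
  move=> e e0; exists 1 => // u _.
  have -> : g u - g z - A * (u - z) = 0 by rewrite /g; ring.
  by rewrite nr0 mulr_ge0 ?nr_ge0 // ltW.
pose h (z : C) : C := (f z + (-1) * g z) * (K z * K z).
have hD z : in_rect (re w - s) (re w + s) (im w - s) (im w + s) z -> z != w ->
    exists k, cdiff h z k.
  move=> zin zw; have Kz := cdiff_inv zw.
  by eexists; exact: cdiff_mul (cdiff_lin (-1) (fD z zin) (gD z)) (cdiff_mul Kz Kz).
have hne x : 0 < x -> forall z, on_edge (re w - x) (re w + x) (im w - x) (im w + x) z -> z != w.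
  move=> x0 z zE; apply/eqP => zw; have := edge_far x0 zE; rewrite zw subrr nr0; lra.
have sub x : x <= s -> forall z, on_edge (re w - x) (re w + x) (im w - x) (im w + x) z ->
    in_rect (re w - s) (re w + s) (im w - s) (im w + s) z.
  by move=> xs z /on_edge_rect[z1 z2]; split; lra.
have h0 : bd h (re w - s) (re w + s) (im w - s) (im w + s) = 0.
  apply: nr_le0; apply/ler_addgt0Pr => e e0; rewrite add0r.
  (* The inner square has perimeter [8 * t], and the integrand will be at most [e / 8 / t] on it. *)
  have [r r0 fr] := fD w (rect_center w s0) (e / 8) (ltac:(lra)).
  pose t := Num.min s (r / 4).
  have t0 : 0 < t by rewrite lt_min s0; lra.
  have ts : t <= s by rewrite ge_min lexx.
  have tr : t <= r / 4 by rewrite ge_min lexx orbT.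
  rewrite (bd_shrink t0 ts hD).
  have xt (x : R) : x - t <= x + t by lra.
  have hE : edge_cont h (re w - t) (re w + t) (im w - t) (im w + t).
    by apply: edge_contP => // z zE; apply: hD; [exact: sub zE | exact: hne zE].
  apply: (le_trans (bd_le (M := e / 8 / t) (xt _) (xt _) hE _)); last first.
    rewrite (_ : 2 * _ + _ = 8 * t); last by ring.
    by rewrite (_ : e / 8 / t * (8 * t) = e) //; field; lra.
  move=> z zE; have zt := edge_far t0 zE.
  have zr : nr (z - w) < r.
    apply: (le_lt_trans (nr_le_reim _)); case: zE => z1 z2 _.
    have l1 : `|re (z - w)| <= t by rewrite reD reN ler_norml; lra.
    have l2 : `|im (z - w)| <= t by rewrite imD imN ler_norml; lra.
    lra.
  have := fr z zr.
  have -> : f z - f w - f^`()%classic w * (z - w) = f z + -1 * g z by rewrite /g -/A; ring.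
  have zp : 0 < nr (z - w) by lra.
  rewrite /h /K !nrM !nrV => hz.
  rewrite mulrA ler_pdivrMr // ler_pdivrMr //.
  apply: (le_trans hz).
  have tn : 1 <= t^-1 * nr (z - w) by rewrite ler_pdivlMl // mulr1.
  have -> : e / 8 / t * nr (z - w) * nr (z - w) = e / 8 * nr (z - w) * (t^-1 * nr (z - w)).
    by ring.
  rewrite ler_peMr //.
  by rewrite mulr_ge0 ?nr_ge0 // divr_ge0 // ltW.
have xs (x : R) : x - s <= x + s by lra.
have fE : edge_cont f (re w - s) (re w + s) (im w - s) (im w + s).
  by apply: edge_contP => // z zE; exists (f^`()%classic z); apply: fD; apply: sub zE.
have KE : forall z, on_edge (re w - s) (re w + s) (im w - s) (im w + s) z ->
    cdiff K z (- K z ^+ 2).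
  by move=> z zE; apply: cdiff_inv; exact: hne zE.
pose FK (z : C) : C := f z * (K z * K z).
have FKE : edge_cont FK (re w - s) (re w + s) (im w - s) (im w + s).
  apply: edge_contP => // z zE; eexists; apply: cdiff_mul (fD z (sub s (lexx _) z zE)) _.
  by apply: cdiff_mul; exact: KE.
have KEc : edge_cont K (re w - s) (re w + s) (im w - s) (im w + s).
  by apply: edge_contP => // z zE; eexists; exact: KE.
have K2E : edge_cont (fun z => K z ^+ 2) (re w - s) (re w + s) (im w - s) (im w + s).
  apply: edge_contP => // z zE; eexists.
  by rewrite (_ : (fun z => K z ^+ 2) = (fun z => K z * K z)) //; apply: cdiff_mul; exact: KE.
have K20 : bd (fun z => K z ^+ 2) (re w - s) (re w + s) (im w - s) (im w + s) = 0.
  apply: (bd_prim (F := fun z => 0 + (-1) * K z)) => // z zE.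
  have c0 : cdiff (fun _ : C => 0) z 0.
    by move=> e e0; exists 1 => // u _; rewrite subrr mul0r subrr nr0 mulr_ge0 ?nr_ge0 // ltW.
  by have := cdiff_lin (-1) c0 (KE z zE); rewrite add0r mulN1r opprK.
have FKbd : bd FK (re w - s) (re w + s) (im w - s) (im w + s) =
    A * bd K (re w - s) (re w + s) (im w - s) (im w + s).
  have e1 := bd_lin (- f w) (xs _) (xs _) FKE K2E.
  have hE2 : edge_cont (fun z => FK z + - f w * K z ^+ 2) (re w - s) (re w + s) (im w - s) (im w + s).
    apply: edge_contP => // z zE; eexists; apply: cdiff_lin.
      apply: cdiff_mul (fD z (sub s (lexx _) z zE)) _; apply: cdiff_mul; exact: KE.
    by rewrite (_ : (fun z => K z ^+ 2) = (fun z => K z * K z)) //; apply: cdiff_mul; exact: KE.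
  have e2 := bd_lin (- A) (xs _) (xs _) hE2 KEc.
  rewrite e1 K20 mulr0 addr0 in e2.
  have e3 : bd (fun z => FK z + - f w * K z ^+ 2 + - A * K z) (re w - s) (re w + s) (im w - s) (im w + s) = 0.
    rewrite -h0; apply: bd_ext => // [|z zE].
      by apply: edge_contP => // z zE; apply: hD; [exact: sub zE | exact: hne zE].
    have zw := hne s s0 z zE; have zw' : z - w != 0 by rewrite subr_eq0.
    by rewrite /FK /h /g /K; field.
  by apply/eqP; rewrite -subr_eq0 -mulNr -e2 e3.
(* The constant 2 of the conclusion: the bound [M / s ^+ 2] times the perimeter [8 * s], divided by
   the lower bound 4 of the winding integral. *)
have J := winding_ge w s0.
have := bd_le (M := M / s ^+ 2) (xs _) (xs _) FKE.
rewrite FKbd nrM (_ : 2 * _ + _ = 8 * s); last by ring.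
have s2 : 0 < s ^+ 2 by rewrite exprn_gt0.
move=> bb.
have {}bb : nr (A : C) * nr (bd K (re w - s) (re w + s) (im w - s) (im w + s) : C) <= M / s ^+ 2 * (8 * s).
  apply: bb => z zE; rewrite /FK /K !nrM !nrV -invfM.
  have zs := edge_far s0 zE; have fz := fM z (sub s (lexx _) z zE).
  have f0 := nr_ge0 (f z : C).
  apply: ler_pM => //; first by rewrite invr_ge0 mulr_ge0 // nr_ge0.
  by rewrite lef_pV2 ?posrE ?expr2 ?mulr_gt0 //; [apply: ler_pM; lra | lra | lra].
have A0 := nr_ge0 A.
have -> : 2 * M / s = M / s ^+ 2 * (8 * s) / 4 by field; lra.
by rewrite ler_pdivlMr //; apply: le_trans bb; rewrite ler_wpM2l.
Qed.

End Cauchy.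

(** * Locally uniform limits of holomorphic functions *)

Section Weierstrass.
Variable R : realType.
Local Notation C := (Cplx R).

Lemma segment_lip (f a : C -> C) (w1 w2 : C) (L : R) :
  (forall t, 0 <= t <= 1 -> cdiff f (w1 + rc t * (w2 - w1)) (a (w1 + rc t * (w2 - w1)))) ->
  (forall t, 0 <= t <= 1 -> nr (a (w1 + rc t * (w2 - w1)) : C) <= L) ->
  nr (f w2 - f w1 : C) <= L * nr (w2 - w1 : C).
Proof.
move=> fd aL; set v := w2 - w1.
pose P t : C := f (w1 + rc t * v).
have pE t h : w1 + rc (t + h) * v - (w1 + rc t * v) = rc h * v by rewrite rcD; ring.
have := @mvi R C 0 1 P (fun t => a (w1 + rc t * v) * v) (L * nr v) (ltac:(lra)).
rewrite /P rc1 rc0 mul1r mul0r addr0 subr0 mulr1 /v (addrC w1) subrK; apply.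
  split=> [t t01 e e0|t t01 e e0].
    have [r r0 fr] := cdiff_cont (fd t t01) e0.
    have v0 := nr_ge0 v.
    exists (r / (nr v + 1)); first by rewrite divr_gt0 //; lra.
    move=> s s01; rewrite ltr_pdivlMr; last lra.
    move=> st; apply: fr.
    rewrite (_ : s = t + (s - t)); last by ring.
    rewrite pE nrM nr_rc; apply: le_lt_trans st.
    by rewrite ler_wpM2l //; rewrite /v; lra.
  have v0 := nr_ge0 v.
  have [r r0 fr] := fd t (ltac:(lra)) (e / (nr v + 1)) (ltac:(rewrite divr_gt0 //; lra)).
  exists (r / (nr v + 1)); first by rewrite divr_gt0 //; lra.
  move=> h /andP[h0 hr] _; move: hr; rewrite ltr_pdivlMr; last lra.
  move=> hr; have := fr (w1 + rc (t + h) * v); rewrite pE nrM nr_rc ger0_norm; last exact: ltW.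
  move=> /(_ (ltac:(rewrite /v; nra))) le.
  have -> : rc h *: (a (w1 + rc t * (w2 - w1)) * (w2 - w1)) = a (w1 + rc t * v) * (rc h * v).
    by rewrite /GRing.scale /= /v; ring.
  apply: (le_trans le); rewrite mulrAC ler_pdivrMr; last lra.
  by nra.
move=> t t01; rewrite nrM ler_wpM2r ?nr_ge0 //; apply: aL; lra.
Qed.

Lemma nr_square (w z : C) (s : R) :
  in_rect (re w - s) (re w + s) (im w - s) (im w + s) z -> nr (z - w) <= 2 * s.
Proof.
move=> [z1 z2]; apply: (le_trans (nr_le_reim _)).
have l1 : `|re (z - w)| <= s by rewrite reD reN ler_norml; lra.
have l2 : `|im (z - w)| <= s by rewrite imD imN ler_norml; lra.
lra.
Qed.

(** A square of half-side [s] centred on the segment from [w] to [v] stays within [3 * s] of [w], by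
    [nr_square]. The Cauchy estimate thus bounds the derivative along the whole segment. *)
Lemma hol_ball_lip (f : C -> C) (w : C) (s M : R) : 0 < s ->
  (forall z, nr (z - w : C) <= 3 * s -> derivable f z 1) ->
  (forall z, nr (z - w : C) <= 3 * s -> nr (f z : C) <= M) ->
  forall v, nr (v - w : C) <= s -> nr (f v - f w : C) <= 2 * M / s * nr (v - w : C) /\
    nr (f^`()%classic w : C) <= 2 * M / s.
Proof.
move=> s0 fd fM v vs.
have d t z : 0 <= t <= 1 -> nr (z - (w + rc t * (v - w))) <= 2 * s -> nr (z - w) <= 3 * s.
  move=> t01 h; rewrite -(subrKA (w + rc t * (v - w))).
  apply: (le_trans (nrD _ _)); rewrite [X in _ + nr X](_ : _ = rc t * (v - w)); last by ring.
  rewrite nrM nr_rc ger0_norm; last lra.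
  have := nr_ge0 (v - w); nra.
split; last first.
  apply: cauchy_deriv => // z /nr_square zs; [apply: fd|apply: fM]; lra.
apply: (segment_lip (a := fun z => f^`()%classic z)) => t t01.
  apply: derivable_cdiff; apply: fd; apply: (d t) => //; rewrite subrr nr0; lra.
by apply: cauchy_deriv => // z /nr_square zs; [apply: fd|apply: fM]; apply: (d t).
Qed.

(* By the Cauchy estimates the difference quotients at [w] converge uniformly. *)
Lemma weierstrass (F : nat -> C -> C) (f : C -> C) (w : C) (r : R) : 0 < r ->
  (forall m z, nr (z - w : C) <= r -> derivable (F m) z 1) ->
  (forall e : R, 0 < e -> exists N, forall m z, (N <= m)%N -> nr (z - w : C) <= r ->
    nr (F m z - f z : C) <= e) ->
  derivable f w 1.
Proof.
move=> r0 Fd Ff; pose s := r / 3.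
have s0 : 0 < s by rewrite divr_gt0.
have s3 : 3 * s = r by rewrite /s; field.
have cau (e : R) : 0 < e -> exists N, forall m l, (N <= m)%N -> (N <= l)%N ->
   (forall v, nr (v - w : C) <= s ->
     nr (F m v - F m w - (F l v - F l w) : C) <= e * nr (v - w : C)) /\
   nr ((F m)^`()%classic w - (F l)^`()%classic w : C) <= e.
  (* [F m] and [F l] then differ by at most [e * s / 2], and the Cauchy estimate multiplies this by
     [2 / s]. *)
  move=> e0; have es : 0 < e * s / 4 by rewrite divr_gt0 // mulr_gt0.
  have [N FN] := Ff _ es.
  exists N => m l Nm Nl.
  have Dd z : nr (z - w) <= r -> derivable (F m - F l) z 1.
    by move=> zr; apply: derivableB; apply: Fd.
  have DM z : nr (z - w) <= r -> nr ((F m - F l) z : C) <= e * s / 2.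
    move=> zr; have := FN m z Nm zr; have := FN l z Nl zr.
    have := nr_dist (F m z) (f z) (F l z); rewrite (nr_distC (f z)).
    change ((F m - F l) z) with (F m z - F l z); lra.
  have eE : 2 * (e * s / 2) / s = e by field; lra.
  have main := hol_ball_lip (f := F m - F l) (w := w) (M := e * s / 2) s0.
  rewrite s3 eE in main; have {}main := main Dd DM.
  split=> [v vs|]; last first.
    have [_] := main w (ltac:(rewrite subrr nr0; lra)).
    by rewrite !derive1E deriveB //; apply: Fd; rewrite subrr nr0; lra.
  have [h _] := main v vs; apply: le_trans h.
  rewrite (_ : _ - _ - _ = (F m - F l) v - (F m - F l) w) //.
  by change (F m v - F m w - (F l v - F l w) = F m v - F l v - (F m w - F l w)); ring.
have [|A AP] := @c_cauchy R (fun m => (F m)^`()%classic w : C).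
  move=> e e0; have [N hN] := cau (e / 2) (ltac:(lra)); exists N => k l Nk Nl.
  have [_ h] := hN k l Nk Nl; lra.
suff : cdiff f w A by move=> /cdiff_is_derive h; exact: ex_derive.
move=> e e0.
have [N1 h1] := cau (e / 3) (ltac:(lra)).
have [N2 h2] := AP (e / 3) (ltac:(lra)).
pose N := maxn N1 N2.
have [d d0 fd] := derivable_cdiff (Fd N w (ltac:(rewrite subrr nr0; lra))) (e := e / 3) (ltac:(lra)).
exists (Num.min d s); first by rewrite lt_min d0.
move=> v; rewrite lt_min => /andP[vd vs].
have {}fd := fd v vd.
have hA := h2 N (leq_maxr _ _).
(* Here [m] tends to infinity in [cau] with [N] and [v] fixed, which replaces [F m] by [f]. *)
have lim : nr (f v - f w - (F N v - F N w) : C) <= e / 3 * nr (v - w).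
  apply/ler_addgt0Pr => x x0.
  have [N3 h3] := Ff (x / 2) (ltac:(lra)).
  pose m := maxn N1 N3.
  have [+ _] := h1 m N (leq_maxl _ _) (leq_maxl _ _).
  move=> /(_ v (ltW vs)).
  have a1 := h3 m v (leq_maxr _ _) (ltac:(lra)).
  have a2 := h3 m w (leq_maxr _ _) (ltac:(rewrite subrr nr0; lra)).
  have -> : f v - f w - (F N v - F N w) = (F m v - F m w - (F N v - F N w)) - (F m v - f v) + (F m w - f w) by ring.
  move=> a3; apply: (le_trans (nrD _ _)).
  have := nrB (F m v - F m w - (F N v - F N w)) (F m v - f v); lra.
have -> : f v - f w - A * (v - w) = (f v - f w - (F N v - F N w)) +
  (F N v - F N w - (F N)^`()%classic w * (v - w)) + ((F N)^`()%classic w - A) * (v - w) by ring.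
apply: (le_trans (nrD _ _)); rewrite nrM.
have := nrD (f v - f w - (F N v - F N w)) (F N v - F N w - (F N)^`()%classic w * (v - w)).
have := nr_ge0 (v - w).
move: hA lim fd; set a := nr _; set b := nr _; set c := nr _; nra.
Qed.

End Weierstrass.

(** * Lipschitz bounds for holomorphic maps of several variables, and compact balls *)

Section VectorHolomorphic.
Variable R : realType.
Variable n : nat.
Local Notation C := (Cplx R).
Local Notation V := (Cn R n).

Lemma differentiable_line (x v : V) (z : C) :
  differentiable (fun k : C => x + k *: v) z.
Proof.
apply: differentiableD; first exact: differentiable_cst.
exact: ex_diff.
Qed.

Lemma hol_line_coord (X : V -> V) (x v : V) (j : 'I_n) (z : C) :
  differentiable X (x + z *: v) -> derivable (fun k : C => X (x + k *: v) ord0 j : C) z 1.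
Proof.
move=> Xd; apply/derivable1_diffP.
have h1 : differentiable (X \o (fun k : C => x + k *: v)) z.
  by apply: differentiable_comp => //; exact: differentiable_line.
exact: (differentiable_comp h1 (@differentiable_coord C 1 n _ ord0 j)).
Qed.

Lemma nr_convex (x y p : V) (r t : R) : 0 <= t <= 1 -> nr (x - p) <= r -> nr (y - p) <= r ->
  nr (x + rc t *: (y - x) - p) <= r.
Proof.
move=> t01 xr yr.
have -> : x + rc t *: (y - x) - p = rc (1 - t) *: (x - p) + rc t *: (y - p).
  by rewrite rcB rc1; lmod (Cplx R) V.
apply: (le_trans (nrD _ _)); rewrite !nrZr !ger0_norm; try lra.
nra.
Qed.

(* Only restrictions to complex lines are used, so that one complex variable suffices. *)
Lemma hol_lip (X : V -> V) (p : V) (r K : R) : 0 < r ->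
  (forall x, nr (x - p) < 4 * r -> differentiable X x) ->
  (forall x, nr (x - p) < 4 * r -> nr (X x) <= K) ->
  forall x y, nr (x - p) <= r -> nr (y - p) <= r ->
    nr (X y - X x) <= 2 * K / r * nr (y - x).
Proof.
move=> r0 Xd XK x y xr yr.
have [->|yx] := eqVneq y x; first by rewrite !subrr !nr0 mulr0.
pose d := nr (y - x).
have d0 : 0 < d.
  rewrite lt_neqAle nr_ge0 andbT eq_sym; apply/eqP => /nr_eq0 /eqP.
  by rewrite subr_eq0 (negPf yx).
(* On the complex line through [x] and [y] the parameter moves points at speed [d], so the parameter
   radius [r / d] corresponds to the distance [r]. *)
have s0 : 0 < r / d by rewrite divr_gt0.
have K0 : 0 <= K by apply: le_trans (nr_ge0 _) (XK p _); rewrite subrr nr0 mulr_gt0.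
have ball t (z : C) : 0 <= t <= 1 -> nr (z - rc t) <= 2 * (r / d) ->
    nr (x + z *: (y - x) - p) < 4 * r.
  move=> t01 zt.
  have -> : x + z *: (y - x) - p = (z - rc t) *: (y - x) + (x + rc t *: (y - x) - p).
    by lmod (Cplx R) V.
  apply: (le_lt_trans (nrD _ _)); rewrite nrZ.
  have := nr_convex t01 xr yr.
  have : nr (z - rc t) * nr (y - x) <= 2 * (r / d) * d by rewrite ler_wpM2r // nr_ge0.
  rewrite -mulrA divfK ?gt_eqF //; lra.
have := nr_le_coord (v := X y - X x) (e := 2 * K / r * d).
apply; first by rewrite !mulr_ge0 // ?invr_ge0 ?ltW.
move=> j; rewrite !mxE.
pose f (k : C) : C := X (x + k *: (y - x)) ord0 j.
have := @segment_lip R f (fun z => f^`()%classic z) 0 1 (2 * K / (r / d)).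
rewrite /f scale1r scale0r addr0 (addrC x) subrK subr0 nr1 mulr1.
have -> : 2 * K / (r / d) = 2 * K / r * d by field; lra.
apply=> t t01; rewrite add0r mulr1.
  apply: derivable_cdiff; apply: hol_line_coord; apply: Xd; apply: (ball t) => //.
  by rewrite subrr nr0 mulr_ge0 // ltW.
rewrite (_ : 2 * K / r * d = 2 * K / (r / d)); last by field; lra.
apply: cauchy_deriv => // z /nr_square zs.
  by apply: hol_line_coord; apply: Xd; apply: (ball t).
by apply: le_trans (nr_coord _ _) _; apply: XK; apply: (ball t).
Qed.

Lemma closed_cball (W : normedModType C) (p : W) (r : R) : closed [set v : W | nr (v - p) <= r].
Proof.
rewrite -[X in closed X]setCK; apply: open_closedC.
rewrite openE => x /= /negP; rewrite -ltNge => xr.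
apply/nbhs_nr; exists (nr (x - p) - r); first by rewrite subr_gt0.
move=> y yx; apply/negP; rewrite -ltNge.
have := nr_dist x y p; rewrite (nr_distC x y); lra.
Qed.

Lemma compact_square (M : R) : compact [set z : C | `|re z| <= M /\ `|im z| <= M].
Proof.
have cpc : continuous (fun p : R * R => cp p.1 p.2 : C).
  move=> [x y] A /nbhs_nr[e e0 eA]; apply/nbhs_ballP; exists (e / 2); first by rewrite /= divr_gt0.
  move=> [u v] [/= h1 h2]; apply: eA.
  rewrite /ball /= in h1 h2.
  have -> : cp u v - cp x y = rc (u - x) + ci R * rc (v - y) by rewrite /cp !rcB; ring.
  apply: (le_lt_trans (nrD _ _)); rewrite nrM nr_ci mul1r !nr_rc (distrC u) (distrC v).
  lra.
have := @continuous_compact _ _ _ _ (continuous_subspaceT cpc)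
  (compact_setX (segment_compact (a := - M) (b := M)) (segment_compact (a := - M) (b := M))).
congr compact; apply/seteqP; split=> [_ [[x y] [/= + +] <-]|z [/= z1 z2]].
  by rewrite re_cp im_cp !in_itv !ler_norml.
exists (re z, im z); last exact: cp_reim.
by split; rewrite /= in_itv /= -ler_norml.
Qed.

(** A closed subset of a product of compact squares, since [M] bounds every coordinate on the
    ball. *)
Lemma compact_cball (p : V) (r : R) : compact [set v : V | nr (v - p) <= r].
Proof.
pose M := nr p + r.
have cQ := @rV_compact C n _ (fun=> @compact_square M).
apply: (subclosed_compact _ cQ); first exact: closed_cball.
move=> v /= vp i.
have h : nr (v ord0 i : C) <= M.
  apply: (le_trans (nr_coord v i)); rewrite -(subrK p v) /M addrC.
  by apply: (le_trans (nrD _ _)); rewrite lerD2l.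
by split; [apply: le_trans (re_le _) h | apply: le_trans (im_le _) h].
Qed.

End VectorHolomorphic.

(* [lra] compares its atoms up to conversion, which is slow on vectors; plain [lra] is
   needed only when two norms agree up to conversion but not syntactically. *)
Ltac nr_lra :=
  first [ solve [ repeat match goal with
                  | |- context [@nr ?R ?V ?v] => generalize (@nr R V v)
                  end; intros; lra ]
        | lra ].

(** * Local existence and uniqueness for differential equations *)

Section LocalODE.
Variable R : realType.
Local Notation C := (Cplx R).

Lemma mvi_aff (W : normedModType C) (a b : R) (P c : R -> W) (v : W) (M : R) :
  a <= b -> rprim a b P c -> (forall t, a <= t < b -> nr (c t - v) <= M) ->
  nr (P b - P a - rc (b - a) *: v) <= M * (b - a).
Proof.
move=> ab Pc cM.
have := mvi ab (rprim_lin (-1) Pc (rprim_aff a b 0 v)) (M := M).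
rewrite (_ : _ - _ = P b - P a - rc (b - a) *: v); last by rewrite rcB; lmod C W.
by apply=> t tab; rewrite scaleN1r; apply: cM.
Qed.

Lemma geo_small (x e : R) : 0 < e -> exists N, x * 2^-1 ^+ N < e.
Proof.
move=> e0; have /cvgrPdist_lt/(_ e e0)[N _ hN] : (fun k => x * 2^-1 ^+ k) @ \oo --> (0 : R).
  by apply: cvg_geometric; rewrite ger0_norm ?invr_ge0 // invf_lt1 // ltr1n.
by exists N; have := hN N (leqnn N); rewrite /= sub0r normrN ltr_norml => /andP[].
Qed.

(** The data of the Picard-Lindelof theorem: [K * T <= r] keeps curves of speed at most [K] in the
    ball, and [L * T <= 2^-1] makes the Picard operator contract by one half. *)
Record lip_field n (X : Cn R n -> Cn R n) (x0 : Cn R n) (r K L T : R) : Prop := LipField {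
  lf_r : 0 <= r;
  lf_K : 0 <= K;
  lf_L : 0 <= L;
  lf_T : 0 < T;
  lf_KT : K * T <= r;
  lf_LT : L * T <= 2^-1;
  lf_bound : forall x, nr (x - x0) <= r -> nr (X x) <= K;
  lf_lip : forall x y, nr (x - x0) <= r -> nr (y - x0) <= r ->
    nr (X y - X x) <= L * nr (y - x)
}.

Definition in_ball n (x0 : Cn R n) (r T : R) (c : R -> Cn R n) :=
  forall t, 0 <= t <= T -> nr (c t - x0) <= r.

Lemma contd_lip n (X : Cn R n -> Cn R n) (x0 : Cn R n) (r K L T : R) (c : R -> Cn R n) :
  lip_field X x0 r K L T -> contd (@nrdist R (Cn R n)) c 0 T -> in_ball x0 r T c ->
  contd (@nrdist R (Cn R n)) (X \o c) 0 T.
Proof.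
move=> [r0 K0 L0 T0 KT LT XK XL] cc cb t tT e e0.
have eL : 0 < e / (L + 1) by rewrite divr_gt0 // ltr_wpDl.
have [d d0 cd] := cc t tT _ eL.
exists d => // s sT st; have := cd s sT st; rewrite /nrdist /= ltr_pdivlMr ?ltr_wpDl //.
have := XL _ _ (cb t tT) (cb s sT); have := nr_ge0 (c s - c t); nra.
Qed.

Lemma picard_step n (X : Cn R n -> Cn R n) (x0 : Cn R n) (r K L T : R) (c : R -> Cn R n) :
  lip_field X x0 r K L T -> contd (@nrdist R (Cn R n)) c 0 T -> in_ball x0 r T c ->
  exists c' : R -> Cn R n, [/\ rprim 0 T c' (X \o c), c' 0 = x0 & in_ball x0 r T c'].
Proof.
move=> lf cc cb; have [r0 K0 L0 T0 KT LT XK XL] := lf.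
have [P Pc] := rprim_exists T0 (contd_lip lf cc cb).
have h := rprim_lin 1 (rprim_aff 0 T (x0 - P 0) 0) Pc.
have {}h : rprim 0 T (fun t => x0 + (P t - P 0)) (X \o c).
  apply: rprim_ext h => t _; last by lmod C (Cn R n).
  by lmod C (Cn R n).
exists (fun t => x0 + (P t - P 0)); split=> //; first by rewrite subrr addr0.
move=> t /andP[t0 tT].
have := mvi t0 (rprim_sub (lexx _) tT Pc) (M := K).
rewrite (_ : x0 + (P t - P 0) - x0 = P t - P 0); last by lmod C (Cn R n).
rewrite subr0 => /(_ _)/le_trans; apply.
  by move=> s st; apply: XK; apply: cb; lra.
by apply: le_trans KT; rewrite ler_wpM2l.
Qed.

(** Successive iterates differ by a geometric sequence of ratio one half. The limit inherits the
    Lipschitz bound [clip] and the second order estimate [cder] from the iterates, and these give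
    its continuity and its right derivative. *)
Lemma picard n (X : Cn R n -> Cn R n) (x0 : Cn R n) (r K L T : R) :
  lip_field X x0 r K L T -> exists c : R -> Cn R n, [/\ c 0 = x0, rprim 0 T c (X \o c) & in_ball x0 r T c].
Proof.
move=> lf; have [r0 K0 L0 T0 KT LT XK XL] := lf.
pose good (c : R -> Cn R n) := contd (@nrdist R (Cn R n)) c 0 T /\ in_ball x0 r T c.
have ex (c : R -> Cn R n) : exists c' : R -> Cn R n, good c ->
    [/\ rprim 0 T c' (X \o c), c' 0 = x0 & in_ball x0 r T c'].
  have [[g1 g2]|ng] := pselect (good c); last by exists c.
  by have [c' h] := picard_step lf g1 g2; exists c'.
have [F FP] := choice ex.
pose c k := iter k F (fun=> x0).
have cg k : good (c k).
  elim: k => [|k /FP[[h1 _] _ h2]]; last by split.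
  split=> [t _ e e0|t _]; last by rewrite subrr nr0.
  by exists 1 => // s _ _; rewrite /nrdist subrr nr0.
have cP k : [/\ rprim 0 T (c k.+1) (X \o c k), c k.+1 0 = x0 & in_ball x0 r T (c k.+1)] by exact: FP.
have cdiff1 k t : 0 <= t <= T -> nr (c k.+1 t - c k t) <= 2 * r * 2^-1 ^+ k.
  elim: k t => [|k IH] t tT.
    rewrite expr0 mulr1; have := nr_dist (c 1%N t) x0 (c 0%N t).
    rewrite (nr_distC x0); have [_ _ /(_ t tT)] := cP 0%N; have [_ /(_ t tT)] := cg 0%N; clear; nr_lra.
  have [h1 i1 b1] := cP k.+1; have [h2 i2 b2] := cP k.
  have /andP[t0 tT'] := tT.
  have := mvi t0 (rprim_sub (lexx _) tT' (rprim_lin (-1) h1 h2)) (M := L * (2 * r * 2^-1 ^+ k)).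
  rewrite i1 i2 subr0 !scaleN1r subrr subr0 => /(_ _)/le_trans; apply.
    move=> s st; have sT : 0 <= s <= T by lra.
    rewrite scaleN1r /=; have [_ bk] := cg k.
    by apply: le_trans (XL _ _ (bk s sT) (b2 s sT)) _; rewrite ler_wpM2l // IH.
  rewrite exprS [leRHS]mulrCA mulrAC ler_wpM2r //.
    by rewrite !mulr_ge0 // exprn_ge0 // invr_ge0.
  by apply: le_trans LT; rewrite ler_wpM2l.
have cdiff2 k i t : 0 <= t <= T -> nr (c (i + k)%N t - c k t) <= 4 * r * (2^-1 ^+ k - 2^-1 ^+ (i + k)).
  move=> tT; elim: i => [|i IH]; first by rewrite !subrr nr0 mulr0.
  apply: (le_trans (nr_dist _ (c (i + k)%N t) _)).
  have := cdiff1 (i + k)%N t tT; rewrite addSn exprS; lra.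
have p2 k : 0 < (2^-1 : R) ^+ k by rewrite exprn_gt0 // invr_gt0.
have cdiff3 k l t : (k <= l)%N -> 0 <= t <= T -> nr (c l t - c k t) <= 4 * r * 2^-1 ^+ k.
  move=> kl tT; have := cdiff2 k (l - k)%N t tT; rewrite subnK //.
  have := p2 l; set u := nr _; have := r0; clear; nra.
have lim_ex t : exists l : Cn R n, 0 <= t <= T -> forall k, nr (l - c k t) <= 4 * r * 2^-1 ^+ k.
  have [tT|ntT] := boolP (0 <= t <= T); last by exists 0.
  have [|l lP] := @v_cauchy R n (fun k => c k t).
    move=> e e0; have [N hN] := geo_small (4 * r) (ltac:(lra) : 0 < e / 2).
    exists N => k l Nk Nl; apply: (le_lt_trans (nr_dist _ (c N t) _)); rewrite (nr_distC (c N t)).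
    have := cdiff3 N k t Nk tT; have := cdiff3 N l t Nl tT; lra.
  exists l => _ k; apply/ler_addgt0Pr => e e0; have [N hN] := lP e e0.
  have := hN (maxn k N) (leq_maxr _ _); have := cdiff3 k (maxn k N) t (leq_maxl _ _) tT.
  have := nr_dist l (c (maxn k N) t) (c k t); rewrite (nr_distC l (c (maxn k N) t)); clear; nr_lra.
have [c' c'P] := choice lim_ex.
have small (u : R) (x : R) : (forall k, u <= x + 4 * r * 2^-1 ^+ k) -> u <= x.
  move=> h; apply/ler_addgt0Pr => e e0; have [N hN] := geo_small (4 * r) e0.
  have := h N; lra.
have cb : in_ball x0 r T c'.
  move=> t tT; apply: small => k; have [_ /(_ t tT)] := cg k.
  have := c'P t tT k; have := nr_dist (c' t) (c k t) x0; clear; nr_lra.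
have clip s t : 0 <= s -> s <= t -> t <= T -> nr (c' t - c' s) <= K * (t - s).
  move=> s0 st tT; apply/ler_addgt0Pr => e e0; have [N hN] := geo_small (4 * r) (ltac:(lra) : 0 < e / 2).
  have [h _ _] := cP N; have [_ bN] := cg N.
  have := mvi st (rprim_sub s0 tT h) (M := K) => /(_ _) h2.
  have {}h2 : nr (c N.+1 t - c N.+1 s) <= K * (t - s).
    by apply: h2 => u us; apply: XK; apply: bN; lra.
  have h3 := c'P t (ltac:(lra)) N.+1; have h4 := c'P s (ltac:(lra)) N.+1.
  have h5 : 4 * r * 2^-1 ^+ N.+1 <= 4 * r * 2^-1 ^+ N.
    by rewrite exprS; have := p2 N; have := r0; clear; nra.
  have -> : c' t - c' s = (c' t - c N.+1 t) + (c N.+1 t - c N.+1 s) - (c' s - c N.+1 s) by lmod C (Cn R n).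
  apply: (le_trans (nrB _ _)); have := nrD (c' t - c N.+1 t) (c N.+1 t - c N.+1 s).
  by move: h2 h3 h4 h5 hN; clear; nr_lra.
have cder s t : 0 <= s -> s <= t -> t <= T ->
    nr (c' t - c' s - rc (t - s) *: X (c' s)) <= L * (K * (t - s)) * (t - s).
  move=> s0 st tT; apply/ler_addgt0Pr => e e0.
  (* [L * T] accounts for the error in the field along the iterate, 2 for the errors at the two
     endpoints. *)
  have [N hN] := geo_small (4 * r * (L * T + 2)) e0.
  have [h _ _] := cP N; have [_ bN] := cg N.
  have LN : 0 <= L * (4 * r * 2^-1 ^+ N) by rewrite !mulr_ge0 // ltW.
  have := mvi_aff (v := X (c' s)) st (rprim_sub s0 tT h) (M := L * (4 * r * 2^-1 ^+ N + K * (t - s))).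
  move=> /(_ _) h2.
  have {}h2 : nr (c N.+1 t - c N.+1 s - rc (t - s) *: X (c' s)) <= L * (4 * r * 2^-1 ^+ N + K * (t - s)) * (t - s).
    apply: h2 => u us /=; have uT : 0 <= u <= T by lra.
    apply: (le_trans (XL _ _ (cb s (ltac:(lra))) (bN u uT))); rewrite ler_wpM2l //.
    have := c'P u uT N; have := clip s u s0 (ltac:(lra)) (ltac:(lra)).
    have := nr_dist (c N u) (c' u) (c' s); rewrite (nr_distC (c N u) (c' u)).
    have : K * (u - s) <= K * (t - s) by rewrite ler_wpM2l //; clear -us; lra.
    clear; nr_lra.
  have h3 := c'P t (ltac:(lra)) N.+1; have h4 := c'P s (ltac:(lra)) N.+1.
  have h5 : 4 * r * 2^-1 ^+ N.+1 <= 4 * r * 2^-1 ^+ N.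
    by rewrite exprS; have := p2 N; have := r0; clear; nra.
  have -> : c' t - c' s - rc (t - s) *: X (c' s) = (c' t - c N.+1 t) +
     (c N.+1 t - c N.+1 s - rc (t - s) *: X (c' s)) - (c' s - c N.+1 s) by lmod C (Cn R n).
  apply: (le_trans (nrB _ _)).
  have := nrD (c' t - c N.+1 t) (c N.+1 t - c N.+1 s - rc (t - s) *: X (c' s)).
  have : L * (4 * r * 2^-1 ^+ N) * (t - s) <= L * (4 * r * 2^-1 ^+ N) * T by rewrite ler_wpM2l //; clear -s0 tT; lra.
  by move: h2 h3 h4 h5 hN; clear; nr_lra.
exists c'; split=> //.
  apply/eqP; rewrite -subr_eq0; apply/eqP/nr_le0; apply: small => k.
  have [_ <- _] := cP k; have := c'P 0 (ltac:(lra)) k.+1.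
  have : 4 * r * 2^-1 ^+ k.+1 <= 4 * r * 2^-1 ^+ k.
    by rewrite exprS; have := p2 k; have := r0; clear; nra.
  lra.
split=> [t tT e e0|s sT e e0].
  exists (e / (K + 1)) => [|s sT]; first by rewrite divr_gt0 //; lra.
  rewrite ltr_pdivlMr; last lra.
  rewrite /nrdist => st; have [ts|ts] := leP t s.
    have := clip t s (ltac:(lra)) ts (ltac:(lra)); have := ler_norm (s - t); have := K0; nra.
  rewrite nr_distC; have := clip s t (ltac:(lra)) (ltW ts) (ltac:(lra)).
  have := ler_norm (t - s); rewrite (distrC t s); have := K0; nra.
have LK : 0 <= L * K by rewrite mulr_ge0.
exists (e / (L * K + 1)) => [|h]; first by rewrite divr_gt0 //; lra.
move=> /andP[h0]; rewrite ltr_pdivlMr; last lra.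
move=> hr hT; have := cder s (s + h) (ltac:(lra)) (ltac:(lra)) hT.
rewrite (_ : s + h - s = h); last by ring.
move=> /le_trans; apply; nra.
Qed.

(* Euler polygons are holomorphic in the initial point and converge uniformly to the
   solution, which makes the flow holomorphic by [weierstrass]. *)
Definition euler n (X : Cn R n -> Cn R n) (d : R) (x : Cn R n) : Cn R n := x + rc d *: X x.

(** A step adds a truncation error [L * K * d ^+ 2] and amplifies the accumulated error by the
    factor [1 + d * L]. Since [L * T <= 2^-1], the amplification also costs at most
    [L * K * d ^+ 2], so the error grows linearly in [j]. *)
Lemma euler_err n (X : Cn R n -> Cn R n) (x0 : Cn R n) (r K L T : R) (c : R -> Cn R n) (d : R) j :
  lip_field X x0 r K L T -> c 0 = x0 -> rprim 0 T c (X \o c) -> in_ball x0 r T c ->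
  0 <= d -> j%:R * d <= T ->
  nr (iter j (euler X d) x0 - x0) <= K * (j%:R * d) /\
  nr (c (j%:R * d) - iter j (euler X d) x0) <= 2 * (L * K) * j%:R * d ^+ 2.
Proof.
move=> [r0 K0 L0 T0 KT LT XK XL] c0 cP cb d0.
have lipc s t : 0 <= s -> s <= t -> t <= T -> nr (c t - c s) <= K * (t - s).
  move=> s0 st tT; apply: (mvi st (rprim_sub s0 tT cP)) => u us.
  by apply: XK; apply: cb; lra.
elim: j => [|j IH]; first by rewrite !mul0r c0 /= subrr nr0 !mulr0 mul0r.
rewrite -natr1 mulrDl mul1r => jT.
have jd : 0 <= j%:R * d by rewrite mulr_ge0.
have [IH1 IH2] := IH (ltac:(lra)).
set e := iter j (euler X d) x0 in IH1 IH2 *; set s := j%:R * d in jd jT IH1 IH2 *.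
have eb : nr (e - x0) <= r by apply: (le_trans IH1); apply: le_trans KT; rewrite ler_wpM2l //; lra.
have csb : nr (c s - x0) <= r by apply: cb; lra.
rewrite iterS -/e; split.
  rewrite (_ : euler X d e - x0 = (e - x0) + rc d *: X e); last by rewrite /euler; lmod C (Cn R n).
  apply: (le_trans (nrD _ _)); rewrite nrZr ger0_norm //.
  by rewrite mulrDr lerD // (mulrC K) ler_wpM2l // XK.
have ssd : s <= s + d by rewrite lerDl.
have := mvi_aff (v := X (c s)) (M := L * (K * d)) ssd (rprim_sub jd jT cP).
rewrite (_ : s + d - s = d); last by ring.
move=> /(_ _) h.
have {}h : nr (c (s + d) - c s - rc d *: X (c s)) <= L * (K * d) * d.
  apply: h => u us /=.
  have [u1 u2 u3] : [/\ s <= u, u <= T & u - s <= d] by clear -us jT; split; lra.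
  apply: (le_trans (XL _ _ csb (cb u _))); first by rewrite (le_trans jd).
  rewrite ler_wpM2l //; apply: (le_trans (lipc s u jd u1 u2)); rewrite ler_wpM2l //.
have -> : c (s + d) - euler X d e = (c (s + d) - c s - rc d *: X (c s)) +
   ((c s - e) + rc d *: (X (c s) - X e)) by rewrite /euler; lmod C (Cn R n).
apply: (le_trans (nrD _ _)).
have := nrD (c s - e) (rc d *: (X (c s) - X e)); rewrite nrZr ger0_norm // => h2.
have h3 := XL _ _ eb csb.
set D := nr (c s - e) in IH2 h2 h3.
have D0 : 0 <= D by exact: nr_ge0.
have LK : 0 <= L * K by rewrite mulr_ge0.
have j0 : 0 <= j%:R :> R by [].
have sT : s <= T by clear -jT d0; lra.
have Ls : L * s <= 2^-1 by apply: le_trans LT; rewrite ler_wpM2l.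
have h4 : d * nr (X (c s) - X e) <= d * (L * D) by rewrite ler_wpM2l.
have h5 : d * (L * D) <= L * K * d ^+ 2.
  have -> : L * K * d ^+ 2 = d * L * (K * d) by ring.
  rewrite mulrA.
  have [->|L0'] := eqVneq L 0; first by rewrite mulr0 !mul0r.
  rewrite ler_wpM2l ?mulr_ge0 //; apply: (le_trans IH2).
  have -> : 2 * (L * K) * j%:R * d ^+ 2 = 2 * (L * s) * (K * d) by rewrite /s; ring.
  by apply: ler_piMl; [rewrite mulr_ge0 | clear -Ls; lra].
move: h IH2 h2 h4 h5; rewrite (_ : L * (K * d) * d = L * K * d ^+ 2); last by ring.
rewrite (_ : 2 * (L * K) * j%:R * d ^+ 2 = 2 * j%:R * (L * K * d ^+ 2)); last by ring.
rewrite (_ : 2 * (L * K) * (j%:R + 1) * d ^+ 2 = 2 * j%:R * (L * K * d ^+ 2) + 2 * (L * K * d ^+ 2)); last by ring.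
set A := L * K * d ^+ 2; set B := 2 * j%:R * A; set a1 := nr _; set a2 := nr (_ + _).
set a3 := d * nr _; set a4 := d * (L * D); move=> e1 e2 e3 e4 e5.
by apply: (le_trans (lerD e1 (le_trans e3 (lerD e2 (le_trans e4 e5))))); rewrite addrCA mulr_natl mulr2n.
Qed.

Lemma euler_cvg n (X : Cn R n -> Cn R n) (x0 : Cn R n) (r K L T : R) (c : R -> Cn R n) (t : R) (N : nat) :
  lip_field X x0 r K L T -> c 0 = x0 -> rprim 0 T c (X \o c) -> in_ball x0 r T c ->
  0 <= t <= T -> nr (c t - iter N.+1 (euler X (t / N.+1%:R)) x0) <= 2 * (L * K) * T ^+ 2 / N.+1%:R.
Proof.
move=> lf c0 cP cb /andP[t0 tT]; have [r0 K0 L0 T0 KT LT XK XL] := lf.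
have N0 : 0 < N.+1%:R :> R by [].
have E : N.+1%:R * (t / N.+1%:R) = t by rewrite mulrCA mulfV ?mulr1 // gt_eqF.
have [_] := euler_err (d := t / N.+1%:R) (j := N.+1) lf c0 cP cb (ltac:(by rewrite divr_ge0)) (ltac:(by rewrite E)).
rewrite E => /le_trans; apply.
have -> : 2 * (L * K) * N.+1%:R * (t / N.+1%:R) ^+ 2 = 2 * (L * K) * t ^+ 2 / N.+1%:R.
  by field; rewrite gt_eqF.
rewrite ler_wpM2r ?invr_ge0 // ler_wpM2l ?mulr_ge0 //.
by rewrite ler_sqr ?nnegrE //; lra.
Qed.

Lemma euler_in n (X : Cn R n -> Cn R n) (x0 : Cn R n) (r K L T : R) (c : R -> Cn R n) (t : R) (N j : nat) :
  lip_field X x0 r K L T -> c 0 = x0 -> rprim 0 T c (X \o c) -> in_ball x0 r T c ->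
  0 <= t <= T -> (j <= N.+1)%N -> nr (iter j (euler X (t / N.+1%:R)) x0 - x0) <= r.
Proof.
move=> lf c0 cP cb /andP[t0 tT] jN; have [r0 K0 L0 T0 KT LT XK XL] := lf.
have N0 : 0 < N.+1%:R :> R by [].
have jt : j%:R * (t / N.+1%:R) <= T.
  rewrite mulrCA; apply: le_trans tT; rewrite ler_piMr // ler_pdivrMr // mul1r ler_nat //.
have [h _] := euler_err (d := t / N.+1%:R) (j := j) lf c0 cP cb (ltac:(by rewrite divr_ge0)) jt.
by apply: (le_trans h); apply: le_trans KT; rewrite ler_wpM2l.
Qed.

(** Both solutions are limits of the same Euler polygons, by [euler_cvg]. *)
Lemma ode_unique n (X : Cn R n -> Cn R n) (x0 : Cn R n) (r K L T : R) (c d : R -> Cn R n) :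
  lip_field X x0 r K L T -> c 0 = x0 -> rprim 0 T c (X \o c) -> in_ball x0 r T c ->
  d 0 = x0 -> rprim 0 T d (X \o d) -> in_ball x0 r T d -> forall t, 0 <= t <= T -> c t = d t.
Proof.
move=> lf c0 cP cb d0 dP db t tT; apply/eqP; rewrite -subr_eq0; apply/eqP/nr_le0.
apply/ler_addgt0Pr => e e0; rewrite add0r.
have [r0 K0 L0 T0 KT LT XK XL] := lf.
set B := 2 * (L * K) * T ^+ 2.
have B0 : 0 <= B by rewrite /B mulr_ge0 ?exprn_ge0 ?mulr_ge0 // ltW.
have [N hN] : exists N : nat, 2 * B / e < N.+1%:R.
  exists (Num.truncn (2 * B / e)); exact: truncnS_gt.
have h1 := euler_cvg N lf c0 cP cb tT; have h2 := euler_cvg N lf d0 dP db tT.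
have N0 : 0 < N.+1%:R :> R by [].
have : B / N.+1%:R <= e / 2.
  rewrite ler_pdivrMr //; move: hN; rewrite ltr_pdivrMr //; lra.
move: h1 h2; rewrite -/B; set q := iter _ _ _ => h1 h2 h3.
have := nr_dist (c t) q (d t); rewrite (nr_distC q (d t)) => h4.
by apply: (le_trans h4); apply: (le_trans (lerD (le_trans h1 h3) (le_trans h2 h3))); rewrite -splitr.
Qed.

End LocalODE.

(** * Integral curves on a manifold *)

Section Charts.
Variables (R : realType) (n : nat) (M : complexManifold R n).
Local Notation C := (Cplx R).
Local Notation V := (Cn R n).
Implicit Types (i j : index M) (p q : M).

Lemma within_cont_nbhs (T U : topologicalType) (A : set T) (f : T -> U) x S :
  {within A, continuous f} -> A x -> nbhs (f x) S -> nbhs x [set y | A y -> S (f y)].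
Proof.
move=> fc Ax fS; have h : @nbhs _ (subspace A) x (f @^-1` S) := fc x S fS.
by have : within A (nbhs x) (f @^-1` S) by rewrite (nbhs_subspace_in Ax).
Qed.

Lemma cdom_nbhs i p : cdom i p -> nbhs p (cdom i).
Proof. by move=> ip; apply: open_nbhs_nbhs; split=> //; exact: cdom_open. Qed.

Lemma cmap_nbhs i p (e : R) : cdom i p -> 0 < e ->
  nbhs p [set q | cdom i q /\ nr (cmap i q - cmap i p) < e].
Proof.
move=> ip e0; have h : nbhs (cmap i p) [set v : V | nr (v - cmap i p) < e].
  by apply/nbhs_nr; exists e.
have := within_cont_nbhs (@cmap_continuous R n M i) ip h.
by apply: filterS2 (cdom_nbhs ip) => q iq /(_ iq).
Qed.

Lemma cimg_ball i p : cdom i p -> exists2 r : R, 0 < r &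
  forall v, nr (v - cmap i p) < r -> (cmap i @` cdom i) v.
Proof.
by move=> ip; apply/nbhs_nr; apply: open_nbhs_nbhs; split; [exact: cimg_open|exists p].
Qed.

Lemma cinv_in i v : (cmap i @` cdom i) v -> cdom i (cinv i v) /\ cmap i (cinv i v) = v.
Proof. by move=> [p ip <-]; rewrite cmapK. Qed.

Lemma cinv_nbhs i v A : (cmap i @` cdom i) v -> nbhs (cinv i v : M) A ->
  exists2 e : R, 0 < e & forall w, nr (w - v) < e -> (cmap i @` cdom i) w /\ A (cinv i w).
Proof.
move=> iv Av; have := within_cont_nbhs (@cinv_continuous R n M i) iv Av.
have iv' : nbhs v (cmap i @` cdom i) by apply: open_nbhs_nbhs; split=> //; exact: cimg_open.
move=> /(filterI iv')/nbhs_nr[e e0 he]; exists e => // w /he[h1 h2].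
by split=> //; exact: h2.
Qed.

Lemma cinv_cball_compact i (v : V) (r : R) :
  (forall w, nr (w - v) <= r -> (cmap i @` cdom i) w) ->
  compact [set q : M | cdom i q /\ nr (cmap i q - v) <= r].
Proof.
move=> vr; have sub : [set w : V | nr (w - v) <= r] `<=` cmap i @` cdom i by move=> w /vr.
have := continuous_compact (continuous_subspaceW sub (@cinv_continuous R n M i)) (@compact_cball R n v r).
congr compact; apply/seteqP; split=> [_ [w wr <-]|q [iq qr]].
  by have [h1 h2] := cinv_in (vr w wr); split=> //; rewrite h2.
by exists (cmap i q) => //; exact: cmapK.
Qed.

(** Being compact, the coordinate ball is closed in the Hausdorff space [M], so limits of curves
    inside it stay in the chart. *)
Lemma cinv_cball_closed i (v : V) (r : R) :
  (forall w, nr (w - v) <= r -> (cmap i @` cdom i) w) ->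
  closed [set q : M | cdom i q /\ nr (cmap i q - v) <= r].
Proof.
by move=> vr; apply: compact_closed; [exact: mfd_hausdorff | exact: cinv_cball_compact].
Qed.

(* Integral curves on a compact interval [0, T], with right derivatives only. *)
Definition contM (z : R -> M) (a b : R) := forall t, a <= t <= b -> forall U, nbhs (z t) U ->
  exists2 d : R, 0 < d & forall s, a <= s <= b -> `|s - t| < d -> U (z s).

Definition icurve (X : vfield M) (z : R -> M) (T : R) :=
  contM z 0 T /\ forall t, 0 <= t < T -> forall i, cdom i (z t) ->
    rder (cmap i \o z) t T (X i (z t)).

Lemma differentiable_nr (W1 W2 : normedModType C) (f : W1 -> W2) (x : W1) : differentiable f x ->
  forall e : R, 0 < e -> exists2 r : R, 0 < r & forall y, nr (y - x) < r ->
    nr (f y - f x - 'd f x (y - x)) <= e * nr (y - x).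
Proof.
move=> fd e e0.
have e0' : 0 < rc e by rewrite -rc0 ltr_rc.
have /eqaddoP/(_ _ e0')/nbhs_nr[r r0 fr] := diff_locally fd.
exists r => // y yr; have := fr (y - x); rewrite subr0 => /(_ yr).
rewrite !nrE -rcM ler_rc => h.
suff -> : f y - f x - 'd f x (y - x) =
   (f \o shift x - (cst (f x) + 'd f x)) (y - x) by [].
change (f y - f x - 'd f x (y - x) = f (y - x + x) - (f x + 'd f x (y - x))).
by rewrite subrK opprD addrA.
Qed.

Lemma linear_bound (W1 W2 : normedModType C) (f : {linear W1 -> W2}) : continuous f ->
  exists2 B : R, 0 < B & forall v, nr (f v) <= B * nr v.
Proof.
move=> fc.
have : nbhs (f 0) [set w : W2 | nr (w - f 0) < 1] by apply/nbhs_nr; exists 1.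
move=> /(fc 0)/nbhs_nr[d d0 fd]; exists (2 / d); first by rewrite divr_gt0.
move=> v; have [->|v0] := eqVneq v 0; first by rewrite linear0 !nr0 mulr0.
have nv0 : 0 < nr v.
  by rewrite lt_neqAle nr_ge0 andbT eq_sym; apply/eqP => /nr_eq0/eqP; rewrite (negPf v0).
have := fd (rc (d / (2 * nr v)) *: v); rewrite /= linear0 !subr0 linearZ !nrZr ger0_norm; last first.
  by rewrite divr_ge0 ?mulr_ge0 // ltW.
rewrite (_ : d / (2 * nr v) * nr v = d / 2); last by field; rewrite gt_eqF.
move=> /(_ (ltac:(lra)))/ltW; rewrite mulrAC ler_pdivrMr ?mulr_gt0 // mul1r => h.
by rewrite mulrAC ler_pdivlMr // mulrC.
Qed.


Lemma contM_chart (z : R -> M) a b i : contM z a b -> (forall t, a <= t <= b -> cdom i (z t)) ->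
  contd (@nrdist R V) (cmap i \o z) a b.
Proof.
move=> zc zi t tab e e0.
have [d d0 zd] := zc t tab _ (cmap_nbhs (zi t tab) e0).
by exists d => // s sab st; have [] := zd s sab st.
Qed.

Lemma icurve_rprim X z T i a b : icurve X z T -> 0 <= a -> b <= T ->
  (forall t, a <= t <= b -> cdom i (z t)) ->
  rprim a b (cmap i \o z) (fun t => X i (z t)).
Proof.
move=> [zc zd] a0 bT zi; split.
  apply: contM_chart => // t tab U zU.
  have [d d0 zU'] := zc t (ltac:(lra)) U zU; exists d => // s sab; apply: zU'; lra.
move=> t tab e e0; have [d d0 h] := zd t (ltac:(lra)) i (zi t (ltac:(lra))) e e0.
by exists d => // s s0 sb; apply: h => //; lra.
Qed.

(** The chain rule for the transition map [psi]: the field transforms by ['d psi], and the error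
    splits into the remainder of [psi] and the image under ['d psi] of the remainder of the
    curve. *)
Lemma rder_chart X (z : R -> M) i j (t T : R) : cdom i (z t) -> cdom j (z t) ->
  0 <= t < T -> contM z 0 T -> rder (cmap i \o z) t T (X i (z t)) -> is_vfield X ->
  rder (cmap j \o z) t T (X j (z t)).
Proof.
move=> it jt tT zc zd [_ Xij _] e e0.
rewrite (Xij i j _ it jt); set v := X i (z t) in zd *.
have ijt : (cmap i @` (cdom i `&` cdom j)) (cmap i (z t)) by exists (z t).
have psid := transition_holomorphic ijt.
set psi := cmap j \o cinv i in psid *; set x := cmap i (z t) in psid *.
have [B B0 dB] := linear_bound (diff_continuous psid).
have v0 := nr_ge0 v.
pose e1 := e / (2 * (nr v + 1)).
have e10 : 0 < e1 by rewrite divr_gt0 // mulr_gt0 // ltr_wpDl.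
have [r r0 fr] := differentiable_nr psid e10.
(* The bound 1 keeps the coordinate increment below [h * (nr v + 1)], which [e1] anticipates; the
   other bound controls the image of the curve's remainder. *)
pose e2 := Num.min 1 (e / (2 * B)).
have e20 : 0 < e2 by rewrite lt_min ltr01 divr_gt0 // mulr_gt0.
have e21 : e2 <= 1 by rewrite ge_min lexx.
have e2B : B * e2 <= e / 2.
  have : e2 <= e / (2 * B) by rewrite ge_min lexx orbT.
  move=> /(ler_wpM2l (ltW B0)); rewrite (_ : B * (e / (2 * B)) = e / 2) //.
  by field; rewrite gt_eqF.
have [d1 d10 h1] := zd e2 e20.
have [d2 d20 h2] := zc t (ltac:(lra)) _ (cmap_nbhs it r0).
exists (Num.min d1 d2); first by rewrite lt_min d10.
move=> h; rewrite lt_min => /andP[h0 /andP[hd1 hd2]] hT.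
have [ith yr] := h2 (t + h) (ltac:(lra)) (ltac:(rewrite (_ : t + h - t = h); [rewrite ger0_norm; lra|ring])).
have w := h1 h (ltac:(lra)) hT.
set y := cmap i (z (t + h)) in yr.
rewrite /= -/x in w; rewrite -/y in w.
change ((cmap j \o z) (t + h)) with (cmap j (z (t + h))).
change ((cmap j \o z) t) with (cmap j (z t)).
have -> : cmap j (z (t + h)) = psi y by rewrite /psi /= /y cmapK.
have -> : cmap j (z t) = psi x by rewrite /psi /= /x cmapK.
have frx := fr y yr.
have -> : psi y - psi x - rc h *: 'd psi x v =
   (psi y - psi x - 'd psi x (y - x)) + 'd psi x (y - x - rc h *: v).
  have -> : 'd psi x (y - x - rc h *: v) = 'd psi x (y - x) - rc h *: 'd psi x v.
    by move: (y - x) => u; rewrite linearB linearZ.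
  by rewrite subrKA.
have yx : nr (y - x) <= h * (nr v + 1).
  rewrite -(subrK (rc h *: v) (y - x)); apply: (le_trans (nrD _ _)).
  rewrite nrZr ger0_norm ?(ltW h0) // mulrDr mulr1 addrC lerD2l.
  by apply: (le_trans w); rewrite ler_piMl // ltW.
apply: (le_trans (nrD _ _)).
have h3 : e1 * nr (y - x) <= e / 2 * h.
  apply: (le_trans (ler_wpM2l (ltW e10) yx)).
  have -> : e1 * (h * (nr v + 1)) = e / 2 * h.
    by rewrite /e1; field; rewrite gt_eqF // ltr_wpDl.
  by [].
have h4 : B * nr (y - x - rc h *: v) <= e / 2 * h.
  by apply: (le_trans (ler_wpM2l (ltW B0) w)); rewrite mulrA ler_wpM2r // ltW.
have := dB (y - x - rc h *: v); move: frx h3 h4; clear; nr_lra.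
Qed.

Lemma icurve_intro (X : vfield M) (z : R -> M) T : contM z 0 T ->
  (forall t, 0 <= t < T -> exists2 i, cdom i (z t) & rder (cmap i \o z) t T (X i (z t))) ->
  icurve X z T.
Proof.
move=> zc zd; split=> // t tT j jt; have [i it h] := zd t tT.
exact: rder_chart h (vfieldP X).
Qed.

Definition lfield (X : vfield M) i : V -> V := X i \o cinv i.

Lemma lfieldE X i p : cdom i p -> lfield X i (cmap i p) = X i p.
Proof. by move=> ip; rewrite /lfield /= cmapK. Qed.

(** One choice of constants serves all initial points within [r] of [p], which makes existence times
    locally uniform. *)
Lemma lfield_data X i p : cdom i p -> exists r K L T : R, [/\ 0 < r, 0 < K,
  forall v, nr (v - cmap i p) <= 2 * r -> (cmap i @` cdom i) v,
  forall v, nr (v - cmap i p) <= 2 * r -> differentiable (lfield X i) v &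
  forall x0, nr (x0 - cmap i p) <= r -> lip_field (lfield X i) x0 r K L T].
Proof.
move=> ip; have [_ _ Xh] := vfieldP X.
set x := cmap i p; set Y := lfield X i.
have [s s0 sP] := cimg_ball ip.
have Yd v : nr (v - x) < s -> differentiable Y v by move=> /sP; exact: Xh.
have Yc : {for x, continuous Y} by apply: differentiable_continuous; apply: Yd; rewrite subrr nr0.
have : nbhs (Y x) [set w : V | nr (w - Y x) < 1] by apply/nbhs_nr; exists 1.
move=> /Yc/nbhs_nr[d d0 dP].
pose m := Num.min s d.
have m0 : 0 < m by rewrite lt_min s0.
have ms : m <= s by rewrite ge_min lexx.
have md : m <= d by rewrite ge_min lexx orbT.
pose K := nr (Y x) + 1.
have K0 : 0 < K by rewrite ltr_wpDl ?nr_ge0.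
have YK v : nr (v - x) < m -> nr (Y v) <= K.
  move=> vm; have /= h := dP v (lt_le_trans vm md).
  have := nrD (Y v - Y x) (Y x); rewrite subrK /K; move: h; clear; nr_lra.
(* [hol_lip] gives a Lipschitz bound on a ball four times smaller than [m]; its radius [2 * r]
   covers the balls of radius [r] around all the [x0]. *)
pose r := m / 8.
have r0 : 0 < r by rewrite divr_gt0.
have r2 : 0 < 2 * r by rewrite mulr_gt0.
have rm : 4 * (2 * r) = m by rewrite /r; field.
pose L := 2 * K / (2 * r).
have L0 : 0 < L by rewrite divr_gt0 // mulr_gt0.
have YL := @hol_lip R n Y x (2 * r) K r2.
rewrite rm in YL; have {}YL := YL (fun v vm => Yd v (lt_le_trans vm ms)) YK.
pose T := Num.min (r / K) (2^-1 / L).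
have h2r v : nr (v - x) <= 2 * r -> nr (v - x) < m by rewrite -rm; move: r0; clear; nr_lra.
exists r, K, L, T; split.
- exact: r0.
- exact: K0.
- by move=> v /h2r vm; apply: sP; exact: lt_le_trans ms.
- by move=> v /h2r vm; apply: Yd; exact: lt_le_trans ms.
move=> x0 x0r.
have tri v : nr (v - x0) <= r -> nr (v - x) <= 2 * r.
  by move=> vr; have := nr_dist v x0 x; move: vr x0r; clear; nr_lra.
split.
- exact: ltW.
- exact: ltW.
- exact: ltW.
- by rewrite lt_min; apply/andP; split; apply: divr_gt0.
- by rewrite mulrC -ler_pdivlMr // ge_min lexx.
- by rewrite mulrC -ler_pdivlMr // ge_min lexx orbT.
- by move=> v /tri/h2r; exact: YK.
- by move=> v w /tri hv /tri hw; exact: YL.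
Qed.

Lemma lip_field_le (Y : V -> V) x0 (r K L T T' : R) : 0 < T' -> T' <= T ->
  lip_field Y x0 r K L T -> lip_field Y x0 r K L T'.
Proof.
move=> T'0 T'T [r0 K0 L0 T0 KT LT YK YL]; split=> //.
  by apply: le_trans KT; rewrite ler_wpM2l.
by apply: le_trans LT; rewrite ler_wpM2l.
Qed.

(* [K] bounds the speed and [K * T <= r], so the curve cannot reach the boundary
   of the ball. *)
Lemma icurve_trapped X z T i (r K L : R) : icurve X z T -> cdom i (z 0) -> 0 < r -> 0 < K ->
  (forall v, nr (v - cmap i (z 0)) <= r -> (cmap i @` cdom i) v) ->
  lip_field (lfield X i) (cmap i (z 0)) r K L T ->
  forall t, 0 <= t <= T -> cdom i (z t) /\ nr (cmap i (z t) - cmap i (z 0)) <= r.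
Proof.
move=> zX i0 r0 K0 im [_ _ _ T0 KT _ YK _].
set x0 := cmap i (z 0) in im KT YK *.
suff H t : 0 <= t <= T -> forall s, 0 <= s <= t -> cdom i (z s) /\ nr (cmap i (z s) - x0) <= r.
  by move=> t tT; apply: (H t tT); rewrite lexx andbT; case/andP: tT.
apply: (@real_induction R (fun t => forall s, 0 <= s <= t ->
    cdom i (z s) /\ nr (cmap i (z s) - x0) <= r) T (ltW T0)) => {t}.
- move=> s s0; have -> : s = 0 by move: s0; clear; nr_lra.
  by split=> //; rewrite /x0 subrr nr0 ltW.
- move=> t tT Pt.
  have [zc _] := zX.
  (* As [t < T], the bound [K * t] is strictly below [r], which leaves room to continue. *)
  have tr : nr (cmap i (z t) - x0) < r.
    have h : rprim 0 t (cmap i \o z) (fun u => X i (z u)).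
      apply: (icurve_rprim zX) => //; first by move: tT; clear; nr_lra.
      by move=> u ut; have [] := Pt u ut.
    have t0 : 0 <= t by case/andP: tT.
    have := mvi t0 h (M := K) => /(_ _)/le_lt_trans; apply.
      move=> u ut; have [iu ur] := Pt u (ltac:(move: ut; clear; nr_lra)).
      by rewrite -lfieldE //; apply: YK.
    by rewrite subr0; apply: lt_le_trans KT; rewrite ltr_pM2l //; case/andP: tT.
  have it : cdom i (z t) by have [] := Pt t (ltac:(move: tT; clear; nr_lra)).
  have [d d0 zd] := zc t (ltac:(move: tT; clear; nr_lra)) _
    (cmap_nbhs it (ltac:(by rewrite subr_gt0) : 0 < r - nr (cmap i (z t) - x0))).
  exists d => // s std sT u us; have [ut|tu] := leP u t; first by apply: Pt; move: us ut; clear; nr_lra.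
  have [iu ur] := zd u (ltac:(move: us sT; clear; nr_lra)) (ltac:(rewrite ger0_norm; move: us std tu; clear; nr_lra)).
  split=> //; have := nr_dist (cmap i (z u)) (cmap i (z t)) x0; move: ur; clear; nr_lra.
- move=> t tT Pt s st; have [zc _] := zX.
  have [->|sne] := eqVneq s t; last first.
    apply: (Pt s) => //; last by move: st; clear; nr_lra.
    by case/andP: st => s0 st; rewrite s0 lt_neqAle sne.
  have := cinv_cball_closed im; apply => U zU.
  have [d d0 zd] := zc t (ltac:(move: tT; clear; nr_lra)) U zU.
  pose u := Num.max 0 (t - d / 2).
  have u0 : 0 <= u by rewrite le_max lexx.
  have ut : u < t by rewrite gt_max; move: tT d0; clear; nr_lra.
  have ud : t - d / 2 <= u by rewrite le_max lexx orbT.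
  exists (z u); split.
    by apply: (Pt u) => //; rewrite ?u0 ?lexx.
  apply: zd; first by move: u0 ut tT; clear; nr_lra.
  by rewrite distrC ger0_norm; move: ud ut d0; clear; nr_lra.
Qed.

Lemma icurve_local X i (x0 : V) (r K L T : R) : 0 < r ->
  (forall v, nr (v - x0) <= r -> (cmap i @` cdom i) v) ->
  lip_field (lfield X i) x0 r K L T ->
  exists2 z : R -> M, z 0 = cinv i x0 & icurve X z T.
Proof.
move=> r0 im lf; have [c [c0 [cc cd] cb]] := picard lf.
have T0 := lf_T lf.
have ci t : 0 <= t <= T -> (cmap i @` cdom i) (c t) by move=> /cb/im.
exists (cinv i \o c); first by rewrite /= c0.
apply: icurve_intro => [t tT U cU|t tT].
  have [e e0 eU] := cinv_nbhs (ci t tT) cU.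
  have [d d0 dc] := cc t tT e e0; exists d => // s sT st.
  by have [] := eU (c s) (dc s sT st).
have tT' : 0 <= t <= T by move: tT; clear; nr_lra.
exists i; first by have [] := cinv_in (ci t tT').
move=> e e0; have [d d0 h] := cd t tT e e0; exists d => // u u0 uT.
have uT' : 0 <= t + u <= T by move: tT u0 uT; clear; nr_lra.
have := h u u0 uT; rewrite /= (cinv_in (ci _ uT')).2 (cinv_in (ci _ tT')).2.
by rewrite /lfield.
Qed.

Lemma contM_shift (z : R -> M) s T : 0 <= s -> contM z 0 T -> contM (fun u => z (s + u)) 0 (T - s).
Proof.
move=> s0 zc t tT U zU; have [d d0 h] := zc (s + t) (ltac:(move: s0 tT; clear; nr_lra)) U zU.
exists d => // u uT ut; apply: h; first by move: s0 uT; clear; nr_lra.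
by rewrite opprD addrACA subrr add0r.
Qed.

Lemma icurve_shift X z s T : 0 <= s -> icurve X z T -> icurve X (fun u => z (s + u)) (T - s).
Proof.
move=> s0 [zc zd]; split; first exact: contM_shift.
move=> t tT i it e e0.
have [d d0 h] := zd (s + t) (ltac:(move: s0 tT; clear; nr_lra)) i it e e0.
exists d => // u u0 uT; rewrite /= addrA; apply: h => //.
by move: uT; clear; nr_lra.
Qed.

Lemma icurve_sub X z T T' : T' <= T -> icurve X z T -> icurve X z T'.
Proof.
move=> TT [zc zd]; split=> [t tT U zU|t tT i it e e0].
  have [d d0 h] := zc t (ltac:(move: TT tT; clear; nr_lra)) U zU; exists d => // s sT.
  by apply: h; move: TT sT; clear; nr_lra.
have [d d0 h] := zd t (ltac:(move: TT tT; clear; nr_lra)) i it e e0.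
by exists d => // u u0 uT; apply: h => //; exact: le_trans TT.
Qed.

Lemma icurve_ext X z w T : (forall t, 0 <= t <= T -> w t = z t) -> icurve X z T -> icurve X w T.
Proof.
move=> wz [zc zd]; split=> [t tT U|t tT i].
  rewrite wz // => zU; have [d d0 h] := zc t tT U zU; exists d => // s sT.
  by rewrite wz //; exact: h.
have tT' : 0 <= t <= T by move: tT; clear; nr_lra.
rewrite wz // => it e e0; have [d d0 h] := zd t tT i it e e0; exists d => // u u0 uT.
rewrite /= !wz //; first exact: h.
by move: tT u0 uT; clear; nr_lra.
Qed.

(** Real induction: uniqueness in a chart prolongs the agreement, and the Hausdorff property carries
    it to limit times. *)
Lemma icurve_unique X z w T : icurve X z T -> icurve X w T -> z 0 = w 0 ->
  forall t, 0 <= t <= T -> z t = w t.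
Proof.
move=> zX wX zw0 t tT; have T0 : 0 <= T by move: tT; clear; nr_lra.
apply: (real_induction (P := fun t => z t = w t) T0 zw0) tT => {t}.
  move=> t tT zwt; have [i it] := cdom_cover (z t).
  have [r [K [L [T1 [r0 K0 im _ lf]]]]] := lfield_data X it.
  have {}lf := lf (cmap i (z t)) (ltac:(by rewrite subrr nr0 ltW)).
  pose T2 := Num.min T1 (T - t).
  have T20 : 0 < T2 by rewrite lt_min (lf_T lf) /=; move: tT; clear; nr_lra.
  have T21 : T2 <= T1 by rewrite ge_min lexx.
  have T2T : T2 <= T - t by rewrite ge_min lexx orbT.
  have {}lf := lip_field_le T20 T21 lf.
  have im' v : nr (v - cmap i (z t)) <= r -> (cmap i @` cdom i) v.
    by move=> h; apply: im; move: h r0; clear; nr_lra.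
  have t0 : 0 <= t by case/andP: tT.
  have zX' := icurve_sub T2T (icurve_shift t0 zX).
  have wX' := icurve_sub T2T (icurve_shift t0 wX).
  have tz := icurve_trapped (r := r) (K := K) (L := L) (i := i) zX'.
  rewrite !addr0 in tz; have {}tz := tz it r0 K0 im' lf.
  have tw := icurve_trapped (r := r) (K := K) (L := L) (i := i) wX'.
  rewrite !addr0 -zwt in tw; have {}tw := tw it r0 K0 im' lf.
  have rp u : icurve X u T2 -> (forall s, 0 <= s <= T2 -> cdom i (u s) /\
      nr (cmap i (u s) - cmap i (z t)) <= r) ->
      rprim 0 T2 (cmap i \o u) (lfield X i \o (cmap i \o u)).
    move=> uX ub; have h := icurve_rprim uX (lexx 0) (lexx T2) (fun s sT => (ub s sT).1).
    apply: rprim_ext h => // s sT; rewrite /= lfieldE //.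
    by apply: (ub s _).1; move: sT; clear; nr_lra.
  exists T2 => // s st sT.
  have sT2 : 0 <= s - t <= T2 by move: st; clear; nr_lra.
  have := ode_unique (c := cmap i \o (fun u => z (t + u))) (d := cmap i \o (fun u => w (t + u))) lf.
  rewrite /= !addr0 -zwt => /(_ erefl (rp _ zX' tz) (fun s sT => (tz s sT).2) erefl (rp _ wX' tw) (fun s sT => (tw s sT).2) _ sT2).
  rewrite (_ : t + (s - t) = s); last by ring.
  move=> /(congr1 (cinv i)).
  have [iz _] := tz _ sT2; have [iw _] := tw _ sT2; move: iz iw.
  rewrite (_ : t + (s - t) = s); last by ring.
  by move=> iz iw; rewrite !cmapK.
move=> t tT zw; apply: (@mfd_hausdorff R n M) => A B zA wB.
have tT' : 0 <= t <= T by move: tT; clear; nr_lra.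
have [d1 d10 h1] := zX.1 t tT' A zA.
have [d2 d20 h2] := wX.1 t tT' B wB.
pose u := Num.max 0 (t - Num.min d1 d2 / 2).
have m0 : 0 < Num.min d1 d2 by rewrite lt_min d10.
have m1 : Num.min d1 d2 <= d1 by rewrite ge_min lexx.
have m2 : Num.min d1 d2 <= d2 by rewrite ge_min lexx orbT.
have u0 : 0 <= u by rewrite le_max lexx.
have ut : u < t by rewrite gt_max; move: tT m0; clear; nr_lra.
have ud : t - Num.min d1 d2 / 2 <= u by rewrite le_max lexx orbT.
have uT : 0 <= u <= T by move: u0 ut tT; clear; nr_lra.
exists (z u); split; first by apply: h1 => //; rewrite distrC ger0_norm; move: m0 m1 ud ut; clear; nr_lra.
rewrite zw ?u0 //; apply: h2 => //; rewrite distrC ger0_norm; move: m0 m2 ud ut; clear; nr_lra.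
Qed.

(** With right derivatives the equation at the junction time [T1] is that of [w] at 0; only
    continuity involves both curves. *)
Lemma icurve_cat X z w T1 T2 : 0 <= T1 -> 0 <= T2 -> icurve X z T1 -> icurve X w T2 -> z T1 = w 0 ->
  icurve X (fun t => if t <= T1 then z t else w (t - T1)) (T1 + T2).
Proof.
move=> T10 T20 [zc zd] [wc wd] zw; set y := fun t => _.
have yz t : t <= T1 -> y t = z t by move=> tT; rewrite /y tT.
have yw t : T1 <= t -> y t = w (t - T1).
  move=> tT; rewrite /y; case: ifPn => // tT'; have -> : t = T1 by move: tT tT'; clear; nr_lra.
  by rewrite subrr.
split=> [t tT U yU|t tT i].
  have [tT1|tT1] := ltP t T1.
    rewrite yz ?ltW // in yU; have [d d0 h] := zc t (ltac:(move: tT tT1; clear; nr_lra)) U yU.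
    exists (Num.min d (T1 - t)); first by rewrite lt_min d0 subr_gt0.
    move=> s sT; rewrite lt_min => /andP[sd st]; have sT1 : s <= T1.
      by move: st; rewrite ltr_norml; clear; nr_lra.
    by rewrite yz //; apply: h => //; move: sT sT1; clear; nr_lra.
  have yU2 := yU; rewrite yw // in yU2.
  have [d d0 h] := wc (t - T1) (ltac:(move: tT tT1; clear; nr_lra)) U yU2.
  have [tT1'|tT1'] := eqVneq t T1.
    rewrite tT1' yz // in yU; have [d' d'0 h'] := zc T1 (ltac:(move: T10; clear; nr_lra)) U yU.
    exists (Num.min d d'); first by rewrite lt_min d0.
    move=> s sT; rewrite lt_min => /andP[sd sd']; rewrite tT1' in sd sd'.
    have [sT1|sT1] := leP s T1.
      by rewrite yz //; apply: h' => //; move: sT sT1; clear; nr_lra.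
    rewrite yw ?ltW //; apply: h; first by move: sT sT1; clear; nr_lra.
    by rewrite tT1' subrr subr0.
  have tT1l : T1 < t by rewrite lt_neqAle eq_sym tT1'.
  exists (Num.min d (t - T1)); first by rewrite lt_min d0 subr_gt0.
  move=> s sT; rewrite lt_min => /andP[sd st]; have sT1 : T1 <= s.
    by move: st; rewrite ltr_norml; clear; nr_lra.
  rewrite yw //; apply: h => //; first by move: sT sT1; clear; nr_lra.
  by rewrite (_ : s - T1 - (t - T1) = s - t) //; ring.
have [tT1|tT1] := ltP t T1.
  rewrite yz ?ltW // => it e e0; have [d d0 h] := zd t (ltac:(move: tT tT1; clear; nr_lra)) i it e e0.
  exists (Num.min d (T1 - t)); first by rewrite lt_min d0 subr_gt0.
  move=> s; rewrite lt_min => /andP[s0 /andP[sd st]] sT.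
  have tsT : t + s <= T1 by move: st; clear; nr_lra.
  have := h s (ltac:(by rewrite s0)) tsT.
  by rewrite /= yz // yz // ltW.
rewrite yw // => it e e0; have [d d0 h] := wd (t - T1) (ltac:(move: tT tT1; clear; nr_lra)) i it e e0.
exists d => // s s0 sT.
have := h s s0 (ltac:(move: sT; clear; nr_lra)).
rewrite /= yw //; last by move: tT1 s0; clear; nr_lra.
by rewrite yw // (_ : t + s - T1 = t - T1 + s) //; ring.
Qed.

End Charts.

(** * Complex derivatives of vector-valued functions, coordinate by coordinate *)

Section Coordinates.
Variable R : realType.
Local Notation C := (Cplx R).

Lemma coordB n (v w : Cn R n) j : (v - w) ord0 j = (v ord0 j : C) - w ord0 j.
Proof. by rewrite mxE mxE. Qed.
Lemma coordZ n k (w : Cn R n) j : (k *: w) ord0 j = k * (w ord0 j : C).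
Proof. by rewrite mxE. Qed.

Lemma finite_radius n (P : 'I_n -> R -> Prop) :
  (forall j, exists2 r : R, 0 < r & P j r) ->
  (forall j r s, 0 < s -> s <= r -> P j r -> P j s) ->
  exists2 r : R, 0 < r & forall j, P j r.
Proof.
move=> ex mono.
have ex2 j : exists r : R, 0 < r /\ P j r by have [r r0 Pr] := ex j; exists r.
have [r rP] := choice ex2.
have r0 : 0 < \big[Num.min/1]_j r j.
  by elim/big_ind: _ => // [x y x0 y0|j _]; [rewrite lt_min x0 | case: (rP j)].
exists (\big[Num.min/1]_j r j) => // j.
by apply: (mono j (r j)) => //; [exact: bigmin_le_cond | case: (rP j)].
Qed.

Lemma vec_derivable n (u : C -> Cn R n) (z : C) :
  (forall j, derivable (fun w => u w ord0 j : C) z 1) -> derivable u z 1.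
Proof.
move=> ud.
pose a : Cn R n := \row_j ((fun w => u w ord0 j : C)^`()%classic z : C).
suff h : (h^-1 *: ((u \o shift z) (h *: (1 : C)) - u z)) @[h --> 0^'] --> a.
  by apply/cvg_ex; exists a.
apply/cvgrPdist_le => e e0.
have eE : e = rc (re e).
  by move: e0; rewrite ltcE /= => /andP[/eqP h _]; apply: c_ext.
have e0' : 0 < re e by move: e0; rewrite ltcE => /andP[].
rewrite near_withinE; apply/nbhs_nr.
have [|j r s s0 sr h w ws|r r0 rP] := @finite_radius n (fun j r => forall w, nr (w - z : C) < r ->
  nr ((u w ord0 j : C) - u z ord0 j - a ord0 j * (w - z) : C) <= re e * nr (w - z : C)).
- move=> j; have [r r0 fr] := derivable_cdiff (ud j) e0'; exists r => // w wr.
  by have := fr w wr; rewrite mxE.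
- by apply: h; exact: lt_le_trans sr.
exists r => // h; rewrite subr0 => hr h0.
have {}h0 : (h : C) != 0 by [].
rewrite /= (_ : h *: (1 : C) = h :> C); last exact: mulr1.
rewrite eE nrE ler_rc; apply: nr_le_coord; first exact: ltW.
move=> j; rewrite coordB coordZ coordB.
have := rP j (h + z); rewrite addrK => /(_ hr).
move: (u (h + z) ord0 j : C) (u z ord0 j : C) (a ord0 j : C) => A B D hF.
have -> : D - h^-1 * (A - B) = - h^-1 * (A - B - D * h).
  by move: (h : C) h0 => h' h0; field.
move: hF; move: (A - B - D * h) => E hF.
by rewrite nrM nrN nrV ler_pdivrMl ?nr_gt0 // mulrC.
Qed.

Lemma derivable_cont (W : normedModType C) (u : C -> W) (z : C) (e : R) : derivable u z 1 -> 0 < e ->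
  exists2 r : R, 0 < r & forall w, nr (w - z : C) < r -> nr (u w - u z) < e.
Proof.
move=> /derivable1_diffP/differentiable_continuous uc e0; apply/nbhs_nr.
by apply: (uc [set w | nr (w - u z) < e]); apply/nbhs_nr; exists e.
Qed.

End Coordinates.

(** * Flows *)

Section Flows.
Variables (R : realType) (n : nat) (M : complexManifold R n).
Local Notation C := (Cplx R).
Local Notation V := (Cn R n).
Implicit Types (i j : index M) (p q : M) (X Y : vfield M).

Lemma vfield_near X i p (e : R) : cdom i p -> 0 < e ->
  nbhs p [set q | cdom i q /\ nr (X i q - X i p) < e].
Proof.
move=> ip e0; have [_ _ Xh] := vfieldP X.
have Yc : {for cmap i p, continuous (lfield X i)}.
  by apply: differentiable_continuous; apply: Xh; exists p.
have : nbhs (lfield X i (cmap i p)) [set w : V | nr (w - lfield X i (cmap i p)) < e].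
  by apply/nbhs_nr; exists e.
move=> /Yc/nbhs_nr[d d0 dP]; apply: filterS (cmap_nbhs ip d0) => q [iq qd]; split=> //.
by have := dP _ qd; rewrite /= !lfieldE.
Qed.

Lemma integral_icurve X z (T : R) : integral_curve X z -> icurve X z T.
Proof.
move=> [zc zd]; split=> [t tT U zU|t tT i it e e0].
  have t0 : [set` `[0, +oo[] t by rewrite /= in_itv /=; case/andP: tT => ->.
  have /nbhs_ballP[d /= d0 h] := within_cont_nbhs zc t0 zU.
  exists d => // s sT st; apply: h; first by rewrite -ball_normE /ball_ /= distrC.
  by rewrite /= in_itv /=; case/andP: sT => ->.
have t0 : 0 <= t by case/andP: tT.
have e0' : 0 < rc e by rewrite -rc0 ltr_rc.
have /cvgrPdist_le/(_ _ e0') := zd t t0 i it.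
rewrite near_withinE near_withinE => /nbhs_ballP[d /= d0 h].
exists d => // s /andP[s0 sd] sT.
have sb : ball (0 : R) d s by rewrite -ball_normE /ball_ /= sub0r normrN ger0_norm // ltW.
have s0' : s != 0 by rewrite gt_eqF.
have := h s sb s0' (ltac:(by rewrite /= addr_ge0 // ltW)).
rewrite nrE ler_rc => hs.
have -> : (cmap i \o z) (t + s) - (cmap i \o z) t - rc s *: X i (z t) =
  - (rc s *: (X i (z t) - rc s^-1 *: (cmap i (z (t + s)) - cmap i (z t)))).
  have rs0 : rc s != 0 by rewrite rc_eq0.
  by rewrite scalerBr scalerA -rcM mulfV // rc1 scale1r opprB.
by rewrite nrN nrZr ger0_norm ?(ltW s0) // mulrC ler_wpM2r // ltW.
Qed.

(** A continuous right derivative is two-sided: near [t] the field varies by less than [e] along the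
    curve, and [mvi_aff] applies on [[t, t + s]] as well as on [[t + s, t]] for negative [s]. *)
Lemma icurve_integral X z : (forall T, icurve X z T) -> integral_curve X z.
Proof.
move=> zX; split.
  apply/subspace_continuousP => t; rewrite /= in_itv /= andbT => t0 U zU.
  have [d d0 h] := (zX (t + 1)).1 t (ltac:(move: t0; clear; nr_lra)) U zU.
  apply/nbhs_ballP; exists (Num.min d 1); first by rewrite /= lt_min d0 ltr01.
  move=> s; rewrite -ball_normE /ball_ /= in_itv /= andbT lt_min => /andP[sd s1] s0.
  apply: h; last by rewrite distrC.
  by move: s1; rewrite ltr_norml; move: s0; clear; nr_lra.
move=> t t0 i it; apply/cvgrPdist_le => e e0.
have eE : e = rc (re e).
  by move: e0; rewrite ltcE /= => /andP[/eqP h _]; apply: c_ext.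
have e0' : 0 < re e by move: e0; rewrite ltcE => /andP[].
have zT := zX (t + 1).
have [d d0 h] := zT.1 t (ltac:(move: t0; clear; nr_lra)) _ (vfield_near X it e0').
rewrite near_withinE near_withinE; apply/nbhs_ballP.
exists (Num.min d 1); first by rewrite /= lt_min d0 ltr01.
move=> s; rewrite -ball_normE /ball_ /= sub0r normrN lt_min => /andP[sd s1] s0 ts.
rewrite eE nrE ler_rc.
have near u : 0 <= u -> `|u - t| <= `|s| -> cdom i (z u) /\ nr (X i (z u) - X i (z t)) < re e.
  move=> u0 us; apply: h; last exact: le_lt_trans sd.
  by have := le_lt_trans us s1; rewrite ltr_norml; move: u0; clear; nr_lra.
have main a b : 0 <= a -> a <= b -> b <= t + 1 -> (forall u, a <= u <= b -> `|u - t| <= `|s|) ->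
    nr (cmap i (z b) - cmap i (z a) - rc (b - a) *: X i (z t)) <= re e * (b - a).
  move=> a0 ab bT ub.
  have hp : rprim a b (cmap i \o z) (fun u => X i (z u)).
    apply: (icurve_rprim zT) => // u uab.
    by apply: (near u _ (ub u uab)).1; move: a0 uab; clear; nr_lra.
  apply: (mvi_aff ab hp) => u uab; apply/ltW; apply: (near u _ (ub u _)).2.
    by move: a0 uab; clear; nr_lra.
  by move: uab; clear; nr_lra.
have fin D : nr (D - rc s *: X i (z t)) <= re e * `|s| ->
    nr (X i (z t) - (s^-1)%:C *: D) <= re e.
  have rs0 : rc s != 0 by rewrite rc_eq0.
  have -> : X i (z t) - (s^-1)%:C *: D = rc (- s^-1) *: (D - rc s *: X i (z t)).
    rewrite scalerBr scalerA -rcM mulNr mulVf // !rcN rc1 scaleN1r opprK scaleNr addrC.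
    by [].
  rewrite nrZr normrN normfV => hD.
  by rewrite ler_pdivrMl ?normr_gt0 // mulrC.
apply: fin; have [sp|sn] := leP 0 s.
  have := main t (t + s) t0 (ltac:(by rewrite lerDl)) (ltac:(move: s1; rewrite ger0_norm // lerD2l; exact: ltW)).
  rewrite (_ : t + s - t = s); last by ring.
  rewrite (ger0_norm sp); apply=> u ut; rewrite ger0_norm; move: ut; clear; nr_lra.
have := main (t + s) t ts (ltac:(by rewrite gerDl ltW)) (ltac:(by rewrite lerDl)).
rewrite (_ : t - (t + s) = - s); last by ring.
rewrite (ltr0_norm sn) => /(_ _) hm.
have -> : cmap i (z (t + s)) - cmap i (z t) - rc s *: X i (z t) =
  - (cmap i (z t) - cmap i (z (t + s)) - rc (- s) *: X i (z t)).
  by rewrite rcN; lmod (Cplx R) V.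
rewrite nrN; apply: hm => u ut; rewrite ler0_norm; move: ut; clear; nr_lra.
Qed.

Lemma generator_icurve X p : infinitesimal_generator M X ->
  exists z : R -> M, z 0 = p /\ forall T, icurve X z T.
Proof.
by move=> gX; have [z [z0 zX]] := gX p; exists z; split=> // T; exact: integral_icurve.
Qed.

(** No regularity in [p] is asked, since the curves are chosen point by point; the semigroup law and
    the action on holomorphic discs are consequences. *)
Definition is_flow X (phi : R -> M -> M) :=
  forall p, phi 0 p = p /\ forall T, icurve X (phi^~ p) T.

Lemma generator_flow X : infinitesimal_generator M X -> exists phi, is_flow X phi.
Proof.
move=> gX; have ex p : exists z : R -> M, z 0 = p /\ forall T, icurve X z T.
  exact: generator_icurve.
by have [f fP] := choice ex; exists (fun t p => f p t).
Qed.

(** By uniqueness the curves on the intervals [[0, T]] extend each other, so the diagonal [f t t] is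
    one curve on the half-line. *)
Lemma flow_generator X : (forall p T, 0 <= T -> exists2 z : R -> M, z 0 = p & icurve X z T) ->
  infinitesimal_generator M X.
Proof.
move=> ex p.
have ex2 T : exists z : R -> M, 0 <= T -> z 0 = p /\ icurve X z T.
  have [T0|T0] := leP 0 T; last by exists (fun=> p).
  by have [z z0 zX] := ex p T T0; exists z.
have [f fP] := choice ex2.
exists (fun t => f t t); split; first by have [] := fP 0 (lexx _).
apply: icurve_integral => T; have [T0|T0] := ltP T 0.
  by split=> t; move: T0; clear; nr_lra.
have [fT0 fTX] := fP T T0.
apply: icurve_ext fTX => t /andP[t0 tT].
have [ft0 ftX] := fP t t0; have [_ fTX] := fP T T0.
by apply: (icurve_unique ftX (icurve_sub tT fTX)); rewrite ?ft0 ?fT0 ?t0 ?lexx.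
Qed.

Lemma flow_add X phi s t p : is_flow X phi -> 0 <= s -> 0 <= t -> phi (s + t) p = phi t (phi s p).
Proof.
move=> fl s0 t0; have [_ h1] := fl p; have [h2 h3] := fl (phi s p).
have := icurve_shift s0 (h1 (s + t)); rewrite (_ : s + t - s = t); last by ring.
move=> h; apply: (icurve_unique h (h3 t)); last by rewrite t0 lexx.
by rewrite addr0 h2.
Qed.

End Flows.

(** * Flows preserve holomorphic discs *)

Section FlowHolomorphic.
Variables (R : realType) (n : nat) (M : complexManifold R n).
Local Notation C := (Cplx R).
Local Notation V := (Cn R n).
Implicit Types (i j : index M) (p q : M) (X Y : vfield M).

Definition hol_pt (f : C -> M) (z : C) := {for z, continuous f} /\
  forall i, cdom i (f z) -> differentiable (cmap i \o f) z.

(** Holomorphy on a neighbourhood, because [weierstrass] takes place on a whole disc. *)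
Definition hol_at (f : C -> M) (z : C) := exists2 r : R, 0 < r &
  forall w, nr (w - z : C) < r -> hol_pt f w.

(** One chart suffices: holomorphic transition maps carry differentiability to every other chart
    around [f z]. *)
Lemma hol_pt_chart (f : C -> M) (u : C -> V) i (z : C) (r : R) : 0 < r ->
  (forall w, nr (w - z : C) < r -> cdom i (f w) /\ cmap i (f w) = u w) ->
  derivable u z 1 -> hol_pt f z.
Proof.
move=> r0 fu ud.
have [fz uz] : cdom i (f z) /\ cmap i (f z) = u z by apply: fu; rewrite subrr nr0.
have fE w : nr (w - z : C) < r -> f w = cinv i (u w).
  by move=> /fu[iw <-]; rewrite cmapK.
have uimg : (cmap i @` cdom i) (u z) by exists (f z).
split=> [A fA|j jz].
  have fA' : nbhs (cinv i (u z) : M) A by rewrite -uz cmapK.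
  have [e e0 eA] := cinv_nbhs uimg fA'.
  have [d d0 ude] := derivable_cont ud e0.
  apply/nbhs_nr; exists (Num.min r d); first by rewrite lt_min r0.
  move=> w; rewrite lt_min => /andP[wr wd]; rewrite /= fE //.
  by have [] := eA _ (ude w wd).
apply/derivable1_diffP.
have ijz : (cmap i @` (cdom i `&` cdom j)) (u z) by exists (f z).
have : derivable ((cmap j \o cinv i) \o u) z 1.
  apply/derivable1_diffP; apply: differentiable_comp; first exact/derivable1_diffP.
  exact: transition_holomorphic ijz.
apply: near_eq_derivable; apply/nbhs_nr; exists r => // w wr.
by rewrite /= fE.
Qed.

Lemma differentiable_addZ (W : normedModType C) (Y : W -> W) (k : C) (x : W) :
  differentiable Y x -> differentiable (fun x => x + k *: Y x) x.
Proof.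
move=> Yd; have h1 : differentiable (@idfun W) x by exact: ex_diff.
have h2 : differentiable (k *: Y) x by exact: differentiableZ.
exact: (differentiableD h1 h2).
Qed.

Lemma euler_derivable (Y : V -> V) (a : C -> V) (d : R) (z : C) k : derivable a z 1 ->
  (forall l, (l < k)%N -> differentiable Y (iter l (euler Y d) (a z))) ->
  derivable (fun w => iter k (euler Y d) (a w)) z 1.
Proof.
move=> ad; elim: k => [//|k IH] Yd.
have {}IH := IH (fun l lk => Yd l (ltnW lk)).
have h : differentiable (euler Y d) (iter k (euler Y d) (a z)).
  by have := differentiable_addZ (rc d) (Yd k (ltnSn k)).
apply/derivable1_diffP.
have IH' : differentiable (fun w => iter k (euler Y d) (a w)) z by apply/derivable1_diffP.
exact: (differentiable_comp IH' h).
Qed.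

(** In a chart the flow is a uniform limit of Euler polygons, each holomorphic in the disc
    parameter. [U] and [d] depend on [q] and not on the disc, as the induction in time of [flow_hol]
    requires. *)
Lemma flow_hol_local X phi q : is_flow X phi -> exists U : set M, exists d : R,
  [/\ nbhs q U, 0 < d & forall (f : C -> M) z, hol_at f z -> U (f z) ->
    forall h, 0 <= h <= d -> hol_at (phi h \o f) z].
Proof.
move=> fl; have [i iq] := cdom_cover q.
have [r [K [L [T [r0 K0 im Yd lf]]]]] := lfield_data X iq.
have T0 : 0 < T by apply: (lf_T (lf (cmap i q) _)); rewrite subrr nr0 ltW.
exists [set p | cdom i p /\ nr (cmap i p - cmap i q) < r], T; split=> //.
  exact: cmap_nbhs.
move=> f z [s s0 fs] [ifz fzr] h hT.
have [fc _] := fs z (ltac:(by rewrite subrr nr0)).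
have : nbhs (f z) [set p | cdom i p /\ nr (cmap i p - cmap i q) < r].
  have := cmap_nbhs ifz (ltac:(by rewrite subr_gt0) : 0 < r - nr (cmap i (f z) - cmap i q)).
  apply: filterS => p [ip pr]; split=> //.
  by have := nr_dist (cmap i p) (cmap i (f z)) (cmap i q); move: pr; clear; nr_lra.
move=> /fc/nbhs_nr[s' s'0 fU].
pose s1 := Num.min s s'.
have s10 : 0 < s1 by rewrite lt_min s0.
exists s1 => // w ws.
pose a (v : C) : V := cmap i (f v).
pose u (v : C) : V := cmap i (phi h (f v)).
have key v : nr (v - z : C) < s1 -> [/\ derivable a v 1, cdom i (f v),
    nr (a v - cmap i q) < r, cdom i (phi h (f v)) & forall N,
    [/\ nr (u v - iter N.+1 (euler (lfield X i) (h / N.+1%:R)) (a v)) <= 2 * (L * K) * T ^+ 2 / N.+1%:R &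
    forall l, (l <= N.+1)%N -> nr (iter l (euler (lfield X i) (h / N.+1%:R)) (a v) - cmap i q) <= 2 * r]].
  rewrite lt_min => /andP[vs vs']; have [iv vr] := fU v vs'.
  have [_ /(_ i iv)/derivable1_diffP ad] := fs v vs.
  have [f0 fX] := fl (f v).
  have lfv := lf (a v) (ltW vr).
  have imv x : nr (x - a v) <= r -> (cmap i @` cdom i) x.
    by move=> xr; apply: im; have := nr_dist x (a v) (cmap i q); move: xr vr; rewrite /a; clear; nr_lra.
  have tr := icurve_trapped (r := r) (K := K) (L := L) (i := i) (fX T).
  rewrite /= f0 in tr; have {}tr := tr iv r0 K0 imv lfv.
  have rp : rprim 0 T (cmap i \o (phi^~ (f v))) (lfield X i \o (cmap i \o (phi^~ (f v)))).
    have hp := icurve_rprim (fX T) (lexx 0) (lexx T) (fun t tT => (tr t tT).1).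
    apply: rprim_ext hp => // t tT; rewrite /= lfieldE //.
    by apply: (tr t _).1; move: tT; clear; nr_lra.
  have tb : in_ball (a v) r T (cmap i \o (phi^~ (f v))) by move=> t tT; exact: (tr t tT).2.
  have c0 : (cmap i \o (phi^~ (f v))) 0 = a v by rewrite /= f0.
  split=> //; first by have [] := tr h hT.
  move=> N; split; first exact: (euler_cvg N lfv c0 rp tb hT).
  move=> l lN; have := euler_in lfv c0 rp tb hT lN.
  have := nr_dist (iter l (euler (lfield X i) (h / N.+1%:R)) (a v)) (a v) (cmap i q).
  by move: vr; rewrite /a; clear; nr_lra.
have sub v : nr (v - w : C) <= (s1 - nr (w - z)) / 2 -> nr (v - z) < s1.
  by have := nr_dist v w z; move: ws; clear; nr_lra.
(* Half of the distance left, so that the closed disc of this radius around [w] lies in the open one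
   of radius [s1] around [z]. *)
have rho0 : 0 < (s1 - nr (w - z)) / 2 by rewrite divr_gt0 // subr_gt0.
apply: (hol_pt_chart (u := u) (i := i) rho0).
  by move=> v /ltW/sub/key[].
apply: vec_derivable => j.
apply: (weierstrass (F := fun N v => iter N.+1 (euler (lfield X i) (h / N.+1%:R)) (a v) ord0 j : C) rho0).
  move=> N v /sub/key[ad _ _ _ /(_ N)[_ El]].
  apply/derivable1_diffP.
  have hd : differentiable (fun x => iter N.+1 (euler (lfield X i) (h / N.+1%:R)) (a x)) v.
    apply/derivable1_diffP.
    exact: (euler_derivable (k := N.+1) ad (fun l lN => Yd _ (El l (ltnW lN)))).
  exact: (differentiable_comp hd (@differentiable_coord C 1 n _ ord0 j)).
move=> e e0; pose B := 2 * (L * K) * T ^+ 2.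
exists (Num.truncn (B / e)) => N v Nv /sub/key[_ _ _ _ /(_ N)[uE _]].
rewrite nr_distC -coordB; apply: (le_trans (nr_coord _ _)); apply: (le_trans uE).
rewrite -/B ler_pdivrMr // -ler_pdivrMl // mulrC.
by apply: (le_trans (ltW (truncnS_gt _))); rewrite ler_nat.
Qed.

(** Real induction in time. For the limit step at [s], an earlier time [u] is chosen with
    [s - u <= d] and [phi u (f z)] in [U], and [flow_hol_local] covers the rest. *)
Lemma flow_hol X phi (f : C -> M) z : is_flow X phi -> hol_at f z ->
  forall t, 0 <= t -> hol_at (phi t \o f) z.
Proof.
move=> fl fz t t0.
have ext g1 g2 : g1 = g2 -> hol_at g1 z -> hol_at g2 z by move=> ->.
have add s h : 0 <= s -> 0 <= h -> hol_at (phi h \o (phi s \o f)) z -> hol_at (phi (s + h) \o f) z.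
  by move=> s0 h0; apply: ext; apply/funext => w; rewrite /= (flow_add _ fl).
apply: (real_induction (P := fun s => hol_at (phi s \o f) z) t0); last by rewrite t0 lexx.
- by apply: ext fz; apply/funext => w; rewrite /= (fl (f w)).1.
- move=> s st fs; have [U [d [Uq d0 HU]]] := flow_hol_local (phi s (f z)) fl.
  exists d => // u su ut; rewrite (_ : u = s + (u - s)); last by ring.
  apply: add; [by case/andP: st | by move: su; clear; nr_lra | ].
  apply: HU => //; last by move: su; clear; nr_lra.
  exact: nbhs_singleton Uq.
- move=> s st fs; have [U [d [Uq d0 HU]]] := flow_hol_local (phi s (f z)) fl.
  have [_ /(_ s)[sc _]] := fl (f z).
  have s0 : 0 < s by case/andP: st.
  have [d' d'0 h] := sc s (ltac:(by rewrite ltW // lexx)) U Uq.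
  pose u := Num.max 0 (s - Num.min d d' / 2).
  have m0 : 0 < Num.min d d' by rewrite lt_min d0.
  have m1 : Num.min d d' <= d by rewrite ge_min lexx.
  have m2 : Num.min d d' <= d' by rewrite ge_min lexx orbT.
  have u0 : 0 <= u by rewrite le_max lexx.
  have us : u < s by rewrite gt_max s0; move: m0; clear; nr_lra.
  have ud : s - Num.min d d' / 2 <= u by rewrite le_max lexx orbT.
  rewrite (_ : s = u + (s - u)); last by ring.
  apply: add => //; first by rewrite subr_ge0 ltW.
  apply: HU; first by apply: fs; rewrite u0.
    apply: h; first by rewrite u0 ltW.
    by rewrite distrC ger0_norm; move: us m0 m2 ud; clear; nr_lra.
  by move: us m0 m1 ud; clear; nr_lra.
Qed.

Lemma disc_hol_at (f : C -> M) z : holomorphic_disc f -> unit_disc z -> hol_at f z.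
Proof.
move=> fh z1; have {}z1 : nr z < 1 by move: z1; rewrite /unit_disc /= nrE -rc1 ltr_rc.
exists (1 - nr z); first by rewrite subr_gt0.
move=> w wz; apply: fh; rewrite /unit_disc /= nrE -rc1 ltr_rc.
by have := nrD (w - z) z; rewrite subrK; move: wz; clear; nr_lra.
Qed.

Lemma flow_disc X phi (f : C -> M) t : is_flow X phi -> 0 <= t -> holomorphic_disc f ->
  holomorphic_disc (phi t \o f).
Proof.
move=> fl t0 fh z z1; have [r r0 h] := flow_hol fl (disc_hol_at fh z1) t0.
by have [h1 h2] := h z (ltac:(by rewrite subrr nr0)).
Qed.

End FlowHolomorphic.

(** * Estimates for the Poincare distance of the disc *)

Section PoincareDistance.
Variable R : realType.
Local Notation C := (Cplx R).

(** The pseudo-hyperbolic distance, of which [poincare_dist] is an increasing function. *)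
Definition pratio (z w : C) : R := nr ((z - w) / (1 - z * w^*)%C : C).

Lemma poincareE (z w : C) : poincare_dist z w = 2^-1 * ln ((1 + pratio z w) / (1 - pratio z w)).
Proof. by []. Qed.

Lemma re_conj (z : C) : re (z^*)%C = re z. Proof. by case: z. Qed.
Lemma im_conj (z : C) : im (z^*)%C = - im z. Proof. by case: z. Qed.

Lemma nr_lt1 (z : C) : nr z < 1 <-> re z ^+ 2 + im z ^+ 2 < 1.
Proof.
rewrite -nr_sq; split=> h; first by rewrite expr_lt1 ?nr_ge0.
by rewrite -(expr_lt1 (n := 2)) ?nr_ge0.
Qed.

Lemma pratio_den (z w : C) : nr (1 - z * w^*)%C ^+ 2 =
  (1 - (re z * re w + im z * im w)) ^+ 2 + (im z * re w - re z * im w) ^+ 2.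
Proof.
by rewrite nr_sq !(reD, imD, reN, imN, reM, imM) re_conj im_conj -rc1 re_rc im_rc; ring.
Qed.

Lemma pratio_den_gt0 (z w : C) : nr z < 1 -> nr w < 1 -> 0 < nr (1 - z * w^*)%C.
Proof.
move=> /nr_lt1 z1 /nr_lt1 w1; rewrite lt_neqAle nr_ge0 andbT eq_sym; apply/eqP => h.
have := pratio_den z w; rewrite h expr0n /=.
have : re z * re w + im z * im w < 1.
  have := sqr_ge0 (re z - re w); have := sqr_ge0 (im z - im w); move: z1 w1; clear; nra.
set a := re z * re w + _; set b := im z * re w - _.
have := sqr_ge0 b; move=> b0 a1 e; have : 0 < (1 - a) ^+ 2 by rewrite exprn_gt0 // subr_gt0.
move: b0 e; clear; nr_lra.
Qed.

Lemma pratioE (z w : C) : pratio z w = nr (z - w) / nr (1 - z * w^*)%C.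
Proof. by rewrite /pratio nrM nrV. Qed.

(** By the identity |1 - z conj(w)|^2 - |z - w|^2 = (1 - |z|^2)(1 - |w|^2). *)
Lemma pratio_lt1 (z w : C) : nr z < 1 -> nr w < 1 -> pratio z w < 1.
Proof.
move=> z1 w1; have d0 := pratio_den_gt0 z1 w1.
rewrite pratioE ltr_pdivrMr // mul1r -ltr_sqr ?nnegrE ?nr_ge0 //.
rewrite pratio_den nr_sq !(reD, imD, reN, imN).
move/nr_lt1: z1 => z1; move/nr_lt1: w1 => w1.
have : 0 < (1 - (re z ^+ 2 + im z ^+ 2)) * (1 - (re w ^+ 2 + im w ^+ 2)).
  by rewrite mulr_gt0 // subr_gt0.
by clear; nra.
Qed.

Lemma pratio_ge0 (z w : C) : 0 <= pratio z w.
Proof. exact: nr_ge0. Qed.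

Lemma poincare_le (a b c d : C) : pratio a b <= pratio c d -> pratio c d < 1 ->
  poincare_dist a b <= poincare_dist c d.
Proof.
move=> h1 h2; rewrite !poincareE ler_pM2l ?invr_gt0 //.
have a0 := pratio_ge0 a b; have c0 := pratio_ge0 c d.
rewrite ler_ln ?posrE; first last.
- by rewrite divr_gt0; move: h1 h2 a0; clear; nr_lra.
- by rewrite divr_gt0; move: h1 h2 a0; clear; nr_lra.
rewrite ler_pdivrMr; last by move: h1 h2; clear; nr_lra.
rewrite mulrAC ler_pdivlMr; last by move: h2; clear; nr_lra.
by move: h1 h2 a0 c0; clear; nra.
Qed.

Lemma poincare_ge0 (z w : C) : nr z < 1 -> nr w < 1 -> 0 <= poincare_dist z w.
Proof.
move=> z1 w1; rewrite poincareE mulr_ge0 ?invr_ge0 // ln_ge0 //.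
have h := pratio_lt1 z1 w1; have h0 := pratio_ge0 z w.
by rewrite ler_pdivlMr; move: h h0; clear; nr_lra.
Qed.

(** From [ln (1 + x) <= x] with [x = 2 * nr w / (1 - nr w)], which is at most [4 * nr w] here. *)
Lemma poincare_small (w : C) : nr w <= 2^-1 -> poincare_dist 0 w <= 2 * nr w.
Proof.
move=> w2; rewrite poincareE.
have -> : pratio 0 w = nr w.
  by rewrite pratioE mul0r subr0 sub0r nrN nr1 divr1.
have w0 := nr_ge0 w.
have -> : (1 + nr w) / (1 - nr w) = 1 + (2 * nr w / (1 - nr w)).
  by field; apply/eqP; move: w2; clear; nr_lra.
have h : 2 * nr w / (1 - nr w) <= 4 * nr w.
  by rewrite ler_pdivrMr; move: w2 w0; clear; nra.
have h0 : 0 <= 2 * nr w / (1 - nr w) by rewrite divr_ge0; move: w2 w0; clear; nr_lra.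
have := @le_ln1Dx R (2 * nr w / (1 - nr w)) => /(_ _) h2.
have {}h2 := h2 (ltac:(move: h0; clear; nr_lra)).
by move: h h2; clear; nr_lra.
Qed.

Lemma nr_segment_lt1 (a b : C) (t : R) : nr a < 1 -> nr b < 1 -> 0 <= t <= 1 ->
  nr (a + rc t * (b - a)) < 1.
Proof.
move=> a1 b1 /andP[t0 t1].
have -> : a + rc t * (b - a) = rc (1 - t) * a + rc t * b by rewrite rcB rc1; ring.
apply: (le_lt_trans (nrD _ _)); rewrite !nrM !nr_rc !ger0_norm ?subr_ge0 //.
have := nr_ge0 a; have := nr_ge0 b; move: a1 b1 t0 t1; clear.
have [->|t0'] := eqVneq t 0; first by lra.
move=> a1 b1 t0 t1 b0 a0; have : t * nr b < t by rewrite gtr_pMr // lt_neqAle eq_sym t0'.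
have : (1 - t) * nr a <= (1 - t) by rewrite ler_piMr ?subr_ge0 // ltW.
lra.
Qed.

(** After clearing denominators and squaring, the difference [D] of the two sides factors into
    nonnegative terms, as |a| < 1 and Re(a conj(b)) <= 1. Euclidean segments can therefore stand in
    for geodesics. *)
Lemma pratio_segment (a b : C) (t : R) : nr a < 1 -> nr b < 1 -> 0 <= t <= 1 ->
  pratio a (a + rc t * (b - a)) <= pratio a b.
Proof.
move=> a1 b1 /andP[t0 t1]; set c := a + _.
have c1 : nr c < 1 by apply: nr_segment_lt1 => //; rewrite t0.
rewrite !pratioE.
have db := pratio_den_gt0 a1 b1; have dc := pratio_den_gt0 a1 c1.
have -> : a - c = - (rc t * (b - a)) by rewrite /c; ring.
rewrite nrN nrM nr_rc ger0_norm // (nr_distC a).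
rewrite ler_pdivrMr // mulrAC ler_pdivlMr // (mulrC t) -mulrA ler_wpM2l ?nr_ge0 //.
rewrite -ler_sqr ?nnegrE ?mulr_ge0 ?nr_ge0 // exprMn !pratio_den.
rewrite /c !(reD, imD, reN, imN, reM, imM) re_rc im_rc.
move/nr_lt1: a1; move/nr_lt1: b1.
move: (re a) (im a) (re b) (im b) => a1 a2 b1 b2 hb ha.
have k1 : a1 * b1 + a2 * b2 <= 1.
  have := sqr_ge0 (a1 - b1); have := sqr_ge0 (a2 - b2); move: ha hb; clear; nra.
rewrite -subr_ge0; set D := _ - _.
have -> : D = (1 - (a1 ^+ 2 + a2 ^+ 2)) * (1 - t) *
   ((1 - (a1 ^+ 2 + a2 ^+ 2)) * (1 - t) + 2 * t * (1 - (a1 * b1 + a2 * b2))).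
  by rewrite /D; ring.
have A0 : 0 <= 1 - (a1 ^+ 2 + a2 ^+ 2) by rewrite subr_ge0 ltW.
have t1' : 0 <= 1 - t by rewrite subr_ge0.
by rewrite mulr_ge0 ?mulr_ge0 // addr_ge0 ?mulr_ge0 // subr_ge0.
Qed.

End PoincareDistance.

(** * The Kobayashi distance *)

Section KobayashiDistance.
Variables (R : realType) (n : nat) (M : complexManifold R n).
Local Notation C := (Cplx R).
Local Notation V := (Cn R n).
Local Notation k := (@kobayashi R n M).
Implicit Types (i j : index M) (p q : M) (X Y : vfield M).

Lemma unit_discE (z : C) : unit_disc z <-> nr z < 1.
Proof. by rewrite /unit_disc /= nrE -rc1 ltr_rc. Qed.

Lemma chain_ge0 p q : lbound (disc_chain_length p q) 0.
Proof.
move=> s [m [x [f [a [b [_ _ h ->]]]]]]; apply: sumr_ge0 => j _.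
by have [_ /unit_discE aj /unit_discE bj _ _] := h j (ltn_ord j); exact: poincare_ge0.
Qed.

Lemma kobayashi_le p q s : disc_chain_length p q s -> k p q <= s.
Proof. by move=> h; apply: ge_inf => //; exists 0; exact: chain_ge0. Qed.

Lemma kobayashi_disc (f : C -> M) (a b : C) : holomorphic_disc f -> unit_disc a -> unit_disc b ->
  k (f a) (f b) <= poincare_dist a b.
Proof.
move=> fh a1 b1; apply: kobayashi_le.
exists 1%N, (fun l => if l is 0%N then f a else f b), (fun=> f), (fun=> a), (fun=> b).
by split=> // [[|//]|]; rewrite ?big_ord1.
Qed.

Hypothesis kd : is_distance k.

Lemma kob0 p : k p p = 0.
Proof. by have [_ h _ _] := kd; apply/h. Qed.
Lemma kob_sym p q : k p q = k q p. Proof. by have [_ _ h _] := kd. Qed.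
Lemma kob_tri p q r : k p r <= k p q + k q r. Proof. by have [_ _ _ h] := kd. Qed.
Lemma kob_ge0 p q : 0 <= k p q. Proof. by have [h _ _ _] := kd. Qed.
Lemma kob_eq0 p q : k p q = 0 -> p = q. Proof. by have [_ h _ _] := kd; move/h. Qed.

(** The disc [u] on the complex line from [x] to [y] reaches [y] at the parameter [d / r <= 1/2], so
    [poincare_small] gives the constant [2 / r]. *)
Lemma kob_upper i p : cdom i p -> exists c : R, exists U : set M, [/\ 0 < c, nbhs p U &
  forall a b, U a -> U b -> k a b <= c * nr (cmap i a - cmap i b)].
Proof.
move=> ip; have [s s0 im] := cimg_ball ip.
(* The disc stays within [r / 4 + r < s] of the image of [p], hence in the chart; starting points
   within [r / 4] also give [d <= r / 2]. *)
pose r := s / 2; have r0 : 0 < r by rewrite divr_gt0.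
have r4 : 0 < r / 4 by rewrite divr_gt0.
exists (2 / r), [set q | cdom i q /\ nr (cmap i q - cmap i p) < r / 4]; split.
- by rewrite divr_gt0.
- exact: cmap_nbhs.
move=> a b [ia ar] [ib br].
have [ab|ab] := eqVneq (cmap i a) (cmap i b).
  have -> : a = b by rewrite -(cmapK ia) ab cmapK.
  by rewrite kob0 mulr_ge0 ?nr_ge0 // divr_ge0 // ltW.
set x := cmap i a in ar ab *; set y := cmap i b in br ab *.
pose d := nr (x - y).
have d0 : 0 < d.
  rewrite lt_neqAle nr_ge0 andbT eq_sym; apply/eqP => /nr_eq0 /eqP.
  by rewrite subr_eq0 (negPf ab).
have dr : d <= r / 2.
  have := nr_dist x (cmap i p) y; rewrite (nr_distC (cmap i p) y) -/d; move: ar br; clear; nr_lra.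
pose u (z : C) : V := x + z *: (rc (r / d) *: (y - x)).
have uE z : nr (u z - cmap i p) <= r / 4 + nr z * r.
  have -> : u z - cmap i p = (x - cmap i p) + z *: (rc (r / d) *: (y - x)).
    by rewrite /u; lmod (Cplx R) V.
  apply: (le_trans (nrD _ _)); apply: lerD; first exact: ltW.
  rewrite nrZ nrZr (nr_distC y) -/d ger0_norm; last by apply: divr_ge0; exact: ltW.
  by rewrite divfK // gt_eqF.
have uim z : nr z < 1 -> (cmap i @` cdom i) (u z).
  move=> z1; apply: im; apply: (le_lt_trans (uE z)).
  have : nr z * r <= r by rewrite ler_piMl // ltW.
  by move: r0; rewrite /r; clear; nr_lra.
pose f z := cinv i (u z).
have fh : holomorphic_disc f.
  move=> z /unit_discE z1.
  have h : 0 < 1 - nr z by rewrite subr_gt0.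
  apply: (hol_pt_chart (u := u) (i := i) h).
    move=> w wz; have w1 : nr w < 1.
      by have := nrD (w - z) z; rewrite subrK; move: wz; clear; nr_lra.
    exact: cinv_in (uim w w1).
  by apply/derivable1_diffP; exact: differentiable_line.
have d1 : nr (rc (d / r) : C) = d / r by rewrite nr_rc ger0_norm // divr_ge0 // ltW.
have dr2 : d / r <= 2^-1 by rewrite ler_pdivrMr // mulrC.
have fa : f 0 = a by rewrite /f /u scale0r addr0 /x cmapK.
have fb : f (rc (d / r)) = b.
  rewrite /f /u scalerA -rcM (_ : d / r * (r / d) = 1); last by field; rewrite !gt_eqF.
  by rewrite rc1 scale1r addrC subrK /y cmapK.
rewrite -{1}fa -{1}fb; apply: (le_trans (kobayashi_disc fh _ _)).
- by apply/unit_discE; rewrite nr0.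
- by apply/unit_discE; rewrite d1; move: dr2; clear; nr_lra.
apply: (le_trans (poincare_small _)); rewrite d1 //.
by rewrite -/d mulrA mulrAC.
Qed.

Lemma kob_near p (e : R) : 0 < e -> nbhs p [set q | k p q < e].
Proof.
move=> e0; have [i ip] := cdom_cover p; have [c [U [c0 Up h]]] := kob_upper ip.
have pU := nbhs_singleton Up.
have := cmap_nbhs ip (divr_gt0 e0 c0).
apply: filterS2 Up => q Uq [iq]; rewrite ltr_pdivlMr // => qr.
by rewrite /= kob_sym; apply: le_lt_trans (h q p Uq pU) _; rewrite mulrC.
Qed.

Lemma kob_continuous p : continuous (k p : M -> R).
Proof.
move=> q; apply/cvgrPdist_lt => e e0.
near=> x; rewrite ltr_norml; have : k q x < e by near: x; exact: kob_near.
have := kob_tri p q x; have := kob_tri p x q; rewrite (kob_sym x q); clear; nr_lra.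
Unshelve. all: by end_near.
Qed.

(* Composition with [phi t] maps chains of discs to chains of discs. Without chains,
   [kobayashi] is [inf set0 = 0], which the hypothesis [kd] excludes for [p != q]. *)
Lemma flow_kob X phi t p q : is_flow X phi -> 0 <= t -> k (phi t p) (phi t q) <= k p q.
Proof.
move=> fl t0; have [->|pq] := eqVneq p q; first by rewrite !kob0.
have sub : disc_chain_length p q `<=` disc_chain_length (phi t p) (phi t q).
  move=> s [m [x [f [a [b [x0 xm h ->]]]]]].
  exists m, (phi t \o x), (fun l => phi t \o f l), a, b; split; rewrite /= ?x0 ?xm //.
  move=> l lm; have [fh al bl fa fb] := h l lm; split; rewrite /= ?fa ?fb //.
  exact: (flow_disc fl t0 fh).
have ne : disc_chain_length p q !=set0.
  apply/set0P/eqP => e; move: pq; rewrite (@kob_eq0 p q) ?eqxx //.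
  by rewrite /kobayashi e inf0.
apply: lb_le_inf => // s hs; apply: kobayashi_le; exact: sub.
Qed.

(* A chain of discs leaving a compact ball around [p] meets its boundary sphere on a
   Poincare segment inside one disc, where [k p] has a positive minimum. *)
Lemma kob_topology p (U : set M) : nbhs p U ->
  exists2 e : R, 0 < e & forall q, k p q < e -> U q.
Proof.
move=> pU; have [i ip] := cdom_cover p.
have [s s0 im] := cimg_ball ip.
have [s' s'0 imU] := @cinv_nbhs R n M i (cmap i p) U (ltac:(by exists p)) (ltac:(by rewrite cmapK)).
pose r := Num.min s s' / 2.
have m0 : 0 < Num.min s s' by rewrite lt_min s0.
have r0 : 0 < r by rewrite divr_gt0.
have rs : r < s.
  have : Num.min s s' <= s by rewrite ge_min lexx.
  by move: m0; rewrite /r; clear; nr_lra.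
have rs' : r < s'.
  have : Num.min s s' <= s' by rewrite ge_min lexx orbT.
  by move: m0; rewrite /r; clear; nr_lra.
have imr v : nr (v - cmap i p) <= r -> (cmap i @` cdom i) v.
  by move=> vr; apply: im; exact: le_lt_trans rs.
pose B := [set q : M | cdom i q /\ nr (cmap i q - cmap i p) < r].
pose K := [set q : M | cdom i q /\ nr (cmap i q - cmap i p) <= r].
have Bo : open B.
  rewrite openE => q [iq qr].
  have := cmap_nbhs iq (ltac:(by rewrite subr_gt0) : 0 < r - nr (cmap i q - cmap i p)).
  apply: filterS => q' [iq' qr']; split=> //.
  by have := nr_dist (cmap i q') (cmap i q) (cmap i p); move: qr'; clear; nr_lra.
have Kc : closed K by exact: cinv_cball_closed.
pose S := K `&` ~` B.
have Sc : compact S by apply: compact_closedI; [exact: cinv_cball_compact | exact: open_closedC].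
have [m mp Sm] : exists2 m : R, 0 < m & forall q, S q -> m <= k p q.
  (* The sphere [S] is empty in dimension 0, for instance; any [m] will then do. *)
  have [Sne|/set0P/negP/negPn/eqP Se] := pselect (S !=set0); last by exists 1 => // q; rewrite Se.
  have [c /set_mem[Kc' Bc] cm] := compact_EVT_min Sne Sc (continuous_subspaceT (@kob_continuous p)).
  exists (k p c); last by move=> q Sq; apply: cm; exact: mem_set.
  rewrite lt_neqAle kob_ge0 andbT eq_sym; apply/eqP => /kob_eq0 pc; apply: Bc.
  by rewrite -pc /B /= subrr nr0.
exists m => // q kq.
suff [iq qr] : B q.
  by have [_] := imU (cmap i q) (lt_trans qr rs'); rewrite cmapK.
have Bp : B p by rewrite /B /= subrr nr0.
have [<-//|pq] := eqVneq p q.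
have ne : disc_chain_length p q !=set0.
  apply/set0P/eqP => e; move: pq; rewrite (@kob_eq0 p q) ?eqxx //.
  by rewrite /kobayashi e inf0.
have [_ [N [x [f [a [b [x0 xN h ->]]]]]] sm] :
    exists2 s, disc_chain_length p q s & s < m.
  have hi : has_inf (disc_chain_length p q) by split=> //; exists 0; exact: chain_ge0.
  have [s1 h1 h2] := inf_adherent (ltac:(by rewrite subr_gt0) : 0 < m - k p q) hi.
  by exists s1 => //; move: h2; rewrite -/(k p q); clear; nr_lra.
have dist0 l : (l < N)%N -> 0 <= poincare_dist (a l) (b l).
  by move=> /h[_ /unit_discE al /unit_discE bl _ _]; exact: poincare_ge0.
have pre l : (l <= N)%N -> k p (x l) <= \sum_(l' < l) poincare_dist (a l') (b l').
  elim: l => [|l IH] lN; first by rewrite big_ord0 x0 kob0.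
  rewrite big_ord_recr /=; apply: (le_trans (kob_tri p (x l) _)); apply: lerD; first exact: IH (ltnW lN).
  have [fh al bl fa fb] := h l lN.
  by rewrite -fa -fb; exact: kobayashi_disc.
have tot l : (l < N)%N -> \sum_(l' < l) poincare_dist (a l') (b l') + poincare_dist (a l) (b l) < m.
  move=> lN; apply: le_lt_trans sm.
  rewrite -[in leRHS](subnK lN) -!(big_mkord xpredT (fun l' => poincare_dist (a l') (b l'))).
  rewrite -big_nat_recr //= [leRHS](big_cat_nat (n := l.+1)) ?leq_addl //=.
  rewrite lerDl big_nat_cond; apply: sumr_ge0 => l' /andP[/andP[_ l'N] _]; apply: dist0.
  by move: l'N; rewrite subnK.
suff H l : (l <= N)%N -> B (x l) by rewrite -xN; exact: H.
elim: l => [|l IH] lN; first by rewrite x0.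
have {}IH := IH (ltnW lN).
have [fh al bl fa fb] := h l lN.
have al1 := al; have bl1 := bl; move/unit_discE: al1 => al1; move/unit_discE: bl1 => bl1.
pose g (t : R) : M := f l (a l + rc t * (b l - a l)).
have seg t : 0 <= t <= 1 -> nr (a l + rc t * (b l - a l)) < 1 by exact: nr_segment_lt1.
have gc : {within `[0, 1], continuous g}.
  apply/subspace_continuousP => t; rewrite /= in_itv /= => t01 A gA.
  have [fc _] := fh _ (ltac:(by apply/unit_discE; exact: seg t01)).
  have /nbhs_nr[e e0 he] := fc _ gA.
  have v0 := nr_ge0 (b l - a l).
  apply/nbhs_ballP; exists (e / (nr (b l - a l) + 1)) => /=.
    by rewrite divr_gt0 // ltr_wpDl.
  move=> t'; rewrite -ball_normE /ball_ /= ltr_pdivlMr ?ltr_wpDl // => tt' _; apply: he.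
  rewrite opprD addrACA subrr add0r -mulrBl -rcB nrM nr_rc distrC.
  by apply: le_lt_trans tt'; rewrite ler_wpM2l // lerDl.
have gcon : connected (g @` `[0, 1]).
  by apply: connected_continuous_connected gc; exact: segment_connected.
apply: contrapT => nB.
(* Otherwise [B] and [K] have the same trace on the path [g]. It is open and closed in the path and
   contains its start, so by connectedness the endpoint lies in [B]. *)
have [t [t01 St]] : exists t, 0 <= t <= 1 /\ S (g t).
  apply: contrapT => nS.
  have nS' t : 0 <= t <= 1 -> B (g t) \/ ~ K (g t).
    move=> t01; have [Bt|nBt] := pselect (B (g t)); first by left.
    by right=> Kt; apply: nS; exists t; split; [exact: t01 | split; [exact: Kt | exact: nBt]].
  have BK q' : B q' -> K q' by move=> [iq' q'r]; split; [exact: iq' | exact: ltW].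
  have E : g @` `[0, 1] `&` B = g @` `[0, 1] `&` K.
    apply/seteqP; split=> q' [[t t01 <-] h']; split; try by exists t.
      exact: BK.
    rewrite /= in_itv /= in t01; have [Bt|nKt] := nS' t t01; [exact: Bt | by case: nKt].
  have := gcon (g @` `[0, 1] `&` B).
  move=> /(_ _ _ _) hc.
  have {}hc : g @` `[0, 1] `&` B = g @` `[0, 1].
    apply: hc; [|by exists B|by exists K].
    exists (g 0); split; first by exists 0 => //; rewrite /= in_itv /= lexx ler01.
    by rewrite /g rc0 mul0r addr0 fa.
  have : (g @` `[0, 1]) (x l.+1).
    exists 1; first by rewrite /= in_itv /= lexx ler01.
    by rewrite /g rc1 mul1r addrC subrK fb.
  by rewrite -hc => -[_ /nB].
have ct := seg t t01.
(* Up to [g t] the chain is no longer than its links up to the current one, so [k p (g t)] is below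
   the minimum [m] of [k p] on the sphere. *)
have := Sm _ St; rewrite leNgt; apply/negP.
apply/negPn; apply: le_lt_trans (tot l lN).
apply: (le_trans (kob_tri p (x l) _)); apply: lerD; first exact: pre (ltnW lN).
rewrite -fa; apply: (le_trans (kobayashi_disc fh al _)); first exact/unit_discE.
apply: poincare_le; last exact: pratio_lt1.
exact: pratio_segment.
Qed.

End KobayashiDistance.

(** * Integral curves up to a finite time *)

Section Tangency.
Variables (R : realType) (n : nat) (M : complexManifold R n).
Local Notation C := (Cplx R).
Local Notation V := (Cn R n).
Local Notation k := (@kobayashi R n M).
Implicit Types (i j : index M) (p q : M) (X Y : vfield M).

(** First order contact up to a fixed slope error [e]: a generator close to the field, but different
    from it, provides no more. *)
Definition tangent i p (v : V) (e : R) (u : R -> M) := exists2 d : R, 0 < d &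
  forall h, 0 < h < d -> cdom i (u h) /\ nr (cmap i (u h) - cmap i p - rc h *: v) <= e * h.

Lemma tangent_nbhs i p v e u (U : set M) : cdom i p -> 0 < e -> tangent i p v e u -> nbhs p U ->
  exists2 d : R, 0 < d & forall h, 0 < h < d -> U (u h).
Proof.
move=> ip e0 [d d0 ut] pU.
have [s s0 im] := @cinv_nbhs R n M i (cmap i p) U (ltac:(by exists p)) (ltac:(by rewrite cmapK)).
have ev : 0 < e + nr v by rewrite ltr_pwDl // nr_ge0.
exists (Num.min d (s / (e + nr v))); first by rewrite lt_min d0 divr_gt0.
move=> h /andP[h0]; rewrite lt_min ltr_pdivlMr // => /andP[hd hs].
have [iu uh] := ut h (ltac:(by rewrite h0)).
have [] := im (cmap i (u h)); last by move=> _; rewrite cmapK.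
apply: le_lt_trans hs; rewrite -(subrK (rc h *: v) (_ - _)).
apply: (le_trans (nrD _ _)); rewrite nrZr ger0_norm ?(ltW h0) // mulrDr (mulrC h e).
by rewrite lerD2r.
Qed.

Lemma icurve_tangent X z T i (e : R) : 0 < T -> 0 < e -> icurve X z T -> cdom i (z 0) ->
  tangent i (z 0) (X i (z 0)) e z.
Proof.
move=> T0 e0 [zc zd] i0.
have [d1 d10 h1] := zd 0 (ltac:(by rewrite lexx T0)) i i0 e e0.
have [d2 d20 h2] := zc 0 (ltac:(by rewrite lexx ltW)) _ (cdom_nbhs i0).
exists (Num.min T (Num.min d1 d2)); first by rewrite !lt_min T0 d10.
move=> h; rewrite !lt_min => /andP[h0 /andP[hT /andP[hd1 hd2]]].
split; first by apply: h2; [rewrite !ltW | rewrite subr0 ger0_norm // ltW].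
by have := h1 h (ltac:(by rewrite h0)) (ltac:(by rewrite add0r ltW)); rewrite /= add0r.
Qed.

(** The estimate is uniform in the starting point [q], since in a composition of two flows the outer
    one starts at a point that moves with [h]. *)
Lemma flow_step X phi i p (e : R) : is_flow X phi -> cdom i p -> 0 < e ->
  exists2 U : set M, nbhs p U & exists2 d : R, 0 < d & forall q h, U q -> 0 < h < d ->
    cdom i (phi h q) /\ nr (cmap i (phi h q) - cmap i q - rc h *: X i p) <= e * h.
Proof.
move=> fl ip e0.
have [r [K [L [T [r0 K0 im Yd lf]]]]] := lfield_data X ip.
have T0 : 0 < T by apply: (lf_T (lf (cmap i p) _)); rewrite subrr nr0 ltW.
have Yc : {for cmap i p, continuous (lfield X i)}.
  by apply: differentiable_continuous; apply: Yd; rewrite subrr nr0 mulr_ge0 // ltW.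
have : nbhs (lfield X i (cmap i p)) [set w : V | nr (w - lfield X i (cmap i p)) < e].
  by apply/nbhs_nr; exists e.
move=> /Yc/nbhs_nr[s s0 sP].
pose s' := Num.min (s / 2) r.
have s'0 : 0 < s' by rewrite lt_min divr_gt0.
have s's : s' <= s / 2 by rewrite ge_min lexx.
have s'r : s' <= r by rewrite ge_min lexx orbT.
exists [set q | cdom i q /\ nr (cmap i q - cmap i p) < s']; first exact: cmap_nbhs.
pose d := Num.min T (s / (2 * K)).
have d0 : 0 < d by rewrite lt_min T0 divr_gt0 // mulr_gt0.
have dT : d <= T by rewrite ge_min lexx.
have dK : d <= s / (2 * K) by rewrite ge_min lexx orbT.
exists d => // q h [iq qs] /andP[h0 hd].
have qr : nr (cmap i q - cmap i p) <= r by apply: le_trans (ltW qs) s'r.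
have lfq := lf (cmap i q) qr.
have imq x : nr (x - cmap i q) <= r -> (cmap i @` cdom i) x.
  by move=> xr; apply: im; have := nr_dist x (cmap i q) (cmap i p); move: xr qr; clear; nr_lra.
have [f0 fX] := fl q.
have tr := icurve_trapped (r := r) (K := K) (L := L) (i := i) (fX T).
rewrite /= f0 in tr; have {}tr := tr iq r0 K0 imq lfq.
have hT : h <= T by apply: ltW; exact: lt_le_trans dT.
have rp : rprim 0 h (cmap i \o (phi^~ q)) (fun t => X i (phi t q)).
  by apply: (icurve_rprim (fX T)) => // t th; apply: (tr t _).1; move: th hT; clear; nr_lra.
have Xb t : 0 <= t <= T -> nr (X i (phi t q)) <= K.
  move=> tT; have [it tb] := tr t tT; rewrite -lfieldE //.
  by apply: (lf_bound lfq).
split; first by have [] := tr h (ltac:(by rewrite ltW)).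
have := mvi_aff (v := X i p) (M := e) (ltW h0) rp; rewrite /= f0 subr0; apply=> t th.
have tT : 0 <= t <= T by move: th hT; clear; nr_lra.
have [it _] := tr t tT.
rewrite -!lfieldE //; apply/ltW; apply: sP.
have t0 : 0 <= t by case/andP: tT.
have tK : nr (cmap i (phi t q) - cmap i q) <= K * t.
  have := mvi (M := K) t0 (rprim_sub (lexx 0) (_ : t <= h) rp); rewrite /= f0 subr0; apply.
    by move: th; clear; nr_lra.
  by move=> u ut; apply: Xb; move: ut tT; clear; nr_lra.
have : K * t <= s / 2.
  have : t <= s / (2 * K) by apply: le_trans dK; move: th hd; clear; nr_lra.
  move=> /(ler_wpM2l (ltW K0)); rewrite (_ : K * (s / (2 * K)) = s / 2) //.
  by field; rewrite gt_eqF.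
have := nr_dist (cmap i (phi t q)) (cmap i q) (cmap i p).
by move: tK qs s's; clear; nr_lra.
Qed.

(** The constant comes from [kob_upper] and does not depend on the curves, so the slope errors can
    be chosen after it. *)
Lemma kob_tangent i p : is_distance k -> cdom i p -> exists2 c : R, 0 < c & forall v v' e e' u w,
  0 < e -> 0 < e' -> tangent i p v e u -> tangent i p v' e' w ->
  exists2 d : R, 0 < d & forall h, 0 < h < d -> k (u h) (w h) <= c * (e + e' + nr (v - v')) * h.
Proof.
move=> kd ip; have [c [U [c0 Up kU]]] := kob_upper kd ip.
exists c => // v v' e e' u w e0 e'0 tu tw.
have [d1 d10 h1] := tangent_nbhs ip e0 tu Up.
have [d2 d20 h2] := tangent_nbhs ip e'0 tw Up.
have [d3 d30 h3] := tu; have [d4 d40 h4] := tw.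
exists (Num.min (Num.min d1 d2) (Num.min d3 d4)); first by rewrite !lt_min d10 d20 d30.
move=> h; rewrite !lt_min => /andP[h0 /andP[/andP[hd1 hd2] /andP[hd3 hd4]]].
apply: (le_trans (kU _ _ (h1 h (ltac:(by rewrite h0))) (h2 h (ltac:(by rewrite h0))))).
rewrite -mulrA ler_pM2l //.
have [_ {}h3] := h3 h (ltac:(by rewrite h0)); have [_ {}h4] := h4 h (ltac:(by rewrite h0)).
move: h3 h4; set x := cmap i (u h); set y := cmap i (w h); set o := cmap i p => h3 h4.
have -> : x - y = (x - o - rc h *: v) + rc h *: (v - v') - (y - o - rc h *: v') by lmod (Cplx R) V.
have -> : (e + e' + nr (v - v')) * h = e * h + nr (v - v') * h + e' * h by ring.
apply: (le_trans (nrB _ _)); apply: lerD => //.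
apply: (le_trans (nrD _ _)); rewrite nrZr ger0_norm ?(ltW h0) // (mulrC h) lerD2r.
exact: h3.
Qed.

(* The hypothesis is that the upper Dini derivative at 0 of [k (z t) (w t)] is at most 0,
   for all integral curves; it is applied to [z] and its translate by [s]. *)
Lemma icurve_nonexp X z T s : is_distance k ->
  (forall z w T, 0 < T -> icurve X z T -> icurve X w T -> forall e : R, 0 < e ->
    exists2 d : R, 0 < d & forall h, 0 < h < d -> h <= T -> k (z h) (w h) <= k (z 0) (w 0) + e * h) ->
  icurve X z T -> 0 <= s <= T -> k (z (T - s)) (z T) <= k (z 0) (z s).
Proof.
move=> kd A zX /andP[s0 sT].
have Ts : 0 <= T - s by rewrite subr_ge0.
have := @dini_le R (fun t => k (z t) (z (s + t))) 0 (T - s) Ts.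
rewrite addr0 (_ : s + (T - s) = T); last by ring.
apply.
  move=> t tT e e0; have e2 : 0 < e / 2 by rewrite divr_gt0.
  have [zc _] := zX.
  have [d1 d10 h1] := zc t (ltac:(move: tT s0; clear; nr_lra)) _ (kob_near kd (z t) e2).
  have [d2 d20 h2] := zc (s + t) (ltac:(move: tT s0; clear; nr_lra)) _ (kob_near kd (z (s + t)) e2).
  exists (Num.min d1 d2); first by rewrite lt_min d10.
  move=> t' t'T; rewrite lt_min => /andP[td1 td2].
  have {}h1 : k (z t) (z t') < e / 2 by apply: h1 => //; move: t'T s0; clear; nr_lra.
  have {}h2 : k (z (s + t)) (z (s + t')) < e / 2.
    apply: h2; first by move: t'T s0; clear; nr_lra.
    by rewrite opprD addrACA subrr add0r.
  rewrite /distR ltr_norml.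
  have := kob_tri kd (z t') (z t) (z (s + t')); have := kob_tri kd (z t) (z (s + t)) (z (s + t')).
  have := kob_tri kd (z t) (z t') (z (s + t)); have := kob_tri kd (z t') (z (s + t')) (z (s + t)).
  rewrite (kob_sym kd (z t') (z t)) (kob_sym kd (z (s + t')) (z (s + t))).
  by move: h1 h2; clear; nr_lra.
move=> t /andP[t0 tT] e e0.
have tT' : 0 < T - s - t by rewrite subr_gt0.
have w1 := icurve_sub (_ : T - s - t <= T - t) (icurve_shift t0 zX).
have {}w1 := w1 (ltac:(move: s0; clear; nr_lra)).
have st0 : 0 <= s + t by rewrite addr_ge0.
have w2 := icurve_sub (_ : T - s - t <= T - (s + t)) (icurve_shift st0 zX).
have {}w2 := w2 (ltac:(clear; nr_lra)).
have [d d0 h] := A _ _ _ tT' w1 w2 e e0.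
exists d => // u u0 uT; have := h u u0 (ltac:(move: uT; clear; nr_lra)).
by rewrite !addr0 -addrA.
Qed.

(* By [icurve_nonexp] an integral curve on [0, t[ is Cauchy for [k] at [t]; its limit
   provides an existence time that is uniform near the endpoint. *)
Lemma icurve_extend X : is_distance k -> complete_distance k ->
  (forall z w T, 0 < T -> icurve X z T -> icurve X w T -> forall e : R, 0 < e ->
    exists2 d : R, 0 < d & forall h, 0 < h < d -> h <= T -> k (z h) (w h) <= k (z 0) (w 0) + e * h) ->
  infinitesimal_generator M X.
Proof.
move=> kd kc A; apply: flow_generator => p T T0.
pose P T := exists2 z : R -> M, z 0 = p & icurve X z T.
have start q : exists2 T1 : R, 0 < T1 & exists2 U : set M, nbhs q U & forall q', U q' ->
    exists2 w : R -> M, w 0 = q' & icurve X w T1.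
  have [i iq] := cdom_cover q.
  have [r [K [L [T1 [r0 K0 im Yd lf]]]]] := lfield_data X iq.
  exists T1; first by apply: (lf_T (lf (cmap i q) _)); rewrite subrr nr0 ltW.
  exists [set q' | cdom i q' /\ nr (cmap i q' - cmap i q) < r]; first exact: cmap_nbhs.
  move=> q' [iq' q'r].
  have imq x : nr (x - cmap i q') <= r -> (cmap i @` cdom i) x.
    by move=> xr; apply: im; have := nr_dist x (cmap i q') (cmap i q); move: xr q'r; clear; nr_lra.
  by have [w w0 wX] := icurve_local r0 imq (lf _ (ltW q'r)); exists w; rewrite ?w0 ?cmapK.
apply: (real_induction (P := P) T0); last by rewrite T0 lexx.
- exists (fun=> p) => //; split=> t; last by clear; nr_lra.
  by move=> _ U pU; exists 1 => // s _ _; exact: nbhs_singleton.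
- move=> t /andP[t0 tT] [z z0 zX].
  have [T1 T10 [U zU wU]] := start (z t).
  have [w w0 wX] := wU (z t) (nbhs_singleton zU).
  exists T1 => // s /andP[ts st] sT.
  have cX := icurve_cat t0 (ltW T10) zX wX (esym w0).
  exists (fun u => if u <= t then z u else w (u - t)); first by rewrite t0.
  by apply: icurve_sub cX; exact: ltW.
- move=> t /andP[t0 tT] Pt.
  have ex s : exists z : R -> M, 0 <= s < t -> z 0 = p /\ icurve X z s.
    have [st|nst] := boolP (0 <= s < t); last by exists (fun=> p).
    by have [z z0 zX] := Pt s st; exists z.
  have [z zP] := choice ex.
  pose s m : R := t - t * 2^-1 ^+ m.+1.
  have p2 m : 0 < (2^-1 : R) ^+ m by rewrite exprn_gt0 // invr_gt0.
  have p21 m : (2^-1 : R) ^+ m.+1 <= 2^-1.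
    by rewrite exprS ler_piMr ?invr_ge0 // exprn_ile1 ?invr_ge0 // invf_le1 // ler1n.
  have st m : t / 2 <= s m < t.
    apply/andP; split; last by rewrite /s gtrBl mulr_gt0.
    by have := ler_wpM2l (ltW t0) (p21 m); rewrite /s; clear; nr_lra.
  have st' m : 0 <= s m < t by have := st m; move: t0; clear; nr_lra.
  pose u m := z (s m) (s m).
  (* The fixed curve [c] supplies one modulus of continuity at time 0; by uniqueness all the curves
     from [p] share it. *)
  have t2 : 0 <= t / 2 < t by move: t0; clear; nr_lra.
  have [c0 cX] := zP _ t2; set c := z (t / 2) in c0 cX.
  have key (e : R) : 0 < e -> exists2 d : R, 0 < d & forall a b, 0 <= a -> a <= b -> b < t ->
      b - a < d -> k (z a a) (z b b) < e.
    move=> e0; have [d d0 cd] := cX.1 0 (ltac:(move: t0; clear; nr_lra)) _ (kob_near kd (c 0) e0).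
    exists (Num.min d (t / 2)); first by rewrite lt_min d0; move: t0; clear; nr_lra.
    move=> a b a0 ab bt; rewrite lt_min => /andP[bad bat].
    have [za0 zaX] := zP a (ltac:(move: a0 ab bt; clear; nr_lra)).
    have [zb0 zbX] := zP b (ltac:(move: a0 ab bt; clear; nr_lra)).
    have -> : z a a = z b a.
      by apply: (icurve_unique zaX (icurve_sub ab zbX)); rewrite ?za0 ?zb0 ?a0 ?lexx.
    have := icurve_nonexp (s := b - a) kd A zbX (ltac:(move: a0 ab; clear; nr_lra)).
    rewrite (_ : b - (b - a) = a); last by ring.
    move=> /le_lt_trans; apply.
    have ba0 : 0 <= b - a by rewrite subr_ge0.
    have -> : z b (b - a) = c (b - a).
      apply: (icurve_unique (icurve_sub (_ : b - a <= b) zbX) (icurve_sub (ltW bat) cX)).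
      - by rewrite gerBl.
      - by rewrite zb0 c0.
      - by rewrite ba0 lexx.
    rewrite zb0 -c0; apply: cd; first by rewrite ba0 ltW.
    by rewrite subr0 ger0_norm.
  have sdist m m' : `|s m - s m'| <= t * 2^-1 ^+ m.+1 + t * 2^-1 ^+ m'.+1.
    have := mulr_gt0 t0 (p2 m.+1); have := mulr_gt0 t0 (p2 m'.+1).
    by rewrite ler_norml /s; clear; nr_lra.
  have smal (d : R) : 0 < d -> exists N, forall m, (N <= m)%N -> t * 2^-1 ^+ m.+1 < d.
    move=> d0; have [N hN] := geo_small t d0; exists N => m Nm; apply: le_lt_trans hN.
    rewrite ler_wpM2l ?(ltW t0) //; rewrite ler_wiXn2l ?invr_ge0 ?invf_le1 ?ler1n //.
    exact: leqW.
  have [q uq] : exists q, (fun m => k (u m) q) @ \oo --> (0 : R).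
    apply: kc => e e0; have [d d0 h] := key e e0.
    have [N hN] := smal (d / 2) (ltac:(by rewrite divr_gt0)).
    exists N => m m' Nm Nm'.
    have sd : `|s m - s m'| < d.
      by have := sdist m m'; have := hN m Nm; have := hN m' Nm'; clear; nr_lra.
    have := st' m; have := st' m'; have [mm|mm] := leP (s m) (s m').
      move=> /andP[_ a1] /andP[a2 _]; apply: h => //.
      by rewrite -(ger0_norm (ltac:(by rewrite subr_ge0) : 0 <= s m' - s m)) distrC.
    move=> /andP[a1 _] /andP[_ a2]; rewrite kob_sym //; apply: h => //; first exact: ltW.
    by rewrite -(ger0_norm (ltac:(by rewrite subr_ge0 ltW) : 0 <= s m - s m')).
  have [T1 T10 [U qU wU]] := start q.
  have [e e0 eU] := kob_topology kd qU.
  have /cvgrPdist_lt/(_ e e0)[N1 _ h1] := uq.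
  have [N2 h2] := smal T1 T10.
  (* For this [m] the point [u m] lies in [U], and the time [t - s m] left is below the existence
     time [T1]. *)
  pose m := maxn N1 N2.
  have Um : U (u m).
    apply: eU; rewrite kob_sym //; have := h1 m (leq_maxl _ _).
    by rewrite /= sub0r normrN ger0_norm // kob_ge0.
  have [w w0 wX] := wU _ Um.
  have [z0 zX] := zP _ (st' m).
  have sm0 : 0 <= s m by have /andP[] := st' m.
  have catX := icurve_cat sm0 (ltW T10) zX wX (esym w0).
  exists (fun v => if v <= s m then z (s m) v else w (v - s m)); first by rewrite sm0.
  apply: icurve_sub catX; have := h2 m (leq_maxr _ _); rewrite /s; clear; nr_lra.
Qed.

End Tangency.

(** * The cone of infinitesimal generators *)

Section Cone.
Variables (R : realType) (n : nat) (M : complexManifold R n).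
Local Notation C := (Cplx R).
Local Notation V := (Cn R n).
Local Notation k := (@kobayashi R n M).
Implicit Types (i j : index M) (p q : M) (X Y : vfield M).
Hypothesis hM : complete_hyperbolic M.

(** Integral curves from two points are compared with the images of these points under [F]. The
    triangle inequality costs [2 * c1 * e' * h] and [2 * c2 * e' * h], which add up to [e * h]: this
    is the estimate that [icurve_extend] asks for. *)
Lemma generator_approx X :
  (forall p q i j, cdom i p -> cdom j q -> forall e : R, 0 < e -> exists2 F : R -> M -> M,
    (forall h, 0 <= h -> k (F h p) (F h q) <= k p q) &
    tangent i p (X i p) e (F^~ p) /\ tangent j q (X j q) e (F^~ q)) ->
  infinitesimal_generator M X.
Proof.
have [kd kc] := hM; move=> ap; apply: (icurve_extend kd kc) => z w T T0 zX wX e e0.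
have [i iz] := cdom_cover (z 0); have [j jw] := cdom_cover (w 0).
have [c1 c10 h1] := kob_tangent kd iz; have [c2 c20 h2] := kob_tangent kd jw.
pose e' := e / (2 * c1 + 2 * c2).
have cc : 0 < 2 * c1 + 2 * c2 by rewrite addr_gt0 // mulr_gt0.
have e'0 : 0 < e' by rewrite divr_gt0.
have [F Fk [F1 F2]] := ap _ _ i j iz jw e' e'0.
have [d1 d10 k1] := h1 _ _ _ _ _ _ e'0 e'0 (icurve_tangent T0 e'0 zX iz) F1.
have [d2 d20 k2] := h2 _ _ _ _ _ _ e'0 e'0 (icurve_tangent T0 e'0 wX jw) F2.
exists (Num.min d1 d2); first by rewrite lt_min d10.
move=> h; rewrite lt_min => /andP[h0 /andP[hd1 hd2]] _.
have := k1 h (ltac:(by rewrite h0)); have := k2 h (ltac:(by rewrite h0)).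
have := Fk h (ltW h0); rewrite !subrr !nr0 !addr0.
have := kob_tri kd (z h) (F h (z 0)) (w h).
have := kob_tri kd (F h (z 0)) (F h (w 0)) (w h).
rewrite (kob_sym kd (F h (w 0)) (w h)).
have : e * h = c1 * (e' + e') * h + c2 * (e' + e') * h.
  by rewrite /e'; field; rewrite gt_eqF.
by clear; nr_lra.
Qed.

Lemma generatorD X Y : infinitesimal_generator M X -> infinitesimal_generator M Y ->
  infinitesimal_generator M (X + Y).
Proof.
have [kd kc] := hM.
move=> /generator_flow[phi fX] /generator_flow[psi fY].
apply: generator_approx => p q i j ip jq e e0.
exists (fun h x => phi h (psi h x)).
  move=> h h0; apply: (le_trans (flow_kob kd _ _ fX h0)); exact: (flow_kob kd _ _ fY h0).
have e2 : 0 < e / 2 by rewrite divr_gt0.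
have main i' p' : cdom i' p' -> tangent i' p' ((X + Y) i' p') e (fun h => phi h (psi h p')).
  move=> ip'.
  have [U pU [d d0 hU]] := flow_step fX ip' e2.
  have tY : tangent i' p' (Y i' p') (e / 2) (psi^~ p').
    have [f0 /(_ 1)fC] := fY p'.
    by have := icurve_tangent ltr01 e2 fC; rewrite /= f0; apply.
  have [d1 d10 h1] := tangent_nbhs ip' e2 tY pU.
  have [d2 d20 h2] := tY.
  exists (Num.min d (Num.min d1 d2)); first by rewrite !lt_min d0 d10.
  move=> h; rewrite !lt_min => /andP[h0 /andP[hd /andP[hd1 hd2]]].
  have [iu a1] := hU _ h (h1 h (ltac:(by rewrite h0))) (ltac:(by rewrite h0)).
  have [_ a2] := h2 h (ltac:(by rewrite h0)); split=> //.
  change ((X + Y) i' p') with (X i' p' + Y i' p').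
  move: a1 a2; set x := cmap i' (phi _ _); set y := cmap i' (psi _ _); set o := cmap i' p'.
  have -> : x - o - rc h *: (X i' p' + Y i' p') =
    (x - y - rc h *: X i' p') + (y - o - rc h *: Y i' p') by lmod (Cplx R) V.
  move=> a1 a2; apply: (le_trans (nrD _ _)); apply: (le_trans (lerD a1 a2)).
  by rewrite -mulrDl -splitr.
by split; apply: main.
Qed.

Lemma generatorZ (a : R) X : 0 <= a -> infinitesimal_generator M X ->
  infinitesimal_generator M (a *: X).
Proof.
move=> a0 gX; apply: flow_generator => p T T0.
have [phi fl] := generator_flow gX; have [f0 fX] := fl p.
exists (fun t => phi (a * t) p); first by rewrite mulr0.
(* For [a = 0] the curve is constant; the general estimates divide by [a]. *)
have [->|ane] := eqVneq a 0.
  split=> [t tT U|t tT i]; rewrite mul0r f0 => hp.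
    by exists 1 => // s _ _; rewrite mul0r f0; exact: nbhs_singleton.
  move=> e e0; exists 1 => // h /andP[h0 _] _.
  rewrite /= !mul0r f0 subrr sub0r nrN.
  rewrite (_ : pre_scale 0 X i p = 0); last exact: scale0r.
  by rewrite scaler0 nr0 mulr_ge0 // ltW.
have ap : 0 < a by rewrite lt_neqAle eq_sym ane.
have [zc zd] := fX (a * T).
split=> [t tT U tU|t tT i it e e0].
  have atT : 0 <= a * t <= a * T.
    by case/andP: tT => t0 tT; rewrite mulr_ge0 //= ler_pM2l.
  have [d d0 h] := zc (a * t) atT U tU.
  exists (d / a); first by rewrite divr_gt0.
  move=> s sT; rewrite ltr_pdivlMr // => st; apply: h.
    by case/andP: sT => s0 sT; rewrite mulr_ge0 //= ler_pM2l.
  by rewrite -mulrBr normrM ger0_norm // mulrC.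
have atT : 0 <= a * t < a * T by case/andP: tT => t0 tT; rewrite mulr_ge0 //= ltr_pM2l.
have [d d0 h] := zd (a * t) atT i it (e / a) (ltac:(by rewrite divr_gt0)).
exists (d / a); first by rewrite divr_gt0.
move=> s /andP[s0]; rewrite ltr_pdivlMr // => sd sT.
have := h (a * s) (ltac:(by rewrite mulr_gt0 //= mulrC)) (ltac:(by rewrite -mulrDr ler_pM2l)).
rewrite /= -mulrDr rcM (mulrC (rc a)) -scalerA mulrA divfK ?gt_eqF //.
Qed.

Lemma generator0 : infinitesimal_generator M 0.
Proof.
apply: flow_generator => p T T0; exists (fun=> p) => //.
split=> [t tT U tU|t tT i it e e0].
  by exists 1 => // s _ _; exact: nbhs_singleton.
exists 1 => // h /andP[h0 _] _.
change (nr ((cmap i p - cmap i p) - rc h *: (0 : Cn R n)) <= e * h).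
by rewrite subrr scaler0 subr0 nr0 mulr_ge0 // ltW.
Qed.

(** Singletons are compact, so evaluation at a point of a chart is continuous; closedness follows
    from two such evaluations at a time. *)
Lemma vfield_eval_nbhs X i p (e : R) : cdom i p -> 0 < e ->
  nbhs X [set Y : vfield M | nr (Y i p - X i p) < e].
Proof.
move=> ip e0.
have cX : vfield_chart i @ nbhs X --> vfield_chart i X.
  have /cvg_sup/(_ i)h : nbhs X --> X by exact: cvg_id.
  apply: (cvg_trans (cvg_app _ h)); exact: initial_continuous.
move/fam_cvgP: cX => /(_ [set p]).
have hp : compactly_in (cdom i) [set p] by split=> [? ->//|]; exact: compact_set1.
move=> /(_ hp); rewrite uniform_set1 => h.
have := h [set v | nr (v - X i p) < e] (ltac:(by apply/nbhs_nr; exists e)).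
by [].
Qed.

Lemma generator_closed : closed (infinitesimal_generator M).
Proof.
have [kd kc] := hM => X clX.
apply: generator_approx => p q i j ip jq e e0.
have e2 : 0 < e / 2 by rewrite divr_gt0.
have [Y [gY [Yp Yq]]] := clX _ (filterI (vfield_eval_nbhs X ip e2) (vfield_eval_nbhs X jq e2)).
have [phi fl] := generator_flow gY.
exists phi; first by move=> h h0; exact: (flow_kob kd _ _ fl h0).
have main i' p' : cdom i' p' -> nr (Y i' p' - X i' p') < e / 2 -> tangent i' p' (X i' p') e (phi^~ p').
  move=> ip' YX; have [f0 /(_ 1)fC] := fl p'.
  have := icurve_tangent ltr01 e2 fC; rewrite /= f0 => /(_ _ ip')[d d0 h].
  exists d => // u ud; have [iu hu] := h u ud; split=> //.
  have /andP[u0 _] := ud.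
  rewrite -(subrK (rc u *: Y i' p') (cmap i' (phi u p') - cmap i' p')) -addrA -scalerBr.
  apply: (le_trans (nrD _ _)); rewrite nrZr ger0_norm ?(ltW u0) //.
  rewrite [in leRHS](splitr e) mulrDl (mulrC u); apply: lerD; first exact: hu.
  by rewrite ler_wpM2r ?(ltW u0) // ltW.
by split; apply: main.
Qed.

End Cone.

Theorem corollary2p7 (R : realType) (n : nat) (M : complexManifold R n)
    (hM : complete_hyperbolic M) :
  closed (infinitesimal_generator M) /\
  convex_cone0 (infinitesimal_generator M).
Proof.
split; first exact: generator_closed.
split; [exact: generator0 | exact: generatorD | exact: generatorZ].
Qed.
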